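(* Let $Q$ be a finite connected quiver and let $\Lambda=\widehat{KQ}/\overline{\langle R\rangle}$ be a finite dimensional algebra, where $R$ is a minimal set of relations. Assume $\operatorname{gl.dim}\Lambda\le 2$. Let $k\in Q_0$ be a source of $Q$ such that the simple projective $\Lambda$-module $P_k$ is non-injective, and let $T_k:=\tau^-P_k\oplus\Lambda/P_k$ be the APR tilting $\Lambda$-module associated with $k$. Then there is an algebra isomorphism $$\operatorname{End}_\Lambda(T_k)\cong\mathcal P(\mu_k^L(Q_\Lambda,W_\Lambda,C_\Lambda)).$$
   Context: $K$ is an algebraically closed field. All modules are left modules; the composition $fg$ of morphisms means first $f$, then $g$. For a quiver $Q$, $Q_0$ and $Q_1$ are the sets of vertices and arrows; an arrow or path $a$ goes from $s(a)$ to $e(a)$, and paths are composed from left to right ($ab$ means first $a$, then $b$). $P_i=\Lambda e_i$ is the indecomposable projective at $i$; $\tau^-$ is the inverse Auslander–Reiten translation; $\Lambda/P_k$ is the direct sum of the $P_i$ with $i\ne k$. Complete path algebra: $\widehat{KQ}=\prod_{i\ge0}KQ_i$, where $KQ_i$ is the span of paths of length $i$; bars denote closure in the radical-adic topology. A relation is a (possibly infinite) formal linear combination of paths of length at least 2 with a common start and a common end. A set $R$ of relations is minimal if $r\notin\overline{\langle R\setminus\{r\}\rangle}$ for all $r\in R$. QP: a pair $(Q,W)$, $Q$ a finite quiver, $W$ (the potential) in $\prod_{i\ge2}KQ_{i,\rm cyc}$, where $KQ_{i,\rm cyc}$ is spanned by cycles of length $i$. The cyclic derivative $\partial_a$ is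 the continuous linear map with $\partial_a(a_1\cdots a_d)=\sum_{a_i=a}a_{i+1}\cdots a_da_1\cdots a_{i-1}$ on cycles. The Jacobian algebra is $\mathcal P(Q,W)=\widehat{KQ}/\overline{\langle\partial_aW\mid a\in Q_1\rangle}$. Potentials $W,W'$ are cyclically equivalent if $W-W'$ is in the closure of the span of all $a_1\cdots a_d-a_2\cdots a_da_1$ with $a_1\cdots a_d$ a cycle. A QP is reduced if $W\in\prod_{i\ge3}KQ_{i,\rm cyc}$, and trivial if $W$ is a linear combination of 2-cycles and $\mathcal P(Q,W)\cong\widehat{KQ_0}$ (the semisimple algebra on the vertices). The direct sum of QPs with the same vertex set is the QP with the disjoint union of arrows and the sum of potentials. Cut: $C\subset Q_1$ such that each cycle appearing in $W$ contains exactly one arrow of $C$. The truncated Jacobian algebra is $\mathcal P(Q,W,C)=\mathcal P(Q,W)/\overline{\langle C\rangle}=\widehat{KQ_C}/\overline{\langle\partial_cW\mid c\in C\rangle}$, where $Q_C$ has vertices $Q_0$ and arrows $Q_1\setminus C$. QP associated with $\Lambda$: $(Q_\Lambda)_0=Q_0$, $(Q_\Lambda)_1=Q_1\sqcup C_\Lambda$ with $C_\Lambda=\{\rho_r:e(r)\to s(r)\mid r\in R\}$, and $W_\Lambda=\sum_{r\in R}\rho_rr$. The set $C_\Lambda$ is a cut. Grading: a QP with a cut $C$ is regarded as a $\mathbb Z$-graded QP $(Q,W,C)$, homogeneous of degree $1$, with arrows in $C$ of degree $d=1$ and the other arrows of degree $d=0$. Graded right-equivalence of graded QPs on the same vertex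 set: a degree preserving algebra isomorphism of complete path algebras that is the identity on $\widehat{KQ_0}$ and sends the first potential to a potential cyclically equivalent to the second. Left mutation. For a vertex $k$ not lying on a loop and a graded QP $(Q,W,d)$ of degree $1$ (with $W$ replaced, if necessary, by a cyclically equivalent potential no cycle of which starts at $k$), $\widetilde\mu_k^L(Q,W,d)=(Q',W',d')$ where: $Q'$ is obtained from $Q$ by replacing each arrow $a:k\to v$ by $a^*:v\to k$, each arrow $b:u\to k$ by $b^*:k\to u$, and adding an arrow $[ba]:u\to v$ for each pair $u\xrightarrow{b}k\xrightarrow{a}v$; $W'=[W]+\sum_{e(b)=k=s(a)}[ba]a^*b^*$, with $[W]$ obtained from $W$ by replacing each composition $ba$ through $k$ by $[ba]$; $d'(a)=d(a)$ for arrows common to $Q$ and $Q'$, $d'(a^* )=-d(a)$ if $s(a)=k$, $d'(b^* )=-d(b)+1$ if $e(b)=k$, $d'([ba])=d(a)+d(b)$. For $(Q_\Lambda,W_\Lambda,C_\Lambda)$ and the source $k$ of $Q$, all degrees of $\widetilde\mu_k^L(Q_\Lambda,W_\Lambda,C_\Lambda)$ are $0$ or $1$ and the arrows of degree $1$ form a cut. A graded QP with a cut is graded right-equivalent to the direct sum of a reduced and a trivial one, unique up to graded right-equivalence; the reduced summand is called the reduced part. $\mu_k^L(Q_\Lambda,W_\Lambda,C_\Lambda)$ denotes the reduced part of $\widetilde\mu_k^L(Q_\Lambda,W_\Lambda,C_\Lambda)$, with the cut given by its degree $1$ arrows. *)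

(* Defs.v *)
From HB Require Import structures.
From mathcomp Require Import all_boot all_order all_algebra.
From mathcomp Require Import boolp classical_sets functions.

Set Implicit Arguments.
Unset Strict Implicit.
Unset Printing Implicit Defensive.

Import GRing.Theory.

Local Open Scope classical_set_scope.
Local Open Scope ring_scope.

(** * Algebras and modules *)

(* MathComp's algType requires 1 != 0; quotients and endomorphism rings may be
   zero, hence this variant over possibly trivial rings, presented by the
   structure map K -> A with central image. *)
HB.mixin Record isPzAlgebra (K : pzRingType) A of GRing.PzRing A := {
  kalg : K -> A;
  kalg_zmod : zmod_morphism kalg;
  kalg_monoid : monoid_morphism kalg;
  kalg_central : forall c x, kalg c * x = x * kalg c
}.

#[short(type="pzAlgType")]
HB.structure Definition PzAlgebra (K : pzRingType) :=
  {A of GRing.PzRing A & isPzAlgebra K A}.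

Section StructureMap.
Variables (K : pzRingType) (A : pzAlgType K).
HB.instance Definition _ :=
  GRing.isZmodMorphism.Build K A (@kalg K A) (@kalg_zmod K A).
HB.instance Definition _ :=
  GRing.isMonoidMorphism.Build K A (@kalg K A) (@kalg_monoid K A).
End StructureMap.

Definition alg_iso (K : pzRingType) (A B : pzAlgType K) : Prop :=
  exists f : {rmorphism A -> B},
    bijective f /\ forall c : K, f (kalg c) = kalg c.

Definition fin_dim (K : pzRingType) (A : pzAlgType K) : Prop :=
  exists (n : nat) (v : 'I_n -> A),
    forall x, exists c : 'I_n -> K, x = \sum_(i < n) kalg (c i) * v i.

Definition surjective (T U : Type) (f : T -> U) : Prop :=
  forall y, exists x, f x = y.

(** ** Submodules, quotient modules, left ideals *)

Section Submodules.
Variables (R : pzRingType) (M : lmodType R).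

Definition is_submod (S : set M) : Prop :=
  S 0 /\ forall (a : R) x y, S x -> S y -> S (a *: x + y).

Record submod := Submod { submod_set : set M; submodP : is_submod submod_set }.

Definition lin_span (S : set M) : set M :=
  [set x | forall N : set M, is_submod N -> S `<=` N -> N x].

Variable S : submod.

Definition submod_pred : {pred M} := fun x => `[< submod_set S x >].

Lemma submod_pred_closed : submod_closed submod_pred.
Proof.
have [S0 SD] := submodP S; split; first exact/asboolP.
by move=> a x y /asboolP Sx /asboolP Sy; apply/asboolP; apply: SD.
Qed.
HB.instance Definition _ :=
  GRing.isSubmodClosed.Build R M submod_pred submod_pred_closed.

Lemma submod_pred_zmod : zmod_closed submod_pred.
Proof.
have [S0 SD] := submod_pred_closed; split=> // x y Sx Sy.
by rewrite -[- y]scaleN1r addrC; apply: SD.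
Qed.
HB.instance Definition _ :=
  GRing.isZmodClosed.Build M submod_pred submod_pred_zmod.

Definition submodT := {x : M | submod_pred x}.
HB.instance Definition _ := Choice.on submodT.
HB.instance Definition _ := SubType.on submodT.
HB.instance Definition _ := [SubChoice_isSubLmodule of submodT by <:].

Definition modquot : Type := Quotient.quot submod_pred.
HB.instance Definition _ := GRing.Zmodule.on modquot.

Definition modquot_pi (x : M) : modquot := \pi_(Quotient.quot submod_pred)%qT x.

Lemma modquot_piE x y : modquot_pi x = modquot_pi y <-> submod_set S (x - y).
Proof.
rewrite /modquot_pi; split.
  by move/eqP; rewrite -Quotient.idealrBE => /asboolP.
by move=> Sxy; apply/eqP; rewrite -Quotient.idealrBE; apply/asboolP.
Qed.

Lemma modquot_piB x y : modquot_pi (x - y) = modquot_pi x - modquot_pi y.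
Proof. by rewrite /modquot_pi !piE. Qed.

Lemma modquot_piD x y : modquot_pi (x + y) = modquot_pi x + modquot_pi y.
Proof. by rewrite /modquot_pi !piE. Qed.

Definition modquot_repr (u : modquot) : M := repr (u : Quotient.quot submod_pred).

Lemma modquot_reprK u : modquot_pi (modquot_repr u) = u.
Proof. exact: reprK. Qed.

Definition modquot_scale (a : R) (u : modquot) : modquot :=
  modquot_pi (a *: modquot_repr u).

Lemma modquot_piZ a x : modquot_pi (a *: x) = modquot_scale a (modquot_pi x).
Proof.
have [S0 SD] := submodP S; apply/modquot_piE; rewrite -scalerBr -[_ *: _]addr0.
by apply: SD => //; apply/modquot_piE; rewrite modquot_reprK.
Qed.

Lemma modquot_scaleA a b u :
  modquot_scale a (modquot_scale b u) = modquot_scale (a * b) u.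
Proof. by rewrite -(modquot_reprK u) -!modquot_piZ scalerA. Qed.
Lemma modquot_scale1 : left_id 1 modquot_scale.
Proof. by move=> u; rewrite -(modquot_reprK u) -!modquot_piZ scale1r. Qed.
Lemma modquot_scaleDr : right_distributive modquot_scale +%R.
Proof.
move=> a u v; rewrite -(modquot_reprK u) -(modquot_reprK v) -modquot_piD.
by rewrite -!modquot_piZ scalerDr modquot_piD.
Qed.
Lemma modquot_scaleDl u : {morph modquot_scale^~ u : a b / a + b}.
Proof.
move=> a b; rewrite /= -(modquot_reprK u).
by rewrite -!modquot_piZ scalerDl modquot_piD.
Qed.
HB.instance Definition _ := GRing.Zmodule_isLmodule.Build R modquot
  modquot_scaleA modquot_scale1 modquot_scaleDr modquot_scaleDl.

End Submodules.

(** ** Two-sided ideals and quotient algebras *)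

Section Ideals.
Variable A : pzRingType.

Definition is_ideal (I : set A) : Prop :=
  [/\ I 0, forall x y, I x -> I y -> I (x - y) &
      forall a x, I x -> I (a * x) /\ I (x * a)].

Record ideal := Ideal { ideal_set : set A; idealP : is_ideal ideal_set }.

Definition ideal_span (S : set A) : set A :=
  [set x | forall I : set A, is_ideal I -> S `<=` I -> I x].

Lemma ideal_span_ideal S : is_ideal (ideal_span S).
Proof.
split=> [I [] //|x y Ix Iy I idI SI|a x Ix].
  by have [_ IB _] := idI; apply: IB; [apply: Ix|apply: Iy].
by split=> I idI SI; have [_ _ /(_ a x (Ix I idI SI))[]] := idI.
Qed.

Variable I : ideal.

Definition ideal_pred : {pred A} := fun x => `[< ideal_set I x >].

Lemma ideal_pred_zmod : zmod_closed ideal_pred.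
Proof.
have [I0 IB _] := idealP I; split; first exact/asboolP.
by move=> x y /asboolP Ix /asboolP Iy; apply/asboolP; apply: IB.
Qed.
HB.instance Definition _ :=
  GRing.isZmodClosed.Build A ideal_pred ideal_pred_zmod.

Definition qalg : Type := Quotient.quot ideal_pred.
HB.instance Definition _ := GRing.Zmodule.on qalg.

Definition qalg_pi (x : A) : qalg := \pi_(Quotient.quot ideal_pred)%qT x.

Lemma qalg_piE x y : qalg_pi x = qalg_pi y <-> ideal_set I (x - y).
Proof.
rewrite /qalg_pi; split.
  by move/eqP; rewrite -Quotient.idealrBE => /asboolP.
by move=> Ixy; apply/eqP; rewrite -Quotient.idealrBE; apply/asboolP.
Qed.

Definition qalg_repr (u : qalg) : A := repr (u : Quotient.quot ideal_pred).

Lemma qalg_reprK u : qalg_pi (qalg_repr u) = u.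
Proof. exact: reprK. Qed.

Lemma qalg_piB x y : qalg_pi (x - y) = qalg_pi x - qalg_pi y.
Proof. by rewrite /qalg_pi !piE. Qed.

Lemma qalg_piD x y : qalg_pi (x + y) = qalg_pi x + qalg_pi y.
Proof. by rewrite /qalg_pi !piE. Qed.

Definition qalg_mul (u v : qalg) : qalg := qalg_pi (qalg_repr u * qalg_repr v).

Lemma qalg_piM x y : qalg_pi (x * y) = qalg_mul (qalg_pi x) (qalg_pi y).
Proof.
have [I0 IB IM] := idealP I; apply/qalg_piE.
have Ir z : ideal_set I (z - qalg_repr (qalg_pi z)).
  by apply/qalg_piE; rewrite qalg_reprK.
set x' := qalg_repr _; set y' := qalg_repr _.
have -> : x * y - x' * y' = x * (y - y') - x' * y' + x * y'.
  by rewrite mulrBr addrAC subrK.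
rewrite -addrA [- _ + _]addrC -mulrBl -[(x - x') * y']opprK; apply: (IB).
  by have [] := IM x _ (Ir y).
by rewrite -sub0r; apply: (IB) => //; have [] := IM y' _ (Ir x).
Qed.

Lemma qalg_mulA : associative qalg_mul.
Proof.
move=> u v w; rewrite -(qalg_reprK u) -(qalg_reprK v) -(qalg_reprK w).
by rewrite -!qalg_piM mulrA.
Qed.
Lemma qalg_mul1 : left_id (qalg_pi 1) qalg_mul.
Proof. by move=> u; rewrite -(qalg_reprK u) -!qalg_piM mul1r. Qed.
Lemma qalg_mulr1 : right_id (qalg_pi 1) qalg_mul.
Proof. by move=> u; rewrite -(qalg_reprK u) -!qalg_piM mulr1. Qed.
Lemma qalg_mulDl : left_distributive qalg_mul +%R.
Proof.
move=> u v w; rewrite -(qalg_reprK u) -(qalg_reprK v) -(qalg_reprK w).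
by rewrite -qalg_piD -!qalg_piM mulrDl qalg_piD.
Qed.
Lemma qalg_mulDr : right_distributive qalg_mul +%R.
Proof.
move=> u v w; rewrite -(qalg_reprK u) -(qalg_reprK v) -(qalg_reprK w).
by rewrite -qalg_piD -!qalg_piM mulrDr qalg_piD.
Qed.
HB.instance Definition _ := GRing.Zmodule_isPzRing.Build qalg
  qalg_mulA qalg_mul1 qalg_mulr1 qalg_mulDl qalg_mulDr.

End Ideals.

Section QuotientAlgebra.
Variables (K : pzRingType) (A : pzAlgType K) (I : ideal A).

Definition qalg_kalg (c : K) : qalg I := qalg_pi I (kalg c).

Lemma qalg_kalg_zmod : zmod_morphism qalg_kalg.
Proof. by move=> c d; rewrite /qalg_kalg kalg_zmod qalg_piB. Qed.
Lemma qalg_kalg_monoid : monoid_morphism qalg_kalg.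
Proof.
have [k1 kM] := @kalg_monoid K A.
by split=> [|c d]; rewrite /qalg_kalg (k1, kM) // qalg_piM.
Qed.
Lemma qalg_kalg_central c u : qalg_kalg c * u = u * qalg_kalg c.
Proof.
rewrite -(qalg_reprK u) /qalg_kalg.
by rewrite -[LHS]qalg_piM -[RHS]qalg_piM kalg_central.
Qed.
HB.instance Definition _ := isPzAlgebra.Build K (qalg I)
  qalg_kalg_zmod qalg_kalg_monoid qalg_kalg_central.

End QuotientAlgebra.

(** ** Homomorphisms *)

Section Hom.
Variables (R : pzRingType) (M N : lmodType R).

Definition hom : Type := {linear M -> N}.
HB.instance Definition _ := gen_eqMixin hom.
HB.instance Definition _ := gen_choiceMixin hom.

Definition hom_app (f : hom) : M -> N := f : {linear M -> N}.
Coercion hom_app : hom >-> Funclass.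

Lemma homP (f g : hom) : f =1 g -> f = g.
Proof.
case: f g => [f [[f1] [f2]]] [g [[g1] [g2]]] /= /funext fg.
rewrite /hom_app /= in fg; subst g.
by congr GRing.Linear.Pack; congr GRing.Linear.Class; congr (_ _);
  apply: Prop_irrelevance.
Qed.

Definition hom0 : hom := (\0 : M -> N) : {linear M -> N}.
Definition hom_add (f g : hom) : hom :=
  ((f : {linear M -> N}) \+ (g : {linear M -> N})) : {linear M -> N}.
Definition hom_opp (f : hom) : hom :=
  (\- (f : {linear M -> N})) : {linear M -> N}.

Lemma hom_addA : associative hom_add.
Proof. by move=> f g h; apply: homP => x; rewrite /hom_app /= addrA. Qed.
Lemma hom_addC : commutative hom_add.
Proof. by move=> f g; apply: homP => x; rewrite /hom_app /= addrC. Qed.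
Lemma hom_add0 : left_id hom0 hom_add.
Proof. by move=> f; apply: homP => x; rewrite /hom_app /= add0r. Qed.
Lemma hom_addN : left_inverse hom0 hom_opp hom_add.
Proof. by move=> f; apply: homP => x; rewrite /hom_app /= addNr. Qed.
HB.instance Definition _ := GRing.isZmodule.Build hom
  hom_addA hom_addC hom_add0 hom_addN.

Lemma hom_appD (f g : hom) x : (f + g) x = f x + g x. Proof. by []. Qed.
Lemma hom_app_add (f : hom) x y : f (x + y) = f x + f y.
Proof. exact: (raddfD (f : {linear M -> N})). Qed.
Lemma hom_app_scale (f : hom) a x : f (a *: x) = a *: f x.
Proof. exact: (linearZ_LR (f : {linear M -> N})). Qed.

Definition mk_hom (f : M -> N) (fl : linear f) : hom :=
  let F := GRing.isLinear.Build R M N *:%R f fl in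
  HB.pack_for {linear M -> N} f F.

End Hom.

Definition hom_comp (R : pzRingType) (L M N : lmodType R)
    (f : hom L M) (g : hom M N) : hom L N :=
  ((g : {linear M -> N}) \o (f : {linear L -> M})) : {linear L -> N}.

Definition mod_iso (R : pzRingType) (M N : lmodType R) : Prop :=
  exists f : hom M N, bijective f.

(** ** Endomorphism algebras *)

Section End.
Variables (K : pzRingType) (A : pzAlgType K) (M : lmodType A).

Definition endalg : Type := hom M M.
HB.instance Definition _ := GRing.Zmodule.on endalg.

(* The product f * g is "first f, then g". *)
Definition end_mul (f g : endalg) : endalg := hom_comp f g.
Definition end_one : endalg := (idfun : M -> M) : {linear M -> M}.

Lemma end_mulA : associative end_mul.
Proof. by move=> f g h; apply: homP => x. Qed.
Lemma end_mul1 : left_id end_one end_mul.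
Proof. by move=> f; apply: homP => x. Qed.
Lemma end_mulr1 : right_id end_one end_mul.
Proof. by move=> f; apply: homP => x. Qed.
Lemma end_mulDl : left_distributive end_mul +%R.
Proof. by move=> f g h; apply: homP => x; apply: hom_app_add. Qed.
Lemma end_mulDr : right_distributive end_mul +%R.
Proof. by move=> f g h; apply: homP => x. Qed.
HB.instance Definition _ := GRing.Zmodule_isPzRing.Build endalg
  end_mulA end_mul1 end_mulr1 end_mulDl end_mulDr.

Lemma end_kalg_linear c : linear (fun x : M => kalg c *: x).
Proof. by move=> a x y; rewrite scalerDr !scalerA kalg_central. Qed.
Definition end_kalg (c : K) : endalg := mk_hom (end_kalg_linear c).

Lemma end_kalg_zmod : zmod_morphism end_kalg.
Proof. by move=> c d; apply: homP => x; rewrite /hom_app /= kalg_zmod scalerBl. Qed.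
Lemma end_kalg_monoid : monoid_morphism end_kalg.
Proof.
have [k1 kM] := @kalg_monoid K A; split=> [|c d]; apply: homP => x.
  by rewrite /hom_app /= k1 scale1r.
by rewrite /hom_app /= kM scalerA kalg_central.
Qed.
Lemma end_kalg_central c (f : endalg) : end_kalg c * f = f * end_kalg c.
Proof. by apply: homP => x; apply: hom_app_scale. Qed.
HB.instance Definition _ := isPzAlgebra.Build K endalg
  end_kalg_zmod end_kalg_monoid end_kalg_central.

End End.

(** ** Direct sums over a finite index type *)

Section DirectSum.
Variables (R : pzRingType) (J : finType) (M : J -> lmodType R).

Definition dsum : Type := forall j, M j.
HB.instance Definition _ := gen_eqMixin dsum.
HB.instance Definition _ := gen_choiceMixin dsum.

Definition dsum0 : dsum := fun=> 0.
Definition dsum_add (x y : dsum) : dsum := fun j => x j + y j.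
Definition dsum_opp (x : dsum) : dsum := fun j => - x j.
Definition dsum_scale (a : R) (x : dsum) : dsum := fun j => a *: x j.

Lemma dsum_addA : associative dsum_add.
Proof. by move=> x y z; apply: functional_extensionality_dep => j; apply: addrA. Qed.
Lemma dsum_addC : commutative dsum_add.
Proof. by move=> x y; apply: functional_extensionality_dep => j; apply: addrC. Qed.
Lemma dsum_add0 : left_id dsum0 dsum_add.
Proof. by move=> x; apply: functional_extensionality_dep => j; apply: add0r. Qed.
Lemma dsum_addN : left_inverse dsum0 dsum_opp dsum_add.
Proof. by move=> x; apply: functional_extensionality_dep => j; apply: addNr. Qed.
HB.instance Definition _ := GRing.isZmodule.Build dsum
  dsum_addA dsum_addC dsum_add0 dsum_addN.

Lemma dsum_scaleA a b x : dsum_scale a (dsum_scale b x) = dsum_scale (a * b) x.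
Proof. by apply: functional_extensionality_dep => j; apply: scalerA. Qed.
Lemma dsum_scale1 : left_id 1 dsum_scale.
Proof. by move=> x; apply: functional_extensionality_dep => j; apply: scale1r. Qed.
Lemma dsum_scaleDr : right_distributive dsum_scale +%R.
Proof. by move=> a x y; apply: functional_extensionality_dep => j; apply: scalerDr. Qed.
Lemma dsum_scaleDl x : {morph dsum_scale^~ x : a b / a + b}.
Proof. by move=> a b; apply: functional_extensionality_dep => j; apply: scalerDl. Qed.
HB.instance Definition _ := GRing.Zmodule_isLmodule.Build R dsum
  dsum_scaleA dsum_scale1 dsum_scaleDr dsum_scaleDl.

End DirectSum.

(** ** Homological notions *)

Section Homological.
Variable R : pzRingType.

Definition projective (P : lmodType R) : Prop :=
  forall (X Y : lmodType R) (p : hom X Y) (g : hom P Y), surjective p ->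
    exists h : hom P X, forall x, p (h x) = g x.

Definition injective_mod (E : lmodType R) : Prop :=
  forall (X Y : lmodType R) (i : hom X Y) (g : hom X E), injective i ->
    exists h : hom Y E, forall x, h (i x) = g x.

Definition exact_at (L M N : lmodType R) (f : hom L M) (g : hom M N) : Prop :=
  forall y, g y = 0 <-> exists x, f x = y.

Fixpoint pd_le (n : nat) (M : lmodType R) : Prop :=
  if n is n'.+1 then
    exists (L P : lmodType R) (i : hom L P) (p : hom P M),
      [/\ projective P, injective i, surjective p, exact_at i p & pd_le n' L]
  else projective M.

Definition gldim_le (n : nat) : Prop := forall M : lmodType R, pd_le n M.

(* The kernel of f is superfluous: no proper submodule S satisfies
   S + ker f = P. *)
Definition superfluous_ker (P M : lmodType R) (f : hom P M) : Prop :=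
  forall S : set P, is_submod S ->
    (forall x, exists2 y, S y & f y = f x) -> forall x, S x.

Definition min_proj_presentation (P1 P0 N : lmodType R)
    (f : hom P1 P0) (g : hom P0 N) : Prop :=
  [/\ projective P1 /\ projective P0, surjective g, exact_at f g,
      superfluous_ker f & superfluous_ker g].

End Homological.

(** ** The K-dual, the transpose and the inverse Auslander-Reiten translation *)

Section Restriction.
Variables (K : pzRingType) (A : pzAlgType K) (M : lmodType A).

(* M with scalars restricted along the structure map K -> A. *)
Definition restr : Type := M.
HB.instance Definition _ := GRing.Zmodule.on restr.

Definition restr_scale (c : K) (x : restr) : restr := kalg c *: (x : M).

Lemma restr_scaleA a b x : restr_scale a (restr_scale b x) = restr_scale (a * b) x.
Proof. by rewrite /restr_scale scalerA (@kalg_monoid K A).2. Qed.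
Lemma restr_scale1 : left_id 1 restr_scale.
Proof. by move=> x; rewrite /restr_scale (@kalg_monoid K A).1 scale1r. Qed.
Lemma restr_scaleDr : right_distributive restr_scale +%R.
Proof. by move=> a x y; apply: scalerDr. Qed.
Lemma restr_scaleDl x : {morph restr_scale^~ x : a b / a + b}.
Proof.
by move=> a b; rewrite /restr_scale rmorphD scalerDl.
Qed.
HB.instance Definition _ := GRing.Zmodule_isLmodule.Build K restr
  restr_scaleA restr_scale1 restr_scaleDr restr_scaleDl.
End Restriction.

(* Right A-modules are left modules over the converse ring A^c. *)
Section Dual.
Variables (K : pzRingType) (A : pzAlgType K) (M : lmodType A).

(* D M = Hom_K(M, K), with (phi . a) x = phi (a x). *)
Definition dual : Type := hom (restr M) K^o.
HB.instance Definition _ := GRing.Zmodule.on dual.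

Lemma dual_scale_linear (a : A) (phi : dual) :
  linear ((fun x => phi (a *: (x : M))) : restr M -> K^o).
Proof.
move=> c x y; rewrite -hom_app_scale -hom_app_add.
congr (hom_app phi _); rewrite scalerDr; congr (_ + _).
change (a *: (kalg c *: (x : M)) = kalg c *: (a *: (x : M))).
by rewrite !scalerA kalg_central.
Qed.
Definition dual_scale (a : A^c) (phi : dual) : dual :=
  mk_hom (dual_scale_linear a phi).

Lemma dual_scaleA a b phi : dual_scale a (dual_scale b phi) = dual_scale (a * b) phi.
Proof. by apply: homP => x; rewrite /hom_app /= scalerA. Qed.
Lemma dual_scale1 : left_id 1 dual_scale.
Proof. by move=> phi; apply: homP => x; rewrite {1}/hom_app /= scale1r. Qed.
Lemma dual_scaleDr : right_distributive dual_scale +%R.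
Proof. by move=> a phi psi; apply: homP. Qed.
Lemma dual_scaleDl phi : {morph dual_scale^~ phi : a b / a + b}.
Proof.
move=> a b; apply: homP => x.
by rewrite {1}/hom_app /= scalerDl; apply: hom_app_add.
Qed.
HB.instance Definition _ := GRing.Zmodule_isLmodule.Build A^c dual
  dual_scaleA dual_scale1 dual_scaleDr dual_scaleDl.
End Dual.

Section Star.
Variables (A : pzRingType).

(* P^* = Hom(P, A) for a right A-module P, with (a . phi) x = a * phi x. *)
Definition star (P : lmodType A^c) : Type := hom P (A^c)^o.
HB.instance Definition _ (P : lmodType A^c) := GRing.Zmodule.on (star P).

Section StarModule.
Variable P : lmodType A^c.

Lemma star_scale_linear (a : A) (phi : star P) :
  linear ((fun x => (a * (phi x : A) : A)) : P -> (A^c)^o).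
Proof.
move=> c x y.
have -> : phi (c *: x + y) = (phi x : A) * (c : A) + (phi y : A) :> A.
  exact: etrans (hom_app_add phi _ _) (congr1 (+%R^~ _) (hom_app_scale phi c x)).
by rewrite mulrDr mulrA.
Qed.
Definition star_scale (a : A) (phi : star P) : star P :=
  mk_hom (star_scale_linear a phi).

Lemma star_scaleA a b phi : star_scale a (star_scale b phi) = star_scale (a * b) phi.
Proof. by apply: homP => x; apply: (mulrA a b (phi x : A)). Qed.
Lemma star_scale1 : left_id 1 star_scale.
Proof. by move=> phi; apply: homP => x; apply: (mul1r (phi x : A)). Qed.
Lemma star_scaleDr : right_distributive star_scale +%R.
Proof. by move=> a phi psi; apply: homP => x; apply: (mulrDr a (phi x : A) (psi x : A)). Qed.
Lemma star_scaleDl phi : {morph star_scale^~ phi : a b / a + b}.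
Proof. by move=> a b; apply: homP => x; apply: (mulrDl a b (phi x : A)). Qed.
HB.instance Definition _ := GRing.Zmodule_isLmodule.Build A (star P)
  star_scaleA star_scale1 star_scaleDr star_scaleDl.
End StarModule.

Variables (P1 P0 : lmodType A^c) (f : hom P1 P0).

Definition star_map (phi : star P0) : star P1 := hom_comp f phi.

Lemma star_image_submod : is_submod (range star_map).
Proof.
split=> [|a _ _ [phi _ <-] [psi _ <-]].
  by exists 0 => //; apply: homP.
by exists (a *: phi + psi) => //; apply: homP.
Qed.

(* The transpose of coker f, computed from the presentation f. *)
Definition transpose : lmodType A := modquot (Submod star_image_submod).
End Star.

(* N is isomorphic to tau^- M = Tr D M. *)
Definition is_tau_inv (K : pzRingType) (A : pzAlgType K) (M N : lmodType A) : Prop :=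
  exists (P1 P0 : lmodType A^c) (f : hom P1 P0) (g : hom P0 (dual M)),
    min_proj_presentation f g /\ mod_iso N (transpose f).

(** ** Left modules A e *)

Section LeftIdeal.
Variables (A : pzRingType) (e : A).

Lemma left_ideal_submod : is_submod ([set a * e | a in setT] : set A^o).
Proof.
split=> [|a _ _ [x _ <-] [y _ <-]]; first by exists 0; rewrite ?mul0r.
by exists (a * x + y) => //; rewrite mulrDl -mulrA.
Qed.

Definition left_ideal : lmodType A := submodT (Submod left_ideal_submod).
End LeftIdeal.

(** * Quivers and complete path algebras *)

Record quiver (V : finType) := Quiver {
  arr : finType;
  src : arr -> V;
  tgt : arr -> V
}.

Section Paths.
Variables (V : finType) (Q : quiver V).

Definition connected_quiver : Prop :=
  forall i j : V,
    connect [rel u v | [exists a : arr Q,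
      ((src a == u) && (tgt a == v)) || ((src a == v) && (tgt a == u))]] i j.

Definition is_source (k : V) : Prop := forall a : arr Q, tgt a != k.

Fixpoint walk (i : V) (w : seq (arr Q)) : bool :=
  if w is a :: w' then (src a == i) && walk (tgt a) w' else true.

Definition walk_end (i : V) (w : seq (arr Q)) : V := last i (map (@tgt V Q) w).

(* A path is a start vertex with a composable word of arrows, read from left
   to right; the empty words give the trivial paths. *)
Definition qpath := {p : V * seq (arr Q) | walk p.1 p.2}.

Definition pstart (p : qpath) : V := (val p).1.
Definition pword (p : qpath) : seq (arr Q) := (val p).2.
Definition plen (p : qpath) : nat := size (pword p).
Definition pend (p : qpath) : V := walk_end (pstart p) (pword p).

Lemma walk_cat i w1 w2 : walk i (w1 ++ w2) = walk i w1 && walk (walk_end i w1) w2.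
Proof. by elim: w1 i => //= a w1 IH i; rewrite IH andbA. Qed.

Lemma walk_end_cat i w1 w2 : walk_end i (w1 ++ w2) = walk_end (walk_end i w1) w2.
Proof. by rewrite /walk_end map_cat last_cat. Qed.

Lemma walk_take i w j : walk i w -> walk i (take j w).
Proof. by rewrite -{1}(cat_take_drop j w) walk_cat => /andP[]. Qed.

Lemma walk_drop i w j : walk i w -> walk (walk_end i (take j w)) (drop j w).
Proof. by rewrite -{1}(cat_take_drop j w) walk_cat => /andP[]. Qed.

End Paths.

Section CompletePathAlgebra.
Variables (K : fieldType) (V : finType) (Q : quiver V).

(* Since Q is finite, an element of prod_n KQ_n is an arbitrary family of
   coefficients indexed by all paths. *)
Definition cpa : Type := qpath Q -> K^o.
HB.instance Definition _ := GRing.Lmodule.copy cpa (qpath Q -> K^o).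

(* Coefficient at an arbitrary word, 0 if the word is not composable. *)
Definition coef (x : cpa) (i : V) (w : seq (arr Q)) : K :=
  if insub (i, w) is Some p then x p else 0.

Definition cpa_mul (x y : cpa) : cpa := fun p =>
  \sum_(j < (plen p).+1)
    coef x (pstart p) (take j (pword p)) *
    coef y (walk_end (pstart p) (take j (pword p))) (drop j (pword p)).

(* The path (i, w) as an element of the algebra, 0 if w is not composable. *)
Definition bas (i : V) (w : seq (arr Q)) : cpa := fun p => (val p == (i, w))%:R.
Definition idem (i : V) : cpa := bas i [::].
Definition aelt (a : arr Q) : cpa := bas (src a) [:: a].

Definition cpa_one : cpa := fun p => (pword p == [::])%:R.

Lemma coefE (x : cpa) (p : qpath Q) : coef x (pstart p) (pword p) = x p.
Proof. by rewrite /coef -surjective_pairing valK. Qed.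

Lemma coef_walk x i w (h : walk i w) : coef x i w = x (exist _ (i, w) h).
Proof. by rewrite -coefE. Qed.

Lemma coef_mul x y i w : walk i w -> coef (cpa_mul x y) i w =
  \sum_(0 <= j < (size w).+1) coef x i (take j w) * coef y (walk_end i (take j w)) (drop j w).
Proof. by move=> h; rewrite (coef_walk _ h) big_mkord. Qed.

Lemma cpa_mulE x y (p : qpath Q) : cpa_mul x y p =
  \sum_(0 <= j < (plen p).+1) coef x (pstart p) (take j (pword p)) *
    coef y (walk_end (pstart p) (take j (pword p))) (drop j (pword p)).
Proof. by rewrite big_mkord. Qed.

Lemma triangular_sum n (G : nat -> nat -> K) :
  \sum_(0 <= j < n.+1) \sum_(0 <= l < j.+1) G l j =
  \sum_(0 <= l < n.+1) \sum_(0 <= m < (n - l).+1) G l (l + m)%N.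
Proof.
elim: n => [|n IH]; first by rewrite !big_nat1.
rewrite big_nat_recr //= IH [RHS]big_nat_recr //= subnn big_nat1 addn0.
rewrite [X in _ + X]big_nat_recr //= addrA; congr (_ + _).
rewrite -big_split /=; apply: eq_big_nat => l /andP[_ ln]; rewrite ltnS in ln.
by rewrite subSn // [RHS]big_nat_recr //= addnS subnKC.
Qed.

Lemma cpa_mulA : associative cpa_mul.
Proof.
move=> x y z; apply/funext => -[[i w] /= h].
rewrite !cpa_mulE /plen /pstart /pword /=; set n := size w.
pose G l j := coef x i (take l w) *
  (coef y (walk_end i (take l w)) (drop l (take j w)) *
   coef z (walk_end i (take j w)) (drop j w)).
transitivity (\sum_(0 <= l < n.+1) \sum_(0 <= m < (n - l).+1) G l (l + m)%N).
  apply: eq_big_nat => l /andP[_ ln]; rewrite ltnS in ln.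
  rewrite coef_mul ?walk_drop // mulr_sumr size_drop.
  apply: eq_big_nat => m _; rewrite /G.
  by rewrite -walk_end_cat -takeD drop_drop take_drop [(m + l)%N]addnC.
rewrite -triangular_sum; apply: eq_big_nat => j /andP[_ jn]; rewrite ltnS in jn.
rewrite coef_mul ?walk_take // mulr_suml size_takel //.
apply: eq_big_nat => l /andP[_ lj]; rewrite ltnS in lj.
by rewrite /G mulrA take_takel.
Qed.

Lemma coef_one i w : walk i w -> coef cpa_one i w = (w == [::])%:R.
Proof. by move=> h; rewrite (coef_walk _ h). Qed.

Lemma cpa_mul1 : left_id cpa_one cpa_mul.
Proof.
move=> x; apply/funext => -[[i w] /= h].
rewrite cpa_mulE /plen /pstart /pword /= big_nat_recl // take0 drop0.
rewrite coef_one // mul1r coef_walk big1_seq ?addr0 // => j.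
rewrite mem_index_iota => /andP[_ /andP[_ jn]].
rewrite coef_one ?walk_take //.
by case: w h jn => //= a w _ _; rewrite mul0r.
Qed.

Lemma cpa_mulr1 : right_id cpa_one cpa_mul.
Proof.
move=> x; apply/funext => -[[i w] /= h].
rewrite cpa_mulE /plen /pstart /pword /= big_nat_recr //= take_size drop_size.
rewrite coef_one // mulr1 coef_walk big1_seq ?add0r // => j.
rewrite mem_index_iota => /andP[_ /andP[_ jn]].
rewrite coef_one ?walk_drop // -size_eq0 size_drop subn_eq0 leqNgt jn.
by rewrite mulr0.
Qed.

Lemma coefD x y i w : coef (x + y) i w = coef x i w + coef y i w.
Proof. by rewrite /coef; case: insub => //; rewrite addr0. Qed.

Lemma coefZ c x i w : coef (c *: x) i w = c * coef x i w.
Proof. by rewrite /coef; case: insub => //; rewrite mulr0. Qed.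

Lemma cpa_mulDl : left_distributive cpa_mul +%R.
Proof.
move=> x y z; apply/funext => p; rewrite cpa_mulE.
transitivity (cpa_mul x z p + cpa_mul y z p) => //; rewrite !cpa_mulE -big_split.
by apply: eq_bigr => j _; rewrite coefD mulrDl.
Qed.

Lemma cpa_mulDr : right_distributive cpa_mul +%R.
Proof.
move=> x y z; apply/funext => p; rewrite cpa_mulE.
transitivity (cpa_mul x y p + cpa_mul x z p) => //; rewrite !cpa_mulE -big_split.
by apply: eq_bigr => j _; rewrite coefD mulrDr.
Qed.

HB.instance Definition _ := GRing.Zmodule_isPzRing.Build cpa
  cpa_mulA cpa_mul1 cpa_mulr1 cpa_mulDl cpa_mulDr.

Lemma cpa_scaleAl c (x y : cpa) : c *: (x * y) = (c *: x) * y.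
Proof.
apply/funext => p; transitivity (c * (cpa_mul x y p)) => //.
rewrite [RHS]cpa_mulE cpa_mulE mulr_sumr.
by apply: eq_bigr => j _; rewrite coefZ mulrA.
Qed.

Lemma cpa_scaleAr c (x y : cpa) : c *: (x * y) = x * (c *: y).
Proof.
apply/funext => p; transitivity (c * (cpa_mul x y p)) => //.
rewrite [RHS]cpa_mulE cpa_mulE mulr_sumr.
by apply: eq_bigr => j _; rewrite coefZ mulrCA.
Qed.

Definition cpa_kalg (c : K) : cpa := c *: (1 : cpa).

Lemma cpa_kalg_zmod : zmod_morphism cpa_kalg.
Proof. by move=> c d; rewrite /cpa_kalg scalerBl. Qed.
Lemma cpa_kalg_monoid : monoid_morphism cpa_kalg.
Proof.
split=> [|c d]; first exact: scale1r.
by rewrite /cpa_kalg -cpa_scaleAl mul1r scalerA.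
Qed.
Lemma cpa_kalg_central c (x : cpa) : cpa_kalg c * x = x * cpa_kalg c.
Proof. by rewrite /cpa_kalg -cpa_scaleAl -cpa_scaleAr mul1r mulr1. Qed.
HB.instance Definition _ := isPzAlgebra.Build K cpa
  cpa_kalg_zmod cpa_kalg_monoid cpa_kalg_central.

(* Closure in the radical-adic topology: the n-th power of the radical (the
   arrow ideal) of the complete path algebra consists of the elements supported
   on paths of length at least n. *)
Definition adic_closure (S : set cpa) : set cpa :=
  [set x | forall n, exists2 y, S y & forall p, (plen p < n)%N -> x p = y p].

Lemma coef_lt (x y : cpa) n i w : (forall p, (plen p < n)%N -> x p = y p) ->
  (size w < n)%N -> coef x i w = coef y i w.
Proof. by move=> xy wn; rewrite /coef; case: insubP => // p _ pE; apply: xy; rewrite /plen /pword pE. Qed.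

Lemma adic_closure_ideal (I : set cpa) : is_ideal I -> is_ideal (adic_closure I).
Proof.
move=> [I0 IB IM]; split=> [n|x y xI yI n|a x xI].
- by exists 0.
- have [x' Ix' xE] := xI n; have [y' Iy' yE] := yI n.
  exists (x' - y'); first exact: IB.
  by move=> p pn; transitivity (x p - y p) => //; rewrite xE ?yE.
split=> n; have [x' Ix' xE] := xI n.
  exists (a * x'); first by have [] := IM a x' Ix'.
  move=> p pn; rewrite [LHS]cpa_mulE [RHS]cpa_mulE; apply: eq_big_nat => j _.
  congr (_ * _); apply: coef_lt xE _.
  by rewrite size_drop (leq_ltn_trans (leq_subr _ _)).
exists (x' * a); first by have [] := IM a x' Ix'.
move=> p pn; rewrite [LHS]cpa_mulE [RHS]cpa_mulE; apply: eq_big_nat => j _.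
congr (_ * _); apply: coef_lt xE _.
by rewrite size_take_min (leq_ltn_trans (geq_minr _ _)).
Qed.

Definition closed_ideal (S : set cpa) : ideal cpa :=
  Ideal (adic_closure_ideal (ideal_span_ideal S)).

(** ** Potentials *)

Definition is_potential (W : cpa) : Prop :=
  forall p, W p != 0 -> pend p = pstart p /\ (2 <= plen p)%N.

(* The linear map with d_a (a_1...a_d) = sum_(a_i = a) a_(i+1)...a_d a_1...a_(i-1)
   on cycles, extended continuously. All terms start at tgt a. *)
Definition cyc_der (a : arr Q) (W : cpa) : cpa := fun p =>
  \sum_(c : (plen p).+1.-tuple (arr Q))
    \sum_(i < (plen p).+1 | (tnth c i == a) &&
        ((pstart p, pword p) == (tgt a, drop i.+1 c ++ take i c)))
      coef W (src (thead c)) c.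

Definition jacobian (W : cpa) : pzAlgType K :=
  qalg (closed_ideal [set cyc_der a W | a in setT]).

Definition rotation_difference : set cpa :=
  [set x | exists a w, [/\ walk (src a) (a :: w), walk_end (src a) (a :: w) = src a &
     x = bas (src a) (a :: w) - bas (tgt a) (rcons w a)]].

Definition cyc_equiv (W W' : cpa) : Prop :=
  adic_closure (lin_span rotation_difference) (W - W').

Definition is_cut (W : cpa) (C : {set arr Q}) : Prop :=
  forall p, W p != 0 -> count (mem C) (pword p) = 1%N.

Definition homogeneous (d : arr Q -> int) (n : int) (x : cpa) : Prop :=
  forall p, x p != 0 -> \sum_(a <- pword p) d a = n.

(** ** Relations *)

Record qrel := QRel {
  rel_src : V;
  rel_tgt : V;
  rel_val : cpa;
  rel_valP : forall p, rel_val p != 0 ->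
    [/\ (2 <= plen p)%N, pstart p = rel_src & pend p = rel_tgt]
}.

Section Relations.
Variables (I : finType) (R : I -> qrel).

Definition minimal_rels : Prop := forall i,
  ~ adic_closure (ideal_span [set rel_val (R j) | j in [set j | j <> i]])
      (rel_val (R i)).

Definition bound_algebra : pzAlgType K :=
  qalg (closed_ideal [set rel_val (R i) | i in setT]).

(* P_i = Lambda e_i *)
Definition proj_at (i : V) : lmodType bound_algebra :=
  left_ideal (qalg_pi _ (idem i) : bound_algebra).

(* Lambda / P_k *)
Definition proj_others (k : V) : lmodType bound_algebra :=
  dsum (fun i : {i | i != k} => proj_at (val i)).

(* tau^- P_k + Lambda / P_k, for N a module isomorphic to tau^- P_k *)
Definition apr_tilting (k : V) (N : lmodType bound_algebra) : lmodType bound_algebra :=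
  (N * proj_others k)%type.

End Relations.

End CompletePathAlgebra.

(** * Transport of elements between complete path algebras *)

Section Pullback.
Variables (K : fieldType) (V : finType) (Q Q' : quiver V).
Variable u : arr Q' -> option (seq (arr Q)).

Fixpoint expand (w : seq (arr Q')) : option (seq (arr Q)) :=
  if w is a :: w' then
    if (u a, expand w') is (Some v, Some v') then Some (v ++ v') else None
  else Some [::].

(* The coefficient of pullback x at p is that of x at the path obtained from p
   by replacing each arrow a with the word u a, and 0 if some u a is None. *)
Definition pullback (x : cpa K Q) : cpa K Q' := fun p =>
  if expand (pword p) is Some w then coef x (pstart p) w else 0.
End Pullback.

(* Q_C and the truncated Jacobian algebra; when C is a cut no path occurring in
   cyc_der c W meets C, so pullback only reads it in the path algebra of Q_C. *)
Section Truncation.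
Variables (K : fieldType) (V : finType) (Q : quiver V).
Variables (W : cpa K Q) (C : {set arr Q}).

Definition cut_quiver : quiver V :=
  @Quiver V {a : arr Q | a \notin C} (fun a => src (val a)) (fun a => tgt (val a)).

Definition to_cut_quiver (x : cpa K Q) : cpa K cut_quiver :=
  pullback (fun a : arr cut_quiver => Some [:: val a]) x.

Definition truncated_jacobian : pzAlgType K :=
  qalg (closed_ideal [set to_cut_quiver (cyc_der c W) | c in [set c | c \in C]]).
End Truncation.

(** * Graded quivers with potential *)

Section GradedQP.
Variables (K : fieldType) (V : finType).

Record gqp := GQP {
  gquiv : quiver V;
  gpot : cpa K gquiv;
  gdeg : arr gquiv -> int
}.
Arguments gpot : clear implicits.
Arguments gdeg : clear implicits.

Definition degree1_arrows (G : gqp) : {set arr (gquiv G)} :=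
  [set a | gdeg G a == 1]%SET.

(* The graded quiver with potential (Q, W, C) given by a cut C. *)
Definition is_cut_gqp (G : gqp) : Prop :=
  [/\ is_potential (gpot G), forall a, gdeg G a = 0 \/ gdeg G a = 1 &
      is_cut (gpot G) (degree1_arrows G)].

Definition gtruncated_jacobian (G : gqp) : pzAlgType K :=
  truncated_jacobian (gpot G) (degree1_arrows G).

Definition is_reduced (G : gqp) : Prop :=
  forall p, gpot G p != 0 -> (3 <= plen p)%N.

Definition arrowless_quiver : quiver V :=
  @Quiver V void (fun a => match a with end) (fun a => match a with end).

Definition is_trivial (G : gqp) : Prop :=
  (forall p, gpot G p != 0 -> plen p = 2%N) /\
  alg_iso (jacobian (gpot G)) (cpa K arrowless_quiver).

Definition gqp_sum (G H : gqp) : gqp :=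
  let S := @Quiver V (arr (gquiv G) + arr (gquiv H))%type
    (fun a => match a with inl b => src b | inr b => src b end)
    (fun a => match a with inl b => tgt b | inr b => tgt b end) in
  @GQP S
    (pullback (fun a : arr S => if a is inl b then Some [:: b] else None) (gpot G) +
     pullback (fun a : arr S => if a is inr b then Some [:: b] else None) (gpot H))
    (fun a => match a with inl b => gdeg G b | inr b => gdeg H b end).

Definition graded_right_equiv (G H : gqp) : Prop :=
  exists f : {rmorphism cpa K (gquiv G) -> cpa K (gquiv H)},
    [/\ bijective f,
        forall c : K, f (kalg c) = kalg c,
        forall i : V, f (idem K i) = idem K i,
        forall n x, homogeneous (gdeg G) n x -> homogeneous (gdeg H) n (f x) &
        cyc_equiv (f (gpot G)) (gpot H)].

Definition is_reduced_part (M G : gqp) : Prop :=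
  [/\ is_cut_gqp M, is_reduced M &
      exists T, [/\ is_cut_gqp T, is_trivial T & graded_right_equiv G (gqp_sum M T)]].

(** ** Left mutation *)

Section Mutation.
Variables (k : V) (G : gqp).
Let Q := gquiv G.

Definition in_arr := {b : arr Q | tgt b == k}.
Definition out_arr := {a : arr Q | src a == k}.
Definition far_arr := {a : arr Q | (src a != k) && (tgt a != k)}.

(* far_arr: the arrows common to Q and Q'; out_arr: the a^*; in_arr: the b^*;
   in_arr * out_arr: the [ba]. *)
Definition mut_arr : finType := (far_arr + (out_arr + (in_arr + in_arr * out_arr)))%type.

Definition common (c : far_arr) : mut_arr := inl c.
Definition out_star (a : out_arr) : mut_arr := inr (inl a).
Definition in_star (b : in_arr) : mut_arr := inr (inr (inl b)).
Definition compos (b : in_arr) (a : out_arr) : mut_arr := inr (inr (inr (b, a))).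

Definition mut_src (x : mut_arr) : V :=
  match x with
  | inl c => src (val c)
  | inr (inl a) => tgt (val a)
  | inr (inr (inl b)) => k
  | inr (inr (inr (b, a))) => src (val b)
  end.

Definition mut_tgt (x : mut_arr) : V :=
  match x with
  | inl c => tgt (val c)
  | inr (inl a) => k
  | inr (inr (inl b)) => src (val b)
  | inr (inr (inr (b, a))) => tgt (val a)
  end.

Definition mut_deg (x : mut_arr) : int :=
  match x with
  | inl c => gdeg G (val c)
  | inr (inl a) => - gdeg G (val a)
  | inr (inr (inl b)) => - gdeg G (val b) + 1
  | inr (inr (inr (b, a))) => gdeg G (val a) + gdeg G (val b)
  end.

Definition mut_quiver : quiver V := @Quiver V mut_arr mut_src mut_tgt.

Definition uncontract (x : mut_arr) : option (seq (arr Q)) :=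
  match x with
  | inl c => Some [:: val c]
  | inr (inr (inr (b, a))) => Some [:: val b; val a]
  | _ => None
  end.

(* [W]: every cycle of Q not starting at k is obtained from a unique cycle of Q'
   by expanding the arrows [ba]. *)
Definition contracted_pot : cpa K mut_quiver :=
  pullback (uncontract : arr mut_quiver -> _) (gpot G).

Definition mut_pot : cpa K mut_quiver :=
  contracted_pot +
  \sum_(b : in_arr) \sum_(a : out_arr)
    aelt K (compos b a : arr mut_quiver) * aelt K (out_star a : arr mut_quiver) *
    aelt K (in_star b : arr mut_quiver).

(* To be used when k lies on no loop and no cycle of the potential starts at k;
   for the quiver with potential of an algebra and k a source, the latter is
   assoc_pot_start below. *)
Definition left_premutation : gqp := @GQP mut_quiver mut_pot mut_deg.

Definition is_left_mutation (M : gqp) : Prop := is_reduced_part M left_premutation.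
End Mutation.

(** ** The quiver with potential associated with an algebra *)

Section Associated.
Variables (Q : quiver V) (I : finType) (R : I -> qrel K Q).

(* inr r is the arrow rho_r : e(r) -> s(r). *)
Definition assoc_quiver : quiver V :=
  @Quiver V (arr Q + I)%type
    (fun x => match x with inl a => src a | inr r => rel_tgt (R r) end)
    (fun x => match x with inl a => tgt a | inr r => rel_src (R r) end).

Definition assoc_embed (x : cpa K Q) : cpa K assoc_quiver :=
  pullback (fun x : arr assoc_quiver => if x is inl a then Some [:: a] else None) x.

Definition assoc_pot : cpa K assoc_quiver :=
  \sum_(r : I) aelt K (inr r : arr assoc_quiver) * assoc_embed (rel_val (R r)).

Definition assoc_gqp : gqp :=
  @GQP assoc_quiver assoc_pot (fun x => if x is inl _ then 0 else 1).

Lemma assoc_pot_start (k : V) : is_source Q k ->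
  forall p, assoc_pot p != 0 -> pstart p != k.
Proof.
move=> srck p.
have -> : assoc_pot p = \sum_r cpa_mul (aelt K (inr r : arr assoc_quiver))
    (assoc_embed (rel_val (R r))) p.
  by rewrite /assoc_pot fct_sumE.
apply: contraNneq => pk; apply/eqP.
apply: big1 => r _; apply: big1 => j _; rewrite {1}/coef.
case: insubP => [q _ qE|_]; last by rewrite mul0r.
rewrite /aelt /bas qE xpair_eqE /=.
case: eqP => [rk|_]; last by rewrite mul0r.
suff -> : assoc_embed (rel_val (R r)) = 0 :> cpa K assoc_quiver.
  by rewrite /coef; case: insub => // *; rewrite mulr0.
have R0 q' : rel_val (R r) q' = 0.
  apply/eqP/negP => /negP /rel_valP[]; rewrite /plen /pend /walk_end -rk pk.
  case/lastP: (pword q') => // w a _ _; rewrite map_rcons last_rcons.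
  exact/eqP/srck.
apply/funext => q'; rewrite /assoc_embed /pullback /coef.
by case: expand => // w; case: insub => // q''; apply: R0.
Qed.

End Associated.

End GradedQP.

(* Main.v *)
From HB Require Import structures.
From mathcomp Require Import all_boot all_algebra.
From mathcomp Require Import boolp classical_sets functions.
Require Import Defs.

(** Let P be the left premutation at k of the quiver with potential of Lam, and
    let J be the closed ideal of its complete path algebra generated by the
    arrows of the cut and the derivatives of the potential with respect to them.
    The two algebras of the theorem are both compared with the quotient by J.

    The truncated Jacobian algebra. Killing the cut first or last makes no
    difference, so each truncated Jacobian algebra is a quotient of the full path
    algebra by such an ideal. This ideal has an intrinsic description: it is the
    least closed ideal J which contains the cut C and for which the potential is
    a limit of combinations of rotations and of products x y along cycles, with x
    through C and y in J ([tjac_min], [cut_pot_cutspan]). A graded isomorphism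
    preserves the ideal of C, since this ideal is detected by the degree, and it
    preserves rotations, since these are commutators; hence a graded
    right-equivalence preserves J ([graded_equiv_tjac]). Splitting off a trivial
    summand does not change the quotient, because the Jacobian algebra of a
    trivial quiver with potential is semisimple and so J contains all its arrows
    ([sum_tjac_iso]). Therefore the reduced part of P has the quotient by J as
    its truncated Jacobian algebra ([reduced_part_iso]). The potential of P is
    sum_c c w_c with explicit w_c, which gives generators of J ([mut_tjac_min]).

    The tilting module. The dual of the simple projective module at k is the
    simple right module at k, whose minimal presentation has one term e_v Lam for
    each arrow k -> v ([cover_arrows]). Dualising it, the tilting module T has
    one generator t_a for each arrow a starting at k and one generator t_i for
    each vertex i other than k, with the single relation sum_a a t_a = 0
    ([apr_presentation]). The path algebra of the mutated quiver acts on T: an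
    arrow of Q away from k acts by right multiplication, the star of an arrow
    a : k -> v sends t_v to t_a, and the star of a relation r = sum_a a r_a
    sends t_a to - r_a times the generator at the end of r ([evaluation]). The
    generators of J act by zero, as those at k read r_a + a^* r^* ([F_tjac]).

    Comparison. Modulo J the product a^* r^* is - r_a, so every element has a
    normal form, a combination of x, x_a a^*, r^* w_r and r^* w_(r,a) a^* with
    coefficients from the path algebra of Q ([normal_form_exists]). The normal
    forms are matched with endomorphisms of T by means of the complex of right
    modules
      0 -> (+)_r e_(t(r)) Lam -> (+)_a e_(t(a)) Lam -> e_k Lam,
    with r over the relations and a over the arrows starting at k. Exactness in
    the middle ([columns_exact]) gives surjectivity ([normal_form_surj]).
    Exactness on the left ([columns_inj]) gives injectivity ([normal_form_inj]);
    it comes from the minimality of the relations and the bound 2 on the global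
    dimension, that is, from the vanishing of Tor_3 of the simple right module at
    k. Injectivity also uses that some arrow starts at k ([source_arrow]): if not,
    Q would be a single vertex, and the module at k would be injective. *)

Set Implicit Arguments.
Unset Strict Implicit.
Unset Printing Implicit Defensive.

Import GRing.Theory.

Local Open Scope classical_set_scope.
Local Open Scope ring_scope.

(** * Complete path algebras *)

Section CpaBasics.
Variables (K : fieldType) (V : finType) (Q : quiver V).
Implicit Types (x y z : cpa K Q) (i j : V) (w v : seq (arr Q)) (a b : arr Q).

Lemma coef_nwalk x i w : ~~ walk i w -> coef x i w = 0.
Proof. by move=> h; rewrite /coef insubN. Qed.

Lemma cpaP x y : (forall i w, walk i w -> coef x i w = coef y i w) -> x = y.
Proof. by move=> xy; apply/funext => p; rewrite -!coefE; apply: xy; apply: (valP p). Qed.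

Lemma cpaD x y p : (x + y) p = x p + y p. Proof. by []. Qed.
Lemma cpaB x y p : (x - y) p = x p - y p. Proof. by []. Qed.

Lemma coef0 i w : coef (0 : cpa K Q) i w = 0.
Proof. by rewrite /coef; case: insub. Qed.

Lemma coefN x i w : coef (- x) i w = - coef x i w.
Proof. by rewrite -scaleN1r coefZ mulN1r. Qed.

Lemma coefB x y i w : coef (x - y) i w = coef x i w - coef y i w.
Proof. by rewrite coefD coefN. Qed.

Lemma coef_sum (T : Type) (r : seq T) (P : pred T) (F : T -> cpa K Q) i w :
  coef (\sum_(t <- r | P t) F t) i w = \sum_(t <- r | P t) coef (F t) i w.
Proof. by elim/big_rec2: _ => [|t s x _ <-]; rewrite ?coef0 ?coefD. Qed.

Lemma coef_bas i w j v :
  coef (bas K i w) j v = ((i == j) && (w == v) && walk j v)%:R.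
Proof.
case: (boolP (walk j v)) => h; last by rewrite coef_nwalk // andbF.
by rewrite coef_walk /bas /= xpair_eqE andbT eq_sym [v == _]eq_sym.
Qed.

Lemma coefM x y i w : walk i w -> coef (x * y) i w =
  \sum_(0 <= l < (size w).+1)
    coef x i (take l w) * coef y (walk_end i (take l w)) (drop l w).
Proof. exact: coef_mul. Qed.

Lemma bas_nwalk i w : ~~ walk i w -> bas K i w = 0.
Proof.
move=> h; apply: cpaP => j v hv; rewrite coef_bas coef0.
by case: eqP => //= ij; case: eqP => //= wv; rewrite -ij -wv (negbTE h) in hv.
Qed.

Lemma coef_bas_mul i w y j v : walk i w -> walk j v ->
  coef (bas K i w * y) j v =
  if (i == j) && (take (size w) v == w)
  then coef y (walk_end i w) (drop (size w) v) else 0.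
Proof.
move=> hw hv; rewrite coefM //; case: ifP => [/andP[/eqP <-{j hv} /eqP tw]|h].
  have sw : (size w <= size v)%N by rewrite -tw size_take_min geq_minr.
  rewrite (bigD1_seq (size w)) ?iota_uniq ?mem_index_iota //=.
  rewrite tw coef_bas !eqxx hw mul1r big1_seq ?addr0 // => l /andP[lw].
  rewrite mem_index_iota => /andP[_ lv]; rewrite coef_bas eqxx /=.
  case: eqP => [wE|]; last by rewrite mul0r.
  by move: lw; rewrite wE size_takel -1?ltnS ?eqxx.
apply: big1_seq => l /andP[_]; rewrite mem_index_iota ltnS => /andP[_ lv].
rewrite coef_bas; case: eqP h => //= ij h; last by rewrite mul0r.
case: eqP => [wE|]; last by rewrite mul0r.
by move: h; rewrite wE size_takel // eqxx.
Qed.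

Lemma bas_mul i w j v : walk i w -> walk j v ->
  bas K i w * bas K j v = if walk_end i w == j then bas K i (w ++ v) else 0.
Proof.
move=> hw hv; apply: cpaP => l u hu; rewrite coef_bas_mul // coef_bas.
case: (eqVneq i l) => /= [<-{l hu}|il]; last first.
  by case: ifP; rewrite ?coef0 // coef_bas (negbTE il).
case: (eqVneq j (walk_end i w)) => [jE|ji]; last by rewrite /= coef0 if_same.
rewrite coef_bas !eqxx /=; case: (eqVneq (take (size w) u) w) => [tw|ntw].
  rewrite -{3 4}(cat_take_drop (size w) u) tw eqseq_cat // eqxx /= walk_cat hw.
  by [].
by case: eqP => //= uE; move: ntw; rewrite -uE take_size_cat ?eqxx.
Qed.

Lemma aelt_bas a w : aelt K a * bas K (tgt a) w = bas K (src a) (a :: w).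
Proof.
case: (boolP (walk (tgt a) w)) => h; last first.
  by rewrite (bas_nwalk h) mulr0 bas_nwalk //= eqxx.
by rewrite bas_mul //= ?eqxx.
Qed.

Lemma idem_mul i j : idem K i * idem K j = if i == j then idem K i else 0 :> cpa K Q.
Proof. by rewrite bas_mul //=. Qed.

Lemma coef_idemM i x j v :
  coef (idem K i * x) j v = if i == j then coef x j v else 0.
Proof.
case: (boolP (walk j v)) => h; last by rewrite !coef_nwalk ?if_same.
by rewrite coef_bas_mul //= take0 drop0 eqxx andbT; case: eqP => // ->.
Qed.

Lemma coef_Midem i x j v :
  coef (x * idem K i) j v = if i == walk_end j v then coef x j v else 0.
Proof.
case: (boolP (walk j v)) => h; last by rewrite !coef_nwalk ?if_same.
rewrite coefM // big_nat_recr //= take_size drop_size coef_bas /= eqxx !andbT.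
rewrite big1_seq ?add0r.
  by case: (i == _); rewrite ?mulr1 ?mulr0.
move=> l; rewrite mem_index_iota => /andP[_ /andP[_ lv]]; rewrite coef_bas.
have -> : [::] == drop l v = false.
  by rewrite eq_sym -size_eq0 size_drop subn_eq0 leqNgt lv.
by rewrite andbF mulr0.
Qed.

Lemma coef1 i w : walk i w -> coef (1 : cpa K Q) i w = (w == [::])%:R.
Proof. exact: coef_one. Qed.

Lemma sum_idem : \sum_i idem K i = 1 :> cpa K Q.
Proof.
apply: cpaP => j v h; rewrite coef_sum coef1 // (bigD1 j) //= coef_bas eqxx h andbT.
rewrite big1 ?addr0 ?[[::] == _]eq_sym // => i ij.
by rewrite coef_bas (negbTE ij).
Qed.

Lemma idem_bas i j w : idem K i * bas K j w = if i == j then bas K j w else 0.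
Proof.
apply: cpaP => l v h; rewrite coef_idemM (fun_if (fun x => coef x l v)) coef0.
rewrite coef_bas; case: (eqVneq j l) => [->|_] //=.
by rewrite !if_same.
Qed.

Lemma bas_idem i j w : bas K j w * idem K i = if i == walk_end j w then bas K j w else 0.
Proof.
apply: cpaP => l v h; rewrite coef_Midem (fun_if (fun x => coef x l v)) coef0.
rewrite coef_bas; case: (eqVneq j l) => [->|_] /=; last by rewrite !if_same.
by case: (eqVneq w v) => [->|_] //=; rewrite !if_same.
Qed.

Lemma idem_aelt i a : idem K i * aelt K a = if i == src a then aelt K a else 0.
Proof. exact: idem_bas. Qed.

Lemma aelt_idem i a : aelt K a * idem K i = if i == tgt a then aelt K a else 0.
Proof. exact: bas_idem. Qed.

(** ** The powers of the arrow ideal *)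

(** The powers of the arrow ideal. *)
Definition far (n : nat) x : Prop := forall p, (plen p < n)%N -> x p = 0.

Lemma farP n x : far n x <-> forall i w, (size w < n)%N -> coef x i w = 0.
Proof.
split=> [fx i w wn|fx p pn]; last by rewrite -coefE fx.
case: (boolP (walk i w)) => h; last by rewrite coef_nwalk.
by rewrite (coef_walk _ h) fx.
Qed.

Lemma farW m n x : (n <= m)%N -> far m x -> far n x.
Proof. by move=> nm fx p pn; apply: fx; apply: leq_trans nm. Qed.

Lemma far0 n : far n 0. Proof. by []. Qed.

Lemma far_all x : far 0 x. Proof. by []. Qed.

Lemma farD n x y : far n x -> far n y -> far n (x + y).
Proof. by move=> fx fy p pn; rewrite [LHS](_ : _ = x p + y p) // fx ?fy ?addr0. Qed.

Lemma farZ n c x : far n x -> far n (c *: x).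
Proof. by move=> fx p pn; rewrite [LHS](_ : _ = c * x p) // fx ?mulr0. Qed.

Lemma farN n x : far n x -> far n (- x).
Proof. by rewrite -scaleN1r; apply: farZ. Qed.

Lemma farB n x y : far n x -> far n y -> far n (x - y).
Proof. by move=> fx fy; apply: farD => //; apply: farN. Qed.

Lemma far_sum n (T : Type) (r : seq T) (P : pred T) (F : T -> cpa K Q) :
  (forall t, P t -> far n (F t)) -> far n (\sum_(t <- r | P t) F t).
Proof. by move=> fF; elim/big_rec: _ => // t x Pt fx; apply: farD => //; apply: fF. Qed.

Lemma farM m n x y : far m x -> far n y -> far (m + n) (x * y).
Proof.
move=> /farP fx /farP fy; apply/farP => i w wn.
case: (boolP (walk i w)) => h; last by rewrite coef_nwalk.
rewrite coefM //; apply: big1_seq => l /andP[_].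
rewrite mem_index_iota ltnS => /andP[_ lw].
case: (ltnP l m) => lm; first by rewrite fx ?mul0r // size_takel.
by rewrite [X in _ * X]fy ?mulr0 // size_drop ltn_subLR // (leq_trans wn) // leq_add2r.
Qed.

Lemma farMl n x y : far n y -> far n (x * y).
Proof. by move=> fy; apply: (farM (far_all x)). Qed.

Lemma farMr n x y : far n x -> far n (x * y).
Proof. by move=> fx; have := farM fx (far_all y); rewrite addn0. Qed.

Lemma far_bas n i w : (n <= size w)%N -> far n (bas K i w).
Proof.
move=> nw; apply/farP => j v vn; rewrite coef_bas.
by case: (eqVneq w v) => [wv|]; rewrite ?andbF //; rewrite -wv ltnNge nw in vn.
Qed.

Lemma far_eq0 x : (forall n, far n x) -> x = 0.
Proof. by move=> fx; apply/funext => p; apply: (fx (plen p).+1). Qed.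

Lemma adic_closureP (S : set (cpa K Q)) x :
  adic_closure S x <-> forall n, exists2 y, S y & far n (x - y).
Proof.
split=> cx n; have [y Sy xy] := cx n; exists y => // p pn.
  by rewrite [LHS](_ : _ = x p - y p) // xy // subrr.
by apply/eqP; rewrite -subr_eq0; apply/eqP; apply: xy.
Qed.

Lemma kalgE c : kalg c = c *: (1 : cpa K Q). Proof. by []. Qed.

Lemma kalgM c x : kalg c * x = c *: x.
Proof. by rewrite kalgE -[LHS]cpa_scaleAl mul1r. Qed.

Lemma scaleAl c x y : c *: (x * y) = (c *: x) * y. Proof. exact: cpa_scaleAl. Qed.
Lemma scaleAr c x y : c *: (x * y) = x * (c *: y). Proof. exact: cpa_scaleAr. Qed.

(** ** Truncation and density of the path algebra *)

Definition trunc n x : cpa K Q :=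
  \sum_(m < n) \sum_(w : m.-tuple (arr Q)) \sum_i coef x i w *: bas K i w.

Lemma trunc_far n x : far n (x - trunc n x).
Proof.
apply/farP => i w wn.
case: (boolP (walk i w)) => h; last by rewrite coef_nwalk.
rewrite coefB coef_sum (bigD1 (Ordinal wn)) //= coef_sum (bigD1 (in_tuple w)) //=.
rewrite coef_sum (bigD1 i) //= coefZ coef_bas !eqxx h mulr1.
rewrite [X in _ + X + _ + _]big1 => [|j ji]; last first.
  by rewrite coefZ coef_bas (negbTE ji) mulr0.
rewrite [X in _ + _ + X + _]big1 => [|u uw]; last first.
  rewrite coef_sum big1 // => j _; rewrite coefZ coef_bas.
  rewrite (_ : _ == w = false) ?andbF ?mulr0 //.
  by apply: contraNF uw => /eqP uw; apply/eqP/val_inj.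
rewrite [X in _ + _ + _ + X]big1 ?addr0 ?subrr // => -[m mn] /eqP mw.
rewrite coef_sum big1 // => u _; rewrite coef_sum big1 // => j _.
rewrite coefZ coef_bas (_ : _ == w = false) ?andbF ?mulr0 //.
by apply/eqP => uw; apply: mw; apply: val_inj; rewrite /= -uw size_tuple.
Qed.

Definition ksub (S : set (cpa K Q)) : Prop := is_submod S.

Lemma ksub_sum (S : set (cpa K Q)) (T : Type) (r : seq T) (P : pred T) F :
  ksub S -> (forall t, P t -> S (F t)) -> S (\sum_(t <- r | P t) F t).
Proof.
move=> [S0 SD] SF; elim/big_rec: _ => // t x Pt Sx.
by rewrite -[F t]scale1r; apply: SD => //; apply: SF.
Qed.

Lemma ksubD (S : set (cpa K Q)) x y : ksub S -> S x -> S y -> S (x + y).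
Proof. by move=> [_ SD] Sx Sy; rewrite -[x]scale1r; apply: SD. Qed.

Lemma ksubZ (S : set (cpa K Q)) c x : ksub S -> S x -> S (c *: x).
Proof. by move=> [S0 SD] Sx; rewrite -[_ *: _]addr0; apply: SD. Qed.

Lemma ksubN (S : set (cpa K Q)) x : ksub S -> S x -> S (- x).
Proof. by rewrite -scaleN1r; apply: ksubZ. Qed.

Lemma ksub_trunc (S : set (cpa K Q)) n x : ksub S ->
  (forall i w, walk i w -> (size w < n)%N -> S (bas K i w)) -> S (trunc n x).
Proof.
move=> kS Sb; do 3!(apply: ksub_sum => // ? _); apply: ksubZ => //.
set i := (X in bas _ X); set w := (X in bas _ _ X).
case: (boolP (walk i w)) => h; first by apply: Sb => //; rewrite size_tuple.
by rewrite bas_nwalk //; case: kS.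
Qed.

(** Paths span a dense subspace. *)
Lemma path_ind (S : set (cpa K Q)) n : ksub S -> (forall x, far n x -> S x) ->
  (forall i w, walk i w -> S (bas K i w)) -> forall x, S x.
Proof.
move=> kS Sfar Sb x; rewrite -(subrK (trunc n x) x).
apply: ksubD => //; first exact/Sfar/trunc_far.
by apply: ksub_trunc => // *; apply: Sb.
Qed.

Lemma path_ind_closed (S : set (cpa K Q)) : ksub S ->
  (forall x, adic_closure S x -> S x) ->
  (forall i w, walk i w -> S (bas K i w)) -> forall x, S x.
Proof.
move=> kS Scl Sb x; apply: Scl; apply/adic_closureP => n.
by exists (trunc n x); [apply: ksub_trunc => // *; apply: Sb|apply: trunc_far].
Qed.

(** The element y starting at the end of a for which a y collects the terms of x
    beginning with a. *)
Definition ldiv a x : cpa K Q :=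
  fun p => if pstart p == tgt a then coef x (src a) (a :: pword p) else 0.

Lemma coef_ldiv a x i w :
  coef (ldiv a x) i w = if i == tgt a then coef x (src a) (a :: w) else 0.
Proof.
case: (boolP (walk i w)) => h; first by rewrite (coef_walk _ h).
rewrite coef_nwalk //; case: eqP => // ia.
by rewrite coef_nwalk //= eqxx -ia.
Qed.

Lemma coef_aeltM a x i w : coef (aelt K a * x) i w =
  if w is b :: v then if (b == a) && (i == src a) then coef x (tgt a) v else 0 else 0.
Proof.
case: (boolP (walk i w)) => h.
  rewrite coef_bas_mul //= ?eqxx // eq_sym andbC.
  by case: w h => //= b v h; rewrite take0 drop0 eqseq_cons eqxx andbT.
rewrite coef_nwalk //; case: w h => //= b v h.
case: ifP => // /andP[/eqP ba /eqP ia].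
by rewrite coef_nwalk // -ba; move: h; rewrite ba ia eqxx.
Qed.

Lemma ldiv_sum x : far 1 x -> x = \sum_a aelt K a * ldiv a x.
Proof.
move=> /farP fx; apply: cpaP => i w h; rewrite coef_sum.
case: w h => [|b v] h; first by rewrite fx // big1 // => a _; rewrite coef_aeltM.
case/andP: (h) => /eqP bi hv.
rewrite (bigD1 b) //= coef_aeltM coef_ldiv bi !eqxx big1 ?addr0 // => a ab.
by rewrite coef_aeltM eq_sym (negbTE ab).
Qed.

Lemma ldiv_far n a x : far n.+1 x -> far n (ldiv a x).
Proof.
by move=> /farP fx; apply/farP => i w wn; rewrite coef_ldiv; case: eqP => // _; apply: fx.
Qed.

Lemma ldiv_idem a x : idem K (tgt a) * ldiv a x = ldiv a x.
Proof.
by apply: cpaP => i w h; rewrite coef_idemM coef_ldiv eq_sym; case: eqP.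
Qed.

Lemma ldivB a : {morph ldiv a : x y / x - y}.
Proof. by move=> x y; apply: cpaP => i w h; rewrite !(coef_ldiv, coefB); case: eqP => // _; rewrite subr0. Qed.

(** ** Units and the Jacobson radical *)

(** The geometric series of u converges. *)
Lemma far1_inv u : far 1 u -> exists z, z * (1 - u) = 1.
Proof.
move=> fu; pose s n := \sum_(0 <= j < n) u ^+ j.
have farX n : far n (u ^+ n).
  by elim: n => // n IH; rewrite exprS -[n.+1]add1n; apply: farM.
pose z : cpa K Q := fun p => s (plen p).+1 p.
have zs n : far n (z - s n).
  move=> p pn; rewrite cpaB /z.
  rewrite {2}/s (big_cat_nat (n := (plen p).+1)) //= cpaD opprD addrA subrr sub0r.
  suff F : far (plen p).+1 (\sum_((plen p).+1 <= j < n) u ^+ j).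
    by rewrite (F p (ltnSn _)) oppr0.
  rewrite big_seq_cond; apply: far_sum => j; rewrite andbT mem_index_iota.
  by case/andP=> pj _; apply: farW pj _.
exists z; apply/eqP; rewrite -subr_eq0; apply/eqP/far_eq0 => n.
rewrite -(subrK (s n) z) mulrDl -addrA; apply: farD; first exact: farMr.
have -> : s n * (1 - u) = 1 - u ^+ n.
  rewrite /s; elim: n => [|n IH]; first by rewrite big_nil mul0r expr0 subrr.
  by rewrite big_nat_recr //= mulrDl IH mulrBr mulr1 -exprSr addrA subrK.
by rewrite addrC addrA addNr sub0r; apply: farN.
Qed.

(** An element with a nonzero coefficient at some e_i is not in the Jacobson
    radical, so the arrow ideal is the Jacobson radical: it can be recognised in
    any isomorphic algebra. *)
Lemma far1P x : far 1 x <-> forall y, exists z, z * (1 - y * x) = 1.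
Proof.
split=> [fx y|ux]; first by apply: far1_inv; apply: farMl.
apply/farP => i [|//] _; apply/eqP/negP => /negP c0.
have [z /(congr1 (fun u => coef u i [::]))] := ux (((coef x i [::])^-1) *: idem K i).
rewrite -scaleAl coefM // big_nat1 /= coefB coefZ coef_idemM eqxx mulVf // coef1 //=.
by rewrite subrr mulr0 => /eqP; rewrite eq_sym oner_eq0.
Qed.

End CpaBasics.

(** * Ideals, quotients and closures *)

Section IdealLemmas.
Variables (A : pzRingType) (I : set A).
Hypothesis idI : is_ideal I.

Lemma ideal0 : I 0. Proof. by case: idI. Qed.
Lemma idealB x y : I x -> I y -> I (x - y). Proof. by case: idI => _ IB _; apply: IB. Qed.
Lemma idealN x : I x -> I (- x). Proof. by rewrite -sub0r; apply/idealB/ideal0. Qed.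
Lemma idealD x y : I x -> I y -> I (x + y).
Proof. by move=> Ix Iy; rewrite -[y]opprK; apply/idealB/idealN. Qed.
Lemma idealMl a x : I x -> I (a * x). Proof. by case: idI => _ _ IM /(IM a)[]. Qed.
Lemma idealMr a x : I x -> I (x * a). Proof. by case: idI => _ _ IM /(IM a)[]. Qed.
Lemma ideal_sum (T : Type) (r : seq T) (P : pred T) F :
  (forall t, P t -> I (F t)) -> I (\sum_(t <- r | P t) F t).
Proof.
by move=> IF; elim/big_rec: _ => [|t x Pt Ix]; [apply: ideal0|apply: idealD; first exact: IF].
Qed.
End IdealLemmas.

Lemma ideal_preim (A B : pzRingType) (f : {rmorphism A -> B}) (J : set B) :
  is_ideal J -> is_ideal (f @^-1` J).
Proof.
move=> idJ; split=> [|x y Jx Jy|a x Jx]; rewrite /preimage /=.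
- by rewrite rmorph0; apply: ideal0.
- by rewrite rmorphB; apply: idealB.
by rewrite !rmorphM; split; [apply: idealMl|apply: idealMr].
Qed.

Lemma ideal_span_sub (A : pzRingType) (S : set A) : S `<=` ideal_span S.
Proof. by move=> x Sx J _ SJ; apply: SJ. Qed.

Definition mk_rmorphism (A B : pzRingType) (f : A -> B)
    (fz : zmod_morphism f) (fm : monoid_morphism f) : {rmorphism A -> B} :=
  let F1 := GRing.isZmodMorphism.Build A B f fz in
  let F2 := GRing.isMonoidMorphism.Build A B f fm in
  HB.pack_for {rmorphism A -> B} f F1 F2.

Section AlgIso.
Variable K : pzRingType.

Lemma alg_iso_sym (A B : pzAlgType K) : alg_iso A B -> alg_iso B A.
Proof.
case=> f [[g fK gK] fk].
have gz : zmod_morphism g.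
  by move=> x y; apply: (can_inj fK); rewrite gK rmorphB !gK.
have gm : monoid_morphism g.
  by split=> [|x y]; apply: (can_inj fK); rewrite gK ?rmorph1 ?rmorphM ?gK.
exists (mk_rmorphism gz gm); split; first by exists f.
by move=> c; apply: (can_inj fK); rewrite fk gK.
Qed.

Lemma alg_iso_trans (A B C : pzAlgType K) : alg_iso A B -> alg_iso B C -> alg_iso A C.
Proof.
move=> [f [fb fk]] [g [gb gk]]; exists (g \o f); split; first exact: bij_comp.
by move=> c; rewrite /= fk gk.
Qed.

Lemma bij_surj_inj (T U : Type) (f : T -> U) :
  injective f -> surjective f -> bijective f.
Proof.
move=> fi fs; have [g gP] := choice fs.
by exists g => x //; apply: fi; rewrite gP.
Qed.

Lemma qalg_pi_zmod (A : pzRingType) (J : ideal A) : zmod_morphism (qalg_pi J).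
Proof. by move=> x y; apply: qalg_piB. Qed.
Lemma qalg_pi_monoid (A : pzRingType) (J : ideal A) : monoid_morphism (qalg_pi J).
Proof. by split=> // x y; apply: qalg_piM. Qed.
Definition qpi (A : pzRingType) (J : ideal A) : {rmorphism A -> qalg J} :=
  mk_rmorphism (@qalg_pi_zmod A J) (@qalg_pi_monoid A J).

Lemma qpiE (A : pzRingType) (J : ideal A) x y : qpi J x = qpi J y <-> ideal_set J (x - y).
Proof. exact: qalg_piE. Qed.

Lemma qpi0 (A : pzRingType) (J : ideal A) x : qpi J x = 0 <-> ideal_set J x.
Proof. by rewrite -[in X in X <-> _](rmorph0 (qpi J)) qpiE subr0. Qed.

Lemma qpi_surj (A : pzRingType) (J : ideal A) u : exists x, qpi J x = u.
Proof. by exists (qalg_repr u); apply: qalg_reprK. Qed.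

Lemma qpi_kalg (A : pzAlgType K) (J : ideal A) c : qpi J (kalg c) = kalg c.
Proof. by []. Qed.

Lemma qalg_iso_ker (A B : pzAlgType K) (f : {rmorphism A -> B}) (J : ideal A) :
  (forall c, f (kalg c) = kalg c) -> surjective f ->
  (forall x, ideal_set J x <-> f x = 0) -> alg_iso (qalg J) B.
Proof.
move=> fk fs fJ; pose g (u : qalg J) := f (qalg_repr u).
have gE x : g (qpi J x) = f x.
  apply/eqP; rewrite -subr_eq0 -rmorphB; apply/eqP/fJ/qpiE.
  exact: qalg_reprK.
have gz : zmod_morphism g.
  move=> u v; have [[x <-] [y <-]] := (qpi_surj u, qpi_surj v).
  by rewrite -rmorphB !gE rmorphB.
have gm : monoid_morphism g.
  split=> [|u v]; first by rewrite -(rmorph1 (qpi J)) gE rmorph1.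
  have [[x <-] [y <-]] := (qpi_surj u, qpi_surj v).
  by rewrite -rmorphM !gE rmorphM.
exists (mk_rmorphism gz gm); split; last by move=> c; rewrite /= -qpi_kalg gE fk.
apply: bij_surj_inj => [u v|b] /=; last first.
  by have [x <-] := fs b; exists (qpi J x); rewrite gE.
have [[x <-] [y <-]] := (qpi_surj u, qpi_surj v).
by rewrite !gE => /eqP; rewrite -subr_eq0 -rmorphB => /eqP/fJ/qpiE.
Qed.

Lemma qalg_iso (A B : pzAlgType K) (f : {rmorphism A -> B}) (J : ideal A) (J' : ideal B) :
  (forall c, f (kalg c) = kalg c) -> surjective f ->
  (forall x, ideal_set J x <-> ideal_set J' (f x)) -> alg_iso (qalg J) (qalg J').
Proof.
move=> fk fs fJ; apply: (@qalg_iso_ker _ _ (qpi J' \o f)) => [c|u|x].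
- by rewrite /= fk.
- by have [b <-] := qpi_surj u; have [x <-] := fs b; exists x.
by rewrite fJ; apply: iff_sym; apply: qpi0.
Qed.

End AlgIso.

Section ClosedIdeals.
Variables (K : fieldType) (V : finType) (Q : quiver V).
Implicit Types (S J : set (cpa K Q)) (x y : cpa K Q).

Definition closed S : Prop := forall x, adic_closure S x -> S x.

Lemma ideal_ksub J : is_ideal J -> ksub J.
Proof.
move=> idJ; split; first exact: ideal0.
by move=> c x y Jx Jy; rewrite -kalgM; apply: idealD => //; apply: idealMl.
Qed.

Lemma sub_adic_closure S : S `<=` adic_closure S.
Proof. by move=> x Sx n; exists x. Qed.

Lemma adic_closure_closed S : closed (adic_closure S).
Proof.
move=> x /adic_closureP cx; apply/adic_closureP => n.
have [y /adic_closureP/(_ n)[z Sz yz] xy] := cx n; exists z => //.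
by rewrite -(subrK y x) -addrA; apply: farD.
Qed.

Lemma adic_closure_mono S S' : S `<=` S' -> adic_closure S `<=` adic_closure S'.
Proof. by move=> SS x cx n; have [y /SS] := cx n; exists y. Qed.

Lemma adic_closure_ksub S : ksub S -> ksub (adic_closure S).
Proof.
move=> kS; split; first by apply: sub_adic_closure; case: kS.
move=> c x y /adic_closureP cx /adic_closureP cy; apply/adic_closureP => n.
have [[x' Sx fx] [y' Sy fy]] := (cx n, cy n); exists (c *: x' + y').
  by case: kS => _; apply.
by rewrite opprD addrACA -scalerBr; apply: farD => //; apply: farZ.
Qed.

Lemma closed_ideal_closed S : closed (ideal_set (closed_ideal S)).
Proof. exact: adic_closure_closed. Qed.

Lemma closed_ideal_sub S : S `<=` ideal_set (closed_ideal S).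
Proof. by move=> x Sx; exact: (sub_adic_closure (ideal_span_sub Sx)). Qed.

Lemma closed_ideal_min S J : is_ideal J -> closed J -> S `<=` J ->
  ideal_set (closed_ideal S) `<=` J.
Proof. move=> idJ clJ SJ x cx; apply: clJ; apply: adic_closure_mono cx => y sy; exact: sy. Qed.

Lemma far_closed J N : ksub J -> (forall x, far N x -> J x) -> closed J.
Proof.
move=> kJ fJ x /adic_closureP/(_ N)[y Jy xy].
by rewrite -(subrK y x); apply: ksubD => //; apply: fJ.
Qed.

Lemma far_ideal n : is_ideal (@far K V Q n).
Proof.
split=> [|x y|a x fx]; [exact: far0|exact: farB|].
by split; [apply: farMl|apply: farMr].
Qed.

Lemma far_closed_set n : closed (@far K V Q n).
Proof.
by move=> x /adic_closureP/(_ n)[y fy xy]; rewrite -(subrK y x); apply: farD.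
Qed.

End ClosedIdeals.

Section Continuity.
Variables (K : fieldType) (V : finType) (Q Q' : quiver V).
Variable f : {additive cpa K Q -> cpa K Q'}.
Hypothesis ffar : forall n x, far n x -> far n (f x).

Lemma image_adic_closure S S' : (forall x, S x -> S' (f x)) ->
  forall x, adic_closure S x -> adic_closure S' (f x).
Proof.
move=> SS x /adic_closureP cx; apply/adic_closureP => n.
have [y Sy xy] := cx n; exists (f y); first exact: SS.
by rewrite -raddfB; apply: ffar.
Qed.

Lemma preim_closed S : closed S -> closed (f @^-1` S).
Proof. by move=> clS x cx; apply: clS; apply: image_adic_closure cx. Qed.
End Continuity.

(** ** Finite dimensional quotients *)

(** A row space of maximal rank among those contained in U is all of U. *)
Lemma subspace_mx (K : fieldType) d (U : set 'rV[K]_d) :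
  U 0 -> (forall c u v, U u -> U v -> U (c *: u + v)) ->
  exists A : 'M[K]_d, forall u, U u <-> (u <= A)%MS.
Proof.
move=> U0 UD.
pose P r := `[< exists A : 'M[K]_d, (forall u, (u <= A)%MS -> U u) /\ \rank A = r >].
have exP : exists r, P r.
  exists 0%N; apply/asboolP; exists 0; split; last exact: mxrank0.
  by move=> u; rewrite submx0 => /eqP->.
have ubP r : P r -> (r <= d)%N.
  by move=> /asboolP[A [_ <-]]; rewrite rank_leq_row.
case: (ex_maxnP exP ubP) => r /asboolP[A [AU rA]] rmax; exists A => u; split=> [Uu|]; last exact: AU.
pose B := (A + <<u>>)%MS.
have BU v : (v <= B)%MS -> U v.
  move=> /sub_addsmxP[[x y] -> /=]; rewrite addrC.
  have /sub_rVP[c ->] : (y *m <<u>>%MS <= u)%MS by rewrite -(genmxE u) submxMl.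
  by apply: UD => //; apply: AU; apply: submxMl.
have /rmax rB : P (\rank B) by apply/asboolP; exists B.
have AB : (A <= B)%MS by apply: addsmxSl.
have := mxrank_leqif_sup AB; rewrite rA => -[_ /esym].
rewrite eqn_leq rB -rA mxrankS // => BA.
by apply: submx_trans BA; rewrite -(genmxE u) addsmxSr.
Qed.

Section FinDim.
Variables (K : fieldType) (V : finType) (Q : quiver V) (J : ideal (cpa K Q)).
Hypothesis clJ : closed (ideal_set J).
Hypothesis fdJ : fin_dim (qalg J : pzAlgType K).

(** The subspaces J + m^n of a finite dimensional quotient form a stationary
    chain, whose intersection is the closure of J. *)
Lemma fin_dim_far : exists N, forall x, far N x -> ideal_set J x.
Proof.
have [d [v vP]] := fdJ; have idJ := idealP J.
have /choice[w wE] : forall i, exists x, qpi J x = v i by move=> i; apply: qpi_surj.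
pose L (c : 'rV[K]_d) : cpa K Q := \sum_i c 0 i *: w i.
have LD a c c' : L (a *: c + c') = a *: L c + L c'.
  rewrite /L scaler_sumr -big_split; apply: eq_bigr => i _.
  by rewrite !mxE scalerDl scalerA.
have Lsurj x : exists c, ideal_set J (x - L c).
  have [c xE] := vP (qpi J x); exists (\row_i c i); apply/qpiE; rewrite xE rmorph_sum.
  apply: eq_bigr => i _; rewrite mxE -kalgM rmorphM wE.
  by [].
pose U n (c : 'rV[K]_d) := exists2 y, ideal_set J y & far n (L c - y).
have L0 : L 0 = 0 by rewrite /L big1 // => i _; rewrite mxE scale0r.
have /choice[A AU] : forall n, exists A : 'M[K]_d, forall u, U n u <-> (u <= A)%MS.
  move=> n; apply: subspace_mx.
    by exists 0; [apply: ideal0|rewrite L0 subr0].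
  move=> a c c' [y Jy fy] [y' Jy' fy']; exists (a *: y + y').
    by case: (ideal_ksub idJ) => _; apply.
  by rewrite LD opprD addrACA -scalerBr; apply: farD => //; apply: farZ.
have Adec m n : (m <= n)%N -> (A n <= A m)%MS.
  move=> mn; apply/rV_subP => u /AU[y Jy fy]; apply/AU; exists y => //.
  exact: farW fy.
have exr : exists r, `[< exists n, \rank (A n) = r >].
  by exists (\rank (A 0)); apply/asboolP; exists 0%N.
case: (ex_minnP exr) => r /asboolP[N rN] rmin; exists N => x fx.
have [c Jc] := Lsurj x.
have UN : U N c.
  exists (L c - x); first by rewrite -opprB; apply: idealN.
  by rewrite opprB addrC subrK.
suff JL : ideal_set J (L c) by rewrite -(subrK (L c) x); apply: idealD.
apply: clJ; apply/adic_closureP => n.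
suff /AU : (c <= A (maxn n N))%MS.
  by case=> y Jy fy; exists y => //; apply: farW fy; apply: leq_maxl.
have ANn := Adec _ _ (leq_maxr n N).
apply: submx_trans ((AU N c).1 UN) _.
rewrite -(geq_leqif (mxrank_leqif_sup ANn)) rN rmin //.
by apply/asboolP; exists (maxn n N).
Qed.

End FinDim.

(** * Cyclic derivatives and truncated Jacobian ideals *)

Lemma lin_span_min (R : pzRingType) (M : lmodType R) (S N : set M) :
  is_submod N -> S `<=` N -> lin_span S `<=` N.
Proof. by move=> smN SN x; apply. Qed.

Lemma lin_span_sub (R : pzRingType) (M : lmodType R) (S : set M) : S `<=` lin_span S.
Proof. by move=> x Sx N _; apply. Qed.

Lemma lin_span_submod (R : pzRingType) (M : lmodType R) (S : set M) : is_submod (lin_span S).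
Proof.
split=> [N [] //|a x y Sx Sy N smN SN]; case: (smN) => _; apply; [exact: Sx|exact: Sy].
Qed.

Section CyclicDerivative.
Variables (K : fieldType) (V : finType) (Q : quiver V).
Implicit Types (x y z W : cpa K Q) (i j : V) (w v u : seq (arr Q)) (a b c : arr Q).
Implicit Types (J : set (cpa K Q)) (C : {set arr Q}).

Lemma bas_cat i w v : bas K i (w ++ v) = bas K i w * bas K (walk_end i w) v.
Proof.
case: (boolP (walk i (w ++ v))) => h.
  by move: h; rewrite walk_cat => /andP[hw hv]; rewrite bas_mul // eqxx.
rewrite bas_nwalk //; move: h; rewrite walk_cat negb_and => /orP[] h.
  by rewrite [bas K i w](bas_nwalk K h) mul0r.
by rewrite [bas K _ v](bas_nwalk K h) mulr0.
Qed.

Lemma bas_cat_end i j w v : walk_end i w = j -> bas K i (w ++ v) = bas K i w * bas K j v.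
Proof. by move=> <-; apply: bas_cat. Qed.

Lemma walk_nth i w l a : walk i w -> (l < size w)%N -> nth a w l = a ->
  [/\ w = take l w ++ a :: drop l.+1 w, walk_end i (take l w) = src a &
      walk_end (tgt a) (drop l.+1 w) = walk_end i w].
Proof.
move=> h lw wl; have wE : w = take l w ++ a :: drop l.+1 w.
  by rewrite -{1}(cat_take_drop l w) (drop_nth a) // wl.
split=> //; last by rewrite [in RHS]wE walk_end_cat.
by move: h; rewrite [w in walk _ w]wE walk_cat => /andP[_ /= /andP[/eqP-> _]].
Qed.

Lemma cyc_der_lin a k x y : cyc_der a (k *: x + y) = k *: cyc_der a x + cyc_der a y.
Proof.
apply/funext => p; rewrite cpaD [(k *: _) p](_ : _ = k * cyc_der a x p) //.
rewrite /cyc_der mulr_sumr -big_split; apply: eq_bigr => t _ /=.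
rewrite mulr_sumr -big_split; apply: eq_bigr => l _ /=.
by rewrite coefD coefZ.
Qed.

Lemma cyc_der0 a : cyc_der a 0 = 0 :> cpa K Q.
Proof.
apply/funext => p; rewrite /cyc_der; do 2!(apply: big1 => ? _).
exact: coef0.
Qed.
Lemma cyc_derZ a k x : cyc_der a (k *: x) = k *: cyc_der a x.
Proof. by rewrite -[k *: x]addr0 cyc_der_lin cyc_der0 addr0. Qed.
Lemma cyc_derD a x y : cyc_der a (x + y) = cyc_der a x + cyc_der a y.
Proof. by have := cyc_der_lin a 1 x y; rewrite !scale1r. Qed.
Lemma cyc_derB a x y : cyc_der a (x - y) = cyc_der a x - cyc_der a y.
Proof. by rewrite cyc_derD -scaleN1r cyc_derZ scaleN1r. Qed.
Lemma cyc_der_sum a (T : Type) (r : seq T) (P : pred T) (F : T -> cpa K Q) :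
  cyc_der a (\sum_(t <- r | P t) F t) = \sum_(t <- r | P t) cyc_der a (F t).
Proof. by elim/big_rec2: _ => [|t x y _ <-]; rewrite ?cyc_der0 ?cyc_derD. Qed.

Lemma cyc_der_far a n x : far n.+1 x -> far n (cyc_der a x).
Proof.
move=> /farP fx p pn; rewrite /cyc_der; do 2!(apply: big1 => ? _).
by apply: fx; rewrite size_tuple.
Qed.

Lemma cyc_der_bas a i w : walk i w -> cyc_der a (bas K i w) =
  \sum_(0 <= l < size w | nth a w l == a) bas K (tgt a) (drop l.+1 w ++ take l w).
Proof.
move=> hw; apply/funext => p.
transitivity (coef (\sum_(0 <= l < size w | nth a w l == a)
    bas K (tgt a) (drop l.+1 w ++ take l w)) (pstart p) (pword p)); last by rewrite coefE.
rewrite coef_sum /cyc_der.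
have [sw|sw] := eqVneq (size w) (plen p).+1; last first.
  rewrite big1 => [|t _]; last first.
    apply: big1 => l _; rewrite coef_bas; case: eqP => //= _.
    by case: eqP => //= wt; rewrite wt size_tuple eqxx in sw.
  rewrite big1_seq // => l /andP[_]; rewrite mem_index_iota => /andP[_ lw].
  rewrite coef_bas; case: (eqVneq (drop _ _ ++ _)) => [E|]; last by rewrite andbF.
  case/eqP: sw; rewrite /plen -E size_cat size_drop size_takel; last exact: ltnW.
  by rewrite -addnS subnK.
have wS : size w == (plen p).+1 by rewrite sw.
rewrite (bigD1 (Tuple wS)) //= [X in _ + X]big1 ?addr0 => [|t tw]; last first.
  apply: big1 => l _; rewrite coef_bas.
  by case: (eqVneq w t) => [wt|]; rewrite ?andbF //; case/eqP: tw; apply: val_inj.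
rewrite sw big_mkord big_mkcond [RHS]big_mkcond; apply: eq_bigr => l _.
have -> : tnth (Tuple wS) l = nth a w l by rewrite (tnth_nth a).
case: eqP => //= wl; rewrite coef_bas xpair_eqE eq_sym [pword p == _]eq_sym.
have -> : src (thead (Tuple wS)) = i.
  rewrite /thead (tnth_nth a) /=; case: (w) hw sw => //= b v /andP[/eqP ->].
  by [].
by rewrite !eqxx hw coef_bas (valP p) /= andbT; case: ifP.
Qed.

(** ** Elements supported on paths through a set of arrows *)

(** This is the closed ideal generated by C, by [supp_min] below. *)
Definition supp C x : Prop := forall i w, coef x i w != 0 -> has (mem C) w.

Lemma supp_ideal C : is_ideal (supp C).
Proof.
split=> [i w|x y Sx Sy i w|a x Sx].
- by rewrite coef0 eqxx.
- rewrite coefB => xy0; have [x0|/Sx//] := eqVneq (coef x i w) 0.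
  by apply: (Sy i); apply: contraNneq xy0 => ->; rewrite x0 subrr.
split=> i w; case: (boolP (walk i w)) => h; try by rewrite coef_nwalk ?eqxx.
  apply: contraNT => nC; apply/eqP; rewrite coefM //; apply: big1 => l _.
  have [->|/Sx xC] := eqVneq (coef x (walk_end i (take l w)) (drop l w)) 0.
    by rewrite mulr0.
  by case/negP: nC; rewrite -(cat_take_drop l w) has_cat xC orbT.
apply: contraNT => nC; apply/eqP; rewrite coefM //; apply: big1 => l _.
have [->|/Sx xC] := eqVneq (coef x i (take l w)) 0; first by rewrite mul0r.
by case/negP: nC; rewrite -(cat_take_drop l w) has_cat xC.
Qed.

Lemma supp_closed C : closed (supp C).
Proof.
move=> x /adic_closureP cx i w; have [y Sy /farP/(_ i w (ltnSn _))] := cx (size w).+1.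
by rewrite coefB => /eqP; rewrite subr_eq0 => /eqP->; apply: Sy.
Qed.

Lemma supp_bas C i w : has (mem C) w -> supp C (bas K i w).
Proof.
by move=> wC j v; rewrite coef_bas; case: (eqVneq w v) => [<-//|]; rewrite andbF eqxx.
Qed.

Lemma supp_aelt C c : c \in C -> supp C (aelt K c).
Proof. by move=> cC; apply: supp_bas; rewrite /= cC. Qed.

(** Truncations of x only involve paths of the support of x. *)
Lemma supp_path_ind C (S : set (cpa K Q)) x : ksub S -> closed S ->
  (forall i w, walk i w -> has (mem C) w -> S (bas K i w)) -> supp C x -> S x.
Proof.
move=> kS clS Sb Sx; apply: clS; apply/adic_closureP => n.
exists (trunc n x); last exact: trunc_far.
do 3!(apply: ksub_sum => // ? _); set i := (X in bas _ X); set w := (X in bas _ _ X).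
have [->|c0] := eqVneq (coef x i w) 0; first by rewrite scale0r; case: kS.
apply: ksubZ => //; apply: Sb; last exact: Sx c0.
by apply: contraNT c0 => h; rewrite coef_nwalk.
Qed.

Lemma supp_min C J : is_ideal J -> closed J -> (forall c, c \in C -> J (aelt K c)) ->
  supp C `<=` J.
Proof.
move=> idJ clJ JC x; apply: supp_path_ind => //; first exact: ideal_ksub.
move=> i w hw /hasP[c cw cC].
have lw : (index c w < size w)%N by rewrite index_mem.
have cE := nth_index c cw.
have [-> _ _] := walk_nth hw lw cE.
rewrite bas_cat; apply: idealMl => //; rewrite -cat1s bas_cat.
apply: idealMr => //; case: (eqVneq (src c) (walk_end i (take (index c w) w))) => [<-|sc]; first exact: JC.
suff -> : bas K (walk_end i (take (index c w) w)) [:: c] = 0 by apply: ideal0.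
by apply: bas_nwalk; rewrite /= andbT.
Qed.

(** ** The cyclic derivative of a product *)

(** In the derivative of a cycle w v, an arrow of w leaves v as a factor and an
    arrow of v leaves w as a factor; terms of the second kind are in the ideal
    of w. *)
Lemma cder_mul c i w y (y' := idem K (walk_end i w) * y * idem K i) : walk i w ->
  ideal_set (closed_ideal [set bas K i w])
    (cyc_der c (bas K i w * y') -
     \sum_(0 <= l < size w | nth c w l == c)
        bas K (tgt c) (drop l.+1 w) * y' * bas K i (take l w)).
Proof.
rewrite /y' => {y'} hw; set J := closed_ideal _.
have idJ := idealP J; have kJ := ideal_ksub idJ.
pose E (z : cpa K Q) : cpa K Q := cyc_der c (bas K i w * (idem K (walk_end i w) * z * idem K i)) -
   \sum_(0 <= l < size w | nth c w l == c)
     bas K (tgt c) (drop l.+1 w) * (idem K (walk_end i w) * z * idem K i) * bas K i (take l w).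
rewrite -/(E y).
have ED k z1 z2 : E (k *: z1 + z2) = k *: E z1 + E z2.
  rewrite /E mulrDr mulrDl -scaleAr -scaleAl mulrDr -scaleAr cyc_der_lin.
  rewrite scalerBr addrACA -opprD; congr (_ + _); congr (- _).
  rewrite scaler_sumr -big_split; apply: eq_bigr => l _ /=.
  by rewrite mulrDr mulrDl -scaleAr -scaleAl.
have E0 : E 0 = 0.
  rewrite /E mulr0 mul0r mulr0 cyc_der0 sub0r big1 ?oppr0 // => l _.
  by rewrite mulr0 mul0r.
apply: (path_ind_closed (S := fun z => ideal_set J (E z))) => {y}.
- split=> [|k z1 z2 J1 J2]; first by rewrite E0; apply: ideal0.
  by rewrite ED; apply: kJ.2.
- move=> z /adic_closureP cz; apply: closed_ideal_closed; apply/adic_closureP => n.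
  have [z' Jz' zz'] := cz n.+1; exists (E z') => //.
  have -> : E z - E z' = E (z - z').
    by rewrite (_ : z - z' = (-1) *: z' + z) ?ED scaleN1r addrC.
  apply: farB.
    by apply: cyc_der_far; apply: farMl; apply: farMr; apply: farMl.
  apply: far_sum => l _; apply: farMr; apply: farMl; apply: farMr; apply: farMl.
  exact: farW zz'.
move=> j v hv; have J0 : ideal_set J (E 0) by rewrite E0; apply: ideal0.
rewrite /E idem_bas; case: (eqVneq (walk_end i w) j) => [wj|_]; last first.
  by move: J0; rewrite /E mulr0 mul0r.
rewrite bas_idem; case: (eqVneq i (walk_end j v)) => [vi|_]; last first.
  by move: J0; rewrite /E mulr0 mul0r.
rewrite -(bas_cat_end _ wj) cyc_der_bas ?walk_cat ?hw ?wj // size_cat.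
rewrite (big_cat_nat (n := size w)) ?leq_addr //= addrAC; apply: (idealD idJ).
  rewrite [X in X - _](_ : _ = \sum_(0 <= l < size w | nth c w l == c)
      bas K (tgt c) (drop l.+1 w) * bas K j v * bas K i (take l w)).
    by rewrite subrr; apply: ideal0.
  rewrite big_nat_cond [RHS]big_nat_cond; apply: eq_big => [l|l].
    by case: (ltnP l (size w)) => [lw|]; rewrite ?andbF // nth_cat lw.
  case/andP=> /andP[_ lw]; rewrite nth_cat lw => /eqP wl.
  have [_ _ wE] := walk_nth hw lw wl.
  have -> : drop l.+1 (w ++ v) = drop l.+1 w ++ v.
    rewrite drop_cat ltn_neqAle lw andbT; case: eqP => // ->.
    by rewrite subnn drop0 drop_size.
  rewrite take_cat lw -catA (bas_cat_end _ (etrans wE wj)) -mulrA.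
  by rewrite -(bas_cat_end _ (esym vi)).
rewrite -{1}[size w]add0n big_addn addKn big_nat_cond; apply: (ideal_sum idJ) => l.
have -> : nth c (w ++ v) (l + size w) = nth c v l.
  by rewrite nth_cat ltnNge leq_addl /= addnK.
case/andP=> /andP[_ lv] /eqP vl.
have [_ vE1 vE2] := walk_nth hv lv vl.
rewrite drop_cat -addSn ltnNge leq_addl /= addnK take_cat ltnNge leq_addl /= addnK.
rewrite (bas_cat_end (j := i)) ?vE2 // bas_cat; apply: (idealMl idJ); apply: (idealMr idJ).
exact: closed_ideal_sub.
Qed.

End CyclicDerivative.

(** * An intrinsic characterisation of the truncated Jacobian ideal *)

Section TruncatedJacobianIdeal.
Variables (K : fieldType) (V : finType) (Q : quiver V).
Implicit Types (x y z W : cpa K Q) (i j : V) (w v u : seq (arr Q)) (a b c : arr Q).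
Implicit Types (J : set (cpa K Q)) (C : {set arr Q}).

(** The kernel of the map from the whole path algebra onto the truncated
    Jacobian algebra. *)
Definition tjac W C : ideal (cpa K Q) := closed_ideal
  [set x | exists2 c, c \in C & x = aelt K c \/ x = cyc_der c W].

Definition corner i j x : cpa K Q := idem K i * x * idem K j.

Lemma corner_lin i j k x y : corner i j (k *: x + y) = k *: corner i j x + corner i j y.
Proof. by rewrite /corner mulrDr mulrDl -scaleAr -scaleAl. Qed.

Lemma corner_bas i j l w :
  corner i j (bas K l w) = if (i == l) && (walk_end l w == j) then bas K l w else 0.
Proof.
rewrite /corner idem_bas; case: eqP => /= _; last by rewrite mul0r.
by rewrite bas_idem eq_sym.
Qed.

Lemma corner_far i j n x : far n x -> far n (corner i j x).
Proof. by move=> fx; apply: farMr; apply: farMl. Qed.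

Lemma corner_aelt a : corner (src a) (tgt a) (aelt K a) = aelt K a.
Proof. by rewrite corner_bas !eqxx. Qed.

Definition cutprod C J : set (cpa K Q) :=
  [set z | exists i j x y, [/\ supp C x, J y & z = corner i j x * corner j i y]].

Definition rotations : set (cpa K Q) := lin_span (@rotation_difference K V Q).

(** A condition on W which only refers to the ideals of C and J, and not to
    chosen generators of J: an algebra isomorphism which respects these ideals
    transports it. *)
Definition cutspan C J : set (cpa K Q) :=
  adic_closure (lin_span (@rotation_difference K V Q `|` cutprod C J)).

Lemma rotations_ksub : ksub rotations. Proof. exact: lin_span_submod. Qed.

Lemma cutspan_ksub C J : ksub (cutspan C J).
Proof. by apply: adic_closure_ksub; apply: lin_span_submod. Qed.

Lemma cutspan_closed C J : closed (cutspan C J).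
Proof. exact: adic_closure_closed. Qed.

Lemma cutspan_rot C J : adic_closure rotations `<=` cutspan C J.
Proof.
apply: adic_closure_mono; apply: lin_span_min; first exact: lin_span_submod.
by move=> x rx; apply: lin_span_sub; left.
Qed.

Lemma cutspan_prod C J : cutprod C J `<=` cutspan C J.
Proof. by move=> x cx; apply: sub_adic_closure; apply: lin_span_sub; right. Qed.

Lemma cyc_der_rot c x : rotation_difference x -> cyc_der c x = 0.
Proof.
case=> a [w [hw wE ->]]; rewrite cyc_derB !cyc_der_bas //; last first.
  rewrite -cats1 walk_cat /=; move: hw => /= /andP[_ ->].
  by move: wE; rewrite /walk_end /= => ->; rewrite eqxx.
apply/eqP; rewrite subr_eq0; apply/eqP; rewrite size_rcons /=.
rewrite big_mkcond [RHS]big_mkcond big_nat_recl //= [RHS]big_nat_recr //= addrC.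
rewrite nth_rcons ltnn eqxx -cats1 [drop (size w).+1 _]drop_oversize ?size_cat ?addn1 //.
rewrite take_size_cat // cats0 drop0; congr (_ + _).
  apply: eq_big_nat => l /andP[_ lw]; rewrite nth_cat lw; case: eqP => // _.
  rewrite drop_cat take_cat lw.
  have -> : (if (l.+1 < size w)%N then drop l.+1 w ++ [:: a] else drop (l.+1 - size w) [:: a])
      = drop l.+1 w ++ [:: a].
    case: ltnP => // wl; have /eqP -> : l.+1 == size w by rewrite eqn_leq lw wl.
    by rewrite subnn drop_size drop0.
  by rewrite -catA.
Qed.

(** The truncated Jacobian ideal is the least closed ideal J containing C such
    that W is a limit of cyclic rotations and of products in C * J; here is the
    minimality.  It rests on the two facts that a cyclic derivative kills
    rotations and sends x * y, for x through C, into the ideal of y and C. *)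
Lemma cyc_der_cutspan C J W c : is_ideal J -> closed J ->
  (forall b, b \in C -> J (aelt K b)) -> cutspan C J W -> J (cyc_der c W).
Proof.
move=> idJ clJ JC; have kJ := ideal_ksub idJ.
have kD : ksub [set x | J (cyc_der c x)].
  split=> [|k x y Jx Jy] /=; first by rewrite cyc_der0; apply: ideal0.
  by rewrite cyc_der_lin; apply: kJ.2.
have clD : closed [set x | J (cyc_der c x)].
  move=> x /adic_closureP cx; apply: clJ; apply/adic_closureP => n.
  have [y Jy xy] := cx n.+1; exists (cyc_der c y) => //.
  by rewrite -cyc_derB; apply: cyc_der_far.
move=> cW; apply: (clD); apply: adic_closure_mono cW; apply: lin_span_min => //.
move=> _ [/(cyc_der_rot c) /= ->|[i [j [x [y [Sx Jy ->]]]]]]; first exact: ideal0.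
apply: (supp_path_ind (C := C) (S := [set x | J (cyc_der c (corner i j x * corner j i y))])) Sx.
- split=> [|k x1 x2 J1 J2] /=.
    by rewrite /corner mulr0 !mul0r cyc_der0; apply: ideal0.
  by rewrite corner_lin mulrDl -scaleAl; apply: kD.2.
- move=> z /adic_closureP cz; apply: clD; apply/adic_closureP => n.
  have [z' Jz' zz'] := cz n; exists (corner i j z' * corner j i y) => //.
  rewrite -mulrBl; apply: farMr; rewrite /corner -mulrBl -mulrBr.
  exact: corner_far.
move=> l w hw wC /=; rewrite corner_bas.
case: (eqVneq i l) => /= [il|_]; last by rewrite mul0r cyc_der0; apply: ideal0.
case: (eqVneq (walk_end l w) j) => [wj|_]; last by rewrite mul0r cyc_der0; apply: ideal0.
have := cder_mul c y hw; rewrite wj -il -/(corner j i y) => Jd.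
rewrite -[cyc_der _ _](subrK (\sum_(0 <= l < size w | nth c w l == c)
     bas K (tgt c) (drop l.+1 w) * corner j i y * bas K i (take l w))).
apply: (idealD idJ).
  apply: (closed_ideal_min idJ clJ) Jd => _ ->.
  by apply: (supp_min idJ clJ JC); apply: supp_bas.
apply: (ideal_sum idJ) => m _; apply: (idealMr idJ); apply: (idealMl idJ).
by apply: (idealMr idJ); apply: (idealMl idJ).
Qed.

Lemma tjac_min C J W : is_ideal J -> closed J ->
  (forall b, b \in C -> J (aelt K b)) -> cutspan C J W -> ideal_set (tjac W C) `<=` J.
Proof.
move=> idJ clJ JC cW; apply: closed_ideal_min => // _ [c cC [->|->]]; first exact: JC.
exact: cyc_der_cutspan cW.
Qed.

Lemma tjac_aelt C W c : c \in C -> ideal_set (tjac W C) (aelt K c).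
Proof. by move=> cC; apply: closed_ideal_sub; exists c => //; left. Qed.

Lemma tjac_der C W c : c \in C -> ideal_set (tjac W C) (cyc_der c W).
Proof. by move=> cC; apply: closed_ideal_sub; exists c => //; right. Qed.

Lemma tjac_supp C W : supp C `<=` ideal_set (tjac W C).
Proof.
apply: supp_min; [exact: idealP|exact: closed_ideal_closed|exact: tjac_aelt].
Qed.

(** ** Rotations *)

Lemma rot_cat u v i : walk i (u ++ v) -> walk_end i (u ++ v) = i ->
  rotations (bas K i (u ++ v) - bas K (walk_end i u) (v ++ u)).
Proof.
elim: u v i => [|a u IH] v i /=.
  by move=> _ _; rewrite cats0 subrr; case: rotations_ksub.
case/andP=> /eqP <- h hE.
have hr : walk (tgt a) ((u ++ v) ++ [:: a]) by rewrite walk_cat h /=; move: hE; rewrite /walk_end /= => ->; rewrite eqxx.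
rewrite -(subrK (bas K (tgt a) (rcons (u ++ v) a)) (bas _ _ _)) -addrA.
apply: (ksubD rotations_ksub).
  apply: lin_span_sub; exists a, (u ++ v); split=> //=; rewrite ?eqxx //.
have -> : v ++ a :: u = (v ++ [:: a]) ++ u by rewrite -catA.
rewrite -cats1 -catA; apply: IH; first by rewrite catA.
by rewrite catA walk_end_cat /walk_end.
Qed.

(** By bilinearity and continuity this is the rotation of one path past another. *)
Lemma commutator_rot i j x y :
  adic_closure rotations (corner i j x * corner j i y - corner j i y * corner i j x).
Proof.
have kR := adic_closure_ksub rotations_ksub.
pose D x y := corner i j x * corner j i y - corner j i y * corner i j x.
have Dx k x1 x2 y' : D (k *: x1 + x2) y' = k *: D x1 y' + D x2 y'.
  by rewrite /D corner_lin mulrDl mulrDr -scaleAl -scaleAr scalerBr opprD addrACA.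
have Dy k x' y1 y2 : D x' (k *: y1 + y2) = k *: D x' y1 + D x' y2.
  by rewrite /D corner_lin mulrDl mulrDr -scaleAl -scaleAr scalerBr opprD addrACA.
have D0x y' : D 0 y' = 0 by rewrite /D /corner mulr0 !mul0r mulr0 subrr.
have D0y x' : D x' 0 = 0 by rewrite /D /corner mulr0 !mul0r mulr0 subrr.
rewrite -/(D x y); apply: (path_ind_closed (S := [set x | adic_closure rotations (D x y)])).
- by split=> [|k x1 x2 R1 R2] /=; rewrite ?D0x ?Dx; [case: kR|apply: kR.2].
- move=> z /adic_closureP cz; apply: adic_closure_closed; apply/adic_closureP => n.
  have [z' Rz' zz'] := cz n; exists (D z' y) => //.
  have -> : D z y - D z' y = D (z - z') y.
    by rewrite (_ : z - z' = (-1) *: z' + z) ?Dx scaleN1r addrC.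
  by apply: farB; [apply: farMr|apply: farMl]; apply: corner_far.
move=> l w hw /=; apply: (path_ind_closed (S := [set y | adic_closure rotations (D (bas K l w) y)])).
- by split=> [|k y1 y2 R1 R2] /=; rewrite ?D0y ?Dy; [case: kR|apply: kR.2].
- move=> z /adic_closureP cz; apply: adic_closure_closed; apply/adic_closureP => n.
  have [z' Rz' zz'] := cz n; exists (D (bas K l w) z') => //.
  have -> : D (bas K l w) z - D (bas K l w) z' = D (bas K l w) (z - z').
    by rewrite (_ : z - z' = (-1) *: z' + z) ?Dy scaleN1r addrC.
  by apply: farB; [apply: farMl|apply: farMr]; apply: corner_far.
move=> m v hv /=; rewrite /D !corner_bas.
have R0 : adic_closure rotations 0 by case: kR.
case: (eqVneq i l) => /= [il|_]; last by rewrite mul0r mulr0 subrr.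
case: (eqVneq (walk_end l w) j) => [wj|_]; last by rewrite mul0r mulr0 subrr.
case: (eqVneq j m) => /= [jm|_]; last by rewrite mul0r mulr0 subrr.
case: (eqVneq (walk_end m v) i) => [vi|_]; last by rewrite mul0r mulr0 subrr.
rewrite -(bas_cat_end K _ (etrans wj jm)) -(bas_cat_end K _ (etrans vi il)).
apply: sub_adic_closure; rewrite -jm -wj; apply: rot_cat.
  by rewrite walk_cat hw wj jm.
by rewrite walk_end_cat wj jm vi.
Qed.

(** A cycle meeting C in a single arrow c can be rotated so as to start with c,
    and what follows c is then its derivative with respect to c. *)
Lemma cut_cycle_rot C i w : walk i w -> walk_end i w = i -> count (mem C) w = 1%N ->
  rotations (bas K i w -
    \sum_(c in C) aelt K c * corner (tgt c) (src c) (cyc_der c (bas K i w))).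
Proof.
move=> hw wi w1; have /hasP[c cw cC] : has (mem C) w by rewrite has_count w1.
set l := index c w; have lw : (l < size w)%N by rewrite index_mem.
have [wE wE1 wE2] := walk_nth hw lw (nth_index c cw).
have uniqC d m : d \in C -> (m < size w)%N -> nth d w m = d -> m = l.
  move=> dC mw wm; apply/eqP/negPn/negP => ml.
  have : (1 < count (mem C) w)%N; last by rewrite w1.
  have [wF _ _] := walk_nth hw mw wm.
  have nC : (mem C) (nth d w l) by rewrite (set_nth_default c) // nth_index.
  rewrite wF count_cat /= dC.
  move: ml; rewrite neq_ltn => /orP[] ml.
    rewrite addnCA -[1%N]addn0 ltn_add2l addn_gt0 orbC -has_count.
    apply/orP; left; apply/(has_nthP d); exists (l - m.+1)%N.
      by rewrite size_drop ltn_sub2r // (leq_ltn_trans ml).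
    by rewrite nth_drop subnKC.
  rewrite addnCA -[1%N]addn0 ltn_add2l addn_gt0 -has_count.
  apply/orP; left; apply/(has_nthP d); exists l; first by rewrite size_takel // ltnW.
  by rewrite nth_take.
have dE d : d \in C -> cyc_der d (bas K i w) =
    if d == c then bas K (tgt c) (drop l.+1 w ++ take l w) else 0.
  move=> dC; rewrite cyc_der_bas //; case: eqP => [->|dc].
    rewrite big_mkcond (bigD1_seq l) ?iota_uniq ?mem_index_iota //= nth_index // eqxx.
    rewrite big1_seq ?addr0 // => m /andP[ml]; rewrite mem_index_iota => /andP[_ mw].
    by case: eqP => // mc; rewrite (uniqC c m) ?eqxx // in ml.
  rewrite big1_seq // => m; rewrite mem_index_iota => /andP[/eqP md /andP[_ mw]].
  case: dc; rewrite -md (uniqC d m) //.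
  by rewrite (set_nth_default c) // nth_index.
rewrite (bigD1 c) //= big1 ?addr0 => [|d /andP[dC dc]]; last first.
  by rewrite dE // (negbTE dc) /corner mulr0 mul0r mulr0.
rewrite dE // eqxx corner_bas eqxx walk_end_cat wE2 wi wE1 eqxx /=.
rewrite aelt_bas -[c :: _ ++ _]cat_cons {1}wE -wE1; apply: rot_cat; rewrite -wE //.
Qed.

(** Euler's formula: the potential is homogeneous of degree 1 in the arrows of
    C. *)
Lemma cut_pot_rot C W : is_potential W -> is_cut W C ->
  adic_closure rotations
    (W - \sum_(c in C) aelt K c * corner (tgt c) (src c) (cyc_der c W)).
Proof.
move=> pW cW; apply/adic_closureP => n.
pose L x := x - \sum_(c in C) aelt K c * corner (tgt c) (src c) (cyc_der c x).
have LD k x y : L (k *: x + y) = k *: L x + L y.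
  rewrite /L scalerBr addrACA -opprD; congr (_ - _).
  rewrite scaler_sumr -big_split; apply: eq_bigr => c _ /=.
  by rewrite cyc_der_lin corner_lin mulrDr -scaleAr.
have L0 : L 0 = 0.
  by rewrite /L big1 ?subr0 // => c _; rewrite cyc_der0 /corner mulr0 mul0r mulr0.
have kL : ksub [set x | rotations (L x)].
  have kR := rotations_ksub.
  by split=> [|k x y R1 R2] /=; rewrite ?L0 ?LD; [case: kR|apply: kR.2].
exists (L (trunc n.+1 W)).
  suff : [set x | rotations (L x)] (trunc n.+1 W) by [].
  apply: (ksub_sum _ kL) => m _; apply: (ksub_sum _ kL) => w _; apply: (ksub_sum _ kL) => i _.
  have [->|c0] := eqVneq (coef W i w) 0; first by rewrite scale0r; case: kL.
  have h : walk i w by apply: contraNT c0 => h; rewrite coef_nwalk.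
  apply: (ksubZ _ kL); move: c0; rewrite (coef_walk _ h) => c0.
  by apply: cut_cycle_rot => //; [have [] := pW _ c0|apply: cW c0].
rewrite -/(L W); have -> : L W - L (trunc n.+1 W) = L (W - trunc n.+1 W).
  by rewrite (_ : W - _ = (-1) *: trunc n.+1 W + W) ?LD scaleN1r addrC.
have fW : far n.+1 (W - trunc n.+1 W) by apply: trunc_far.
 apply: farB; first exact: farW fW.
by apply: far_sum => c _; apply: farMl; apply: corner_far; apply: cyc_der_far.
Qed.

Lemma cut_pot_cutspan C W : is_potential W -> is_cut W C -> cutspan C (ideal_set (tjac W C)) W.
Proof.
move=> pW cW; have kS := cutspan_ksub C (ideal_set (tjac W C)).
rewrite -[X in cutspan _ _ X](subrK (\sum_(c in C) aelt K c * corner (tgt c) (src c) (cyc_der c W)) W).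
apply: (ksubD kS); first exact/cutspan_rot/cut_pot_rot.
apply: (ksub_sum _ kS) => c cC; apply: cutspan_prod.
exists (src c), (tgt c), (aelt K c), (cyc_der c W).
by split; [apply: supp_aelt|apply: tjac_der|rewrite corner_aelt].
Qed.

End TruncatedJacobianIdeal.

(** * Invariance under graded right-equivalence *)

Arguments gpot {K V} g.
Arguments gdeg {K V} g.

Section GoodMorphisms.
Variables (K : fieldType) (V : finType) (Q Q' : quiver V).
Variable f : {rmorphism cpa K Q -> cpa K Q'}.
Hypothesis fk : forall c, f (kalg c) = kalg c.

Lemma rmorphZ c x : f (c *: x) = c *: f x.
Proof. by rewrite -!kalgM rmorphM fk. Qed.

(** Algebra isomorphisms preserve the arrow ideal, which is the Jacobson
    radical, hence its powers: they are automatically continuous. *)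
Lemma rmorph_far : surjective f -> forall n x, far n x -> far n (f x).
Proof.
move=> fs; have f1 x : far 1 x -> far 1 (f x).
  move=> /far1P fx; apply/far1P => y; have [y' <-] := fs y.
  have [z zE] := fx y'; exists (f z).
  by rewrite -[1 in LHS](rmorph1 f) -rmorphM -rmorphB -rmorphM zE rmorph1.
elim=> [|n IH] x fx; first exact: far_all.
rewrite (ldiv_sum (farW _ fx)) // rmorph_sum; apply: far_sum => a _.
rewrite rmorphM -[n.+1]add1n; apply: farM; last exact/IH/ldiv_far.
by apply: f1; apply: far_bas.
Qed.

Lemma preim_ksub S : ksub S -> ksub (f @^-1` S).
Proof.
case=> S0 SD; split=> [|c x y Sx Sy]; rewrite /preimage /= ?rmorph0 //.
by rewrite rmorphD rmorphZ; apply: SD.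
Qed.

Hypothesis fi : forall i, f (idem K i) = idem K i.

Lemma rmorph_corner i j x : f (corner i j x) = corner i j (f x).
Proof. by rewrite /corner !rmorphM !fi. Qed.

Hypothesis ffar : forall n x, far n x -> far n (f x).

(** A rotation is the commutator of an arrow and a path, and this description,
    unlike rotations themselves, is preserved by morphisms. *)
Lemma rmorph_rotations x : adic_closure (@rotations K V Q) x ->
  adic_closure (@rotations K V Q') (f x).
Proof.
move=> cx; apply: adic_closure_closed.
apply: (image_adic_closure ffar) cx => t.
have kR := adic_closure_ksub (@rotations_ksub K V Q').
apply: (lin_span_min (preim_ksub kR)) => _ [a [w [hw wE ->]]].
rewrite /preimage /= rmorphB -cats1 -aelt_bas (bas_cat_end K _ (wE : walk_end (tgt a) w = _)).
rewrite -/(aelt K a) !rmorphM.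
have -> : bas K (tgt a) w = corner (tgt a) (src a) (bas K (tgt a) w).
  by rewrite corner_bas eqxx (wE : walk_end (tgt a) w = _) eqxx.
by rewrite -(corner_aelt K a) !rmorph_corner; apply: commutator_rot.
Qed.

Lemma rmorph_cutspan C J C' J' x :
  (forall x, supp C x -> supp C' (f x)) -> (forall x, J x -> J' (f x)) ->
  cutspan C J x -> cutspan C' J' (f x).
Proof.
move=> fC fJ cx; have kS := @cutspan_ksub K V Q' C' J'.
apply: cutspan_closed; apply: (image_adic_closure ffar) cx => t.
apply: (lin_span_min (preim_ksub kS)) => z0 [rx|[i [j [y [z [Sy Jz ->]]]]]].
  apply: cutspan_rot; apply: rmorph_rotations; apply: sub_adic_closure.
  exact: lin_span_sub.
rewrite /preimage /= rmorphM !rmorph_corner; apply: cutspan_prod.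
by exists i, j, (f y), (f z); split=> //; [apply: fC|apply: fJ].
Qed.
End GoodMorphisms.

Section GradedEquivalence.
Variables (K : fieldType) (V : finType).

(** The preimage under f of the ideal of W' satisfies the conditions of
    [tjac_min] for W. *)
Lemma equiv_tjac (Q Q' : quiver V) (f : {rmorphism cpa K Q -> cpa K Q'})
    (g : {rmorphism cpa K Q' -> cpa K Q}) W W' C C' :
  cancel f g -> cancel g f ->
  (forall c, f (kalg c) = kalg c) -> (forall i, f (idem K i) = idem K i) ->
  (forall x, supp C x -> supp C' (f x)) -> (forall x, supp C' x -> supp C (g x)) ->
  cutspan C' (ideal_set (tjac W' C')) W' ->
  adic_closure (@rotations K V Q') (f W - W') ->
  forall x, ideal_set (tjac W C) x -> ideal_set (tjac W' C') (f x).
Proof.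
move=> fK gK fk fi fC gC cW' fW; pose J := f @^-1` ideal_set (tjac W' C').
have ffar := rmorph_far (f := f) (fun y => ex_intro _ _ (gK y)).
have gk c : g (kalg c) = kalg c by rewrite -fk fK.
have gi i : g (idem K i) = idem K i by rewrite -fi fK.
have gfar := rmorph_far (f := g) (fun y => ex_intro _ _ (fK y)).
apply: (tjac_min (J := J)).
- by apply: ideal_preim; apply: idealP.
- by apply: (preim_closed ffar); apply: closed_ideal_closed.
- by move=> b bC; apply: tjac_supp; apply/fC/supp_aelt.
have kS := cutspan_ksub C J; rewrite -(subrK (g W') W); apply: (ksubD kS).
  have := rmorph_rotations gk gi gfar fW; rewrite rmorphB fK.
  exact: cutspan_rot.
by apply: (rmorph_cutspan gk gi gfar) cW' => // x; rewrite /J /preimage /= gK.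
Qed.

Implicit Types G H : gqp K V.

Definition gtjac G := tjac (gpot G) (degree1_arrows G).

Definition deg01 G : Prop := forall a, gdeg G a = 0 \/ gdeg G a = 1.

Lemma deg_sum0 G (w : seq (arr (gquiv G))) : deg01 G ->
  (\sum_(a <- w) gdeg G a == 0) = ~~ has (mem (degree1_arrows G)) w.
Proof.
move=> dG; have dge a : 0 <= gdeg G a by case: (dG a) => ->.
elim: w => [|a w IH]; first by rewrite big_nil.
rewrite big_cons /= negb_or -IH Num.Theory.paddr_eq0 ?Num.Theory.sumr_ge0 // inE.
by case: (dG a) => ->.
Qed.

Lemma homogeneousP G n (x : cpa K (gquiv G)) : homogeneous (gdeg G) n x <->
  forall i w, coef x i w != 0 -> \sum_(a <- w) gdeg G a = n.
Proof.
split=> hx; last by move=> p; rewrite -coefE; apply: hx.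
move=> i w; case: (boolP (walk i w)) => h; last by rewrite coef_nwalk ?eqxx.
by rewrite (coef_walk _ h) => /hx.
Qed.

Section OneEquivalence.
Variables (G H : gqp K V) (dG : deg01 G) (dH : deg01 H).
Variable f : {rmorphism cpa K (gquiv G) -> cpa K (gquiv H)}.
Hypothesis ffar : forall n x, far n x -> far n (f x).
Hypothesis fdeg : forall n x, homogeneous (gdeg G) n x -> homogeneous (gdeg H) n (f x).
Let C := degree1_arrows G.
Let C' := degree1_arrows H.

Lemma equiv_supp x : supp C x -> supp C' (f x).
Proof.
move: x; suff : supp C `<=` f @^-1` supp C' by [].
apply: supp_min.
- exact: ideal_preim (supp_ideal K C').
- by apply: (preim_closed ffar); apply: supp_closed.
move=> c; rewrite inE => /eqP c1.
have /fdeg/homogeneousP fc : homogeneous (gdeg G) 1 (aelt K c).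
  apply/homogeneousP => i w; rewrite coef_bas.
  by case: (eqVneq [:: c] w) => [<-|]; rewrite ?andbF ?eqxx // big_seq1.
move=> i w /fc w1; rewrite -[has _ _]negbK -deg_sum0 // w1.
by [].
Qed.

(** The part of x off C has degree 0, hence so does its image; this image also
    lies in the ideal of C', so it is 0. *)
Lemma equiv_supp_inj x : injective f -> supp C' (f x) -> supp C x.
Proof.
move=> finj Sfx.
pose x0 : cpa K (gquiv G) := fun p => if has (mem C) (pword p) then 0 else x p.
have x0E i w : coef x0 i w = if has (mem C) w then 0 else coef x i w.
  case: (boolP (walk i w)) => h; last by rewrite !coef_nwalk ?if_same.
  by rewrite !(coef_walk _ h).
have S1 : supp C (x - x0).
  by move=> i w; rewrite coefB x0E; case: ifP => // _; rewrite subrr eqxx.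
suff x00 : x0 = 0 by move: S1; rewrite x00 subr0.
apply: finj; rewrite rmorph0; apply: cpaP => i w h; rewrite coef0.
apply/eqP/negPn/negP => c0.
have /fdeg/homogeneousP/(_ i w c0)/eqP : homogeneous (gdeg G) 0 x0.
  apply/homogeneousP => j v; rewrite x0E; case: ifP; rewrite ?eqxx // => vC _.
  by apply/eqP; rewrite deg_sum0 ?vC.
rewrite deg_sum0 // => /negP; apply.
have : supp C' (f x0).
  rewrite -[x0](subKr x) rmorphB; apply: (idealB (supp_ideal K C')) => //.
  exact: equiv_supp.
by move=> Sx0; apply: Sx0 c0.
Qed.
End OneEquivalence.

Lemma graded_equiv_tjac G H : deg01 G -> deg01 H ->
  cutspan (degree1_arrows G) (ideal_set (gtjac G)) (gpot G) ->
  cutspan (degree1_arrows H) (ideal_set (gtjac H)) (gpot H) ->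
  graded_right_equiv G H ->
  alg_iso (qalg (gtjac G) : pzAlgType K) (qalg (gtjac H)).
Proof.
move=> dG dH cG cH [f [[g0 fK gK] fk fi fdeg fW]].
have gz : zmod_morphism g0.
  by move=> x y; apply: (can_inj fK); rewrite gK rmorphB !gK.
have gm : monoid_morphism g0.
  by split=> [|x y]; apply: (can_inj fK); rewrite gK ?rmorph1 ?rmorphM ?gK.
pose g := mk_rmorphism gz gm.
have ffar := rmorph_far (f := f) (fun y => ex_intro _ _ (gK y)).
have gk c : g (kalg c) = kalg c by rewrite -fk /= fK.
have gi i : g (idem K i) = idem K i by rewrite -fi /= fK.
have gfar := rmorph_far (f := g) (fun y => ex_intro _ _ (fK y)).
have fC := equiv_supp dH ffar fdeg.
have gC x : supp (degree1_arrows H) x -> supp (degree1_arrows G) (g x).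
  move=> Sx; apply: (equiv_supp_inj dG dH ffar fdeg (can_inj fK)).
  by rewrite /= gK.
apply: (qalg_iso (f := f)) => // [y|x]; first by exists (g y); apply: gK.
split; first exact: (equiv_tjac (g := g)).
rewrite -{2}(fK x); apply: (equiv_tjac (f := g) (g := f)) => //.
have := rmorph_rotations gk gi gfar fW.
have kR := adic_closure_ksub (@rotations_ksub K V (gquiv G)).
by move=> /(ksubN kR); rewrite rmorphB opprB /= fK.
Qed.

End GradedEquivalence.

(** * Restriction and extension along partial maps of arrows *)

Section Pullback.
Variables (K : fieldType) (V : finType) (Q Q' : quiver V).
Variable u : arr Q' -> option (seq (arr Q)).

Definition letterwise : Prop := forall a' v, u a' = Some v ->
  exists2 a, v = [:: a] & src a = src a' /\ tgt a = tgt a'.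

Hypothesis uP : letterwise.

Lemma expand_cat w1 w2 : expand u (w1 ++ w2) =
  if (expand u w1, expand u w2) is (Some v1, Some v2) then Some (v1 ++ v2) else None.
Proof.
elim: w1 => [|a w1 IH] /=; first by case: expand.
case: (u a) => // v; rewrite IH; case: (expand u w1) => // v1; case: (expand u w2) => // v2.
by rewrite catA.
Qed.

Lemma expandP w v : expand u w = Some v ->
  [/\ size v = size w, forall i, walk i v = walk i w & forall i, walk_end i v = walk_end i w].
Proof.
elim: w v => [|a w IH] v /=; first by case=> <-.
case ua: (u a) => [va|] //; have [b -> [sb tb]] := uP ua.
case: (expand u w) IH => // v' /(_ v' erefl) [sE wE eE] [<-] /=.
split=> [|i|i]; first by rewrite sE.
  by rewrite sb tb wE.
by rewrite /walk_end /= tb; apply: eE.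
Qed.

Lemma coef_pull (x : cpa K Q) i w : coef (pullback u x) i w =
  if expand u w is Some v then coef x i v else 0.
Proof.
case: (boolP (walk i w)) => h; first by rewrite (coef_walk _ h).
rewrite coef_nwalk //; case E: expand => [v|] //.
by have [_ wE _] := expandP E; rewrite coef_nwalk // wE.
Qed.

Lemma pull_zmod : zmod_morphism (pullback u : cpa K Q -> cpa K Q').
Proof.
move=> x y; apply: cpaP => i w h; rewrite coefB !coef_pull.
by case: expand => [v|]; rewrite ?coefB ?subr0.
Qed.

Lemma pull_monoid : monoid_morphism (pullback u : cpa K Q -> cpa K Q').
Proof.
split=> [|x y]; apply: cpaP => i w h.
  rewrite coef_pull coef1 //; case E: expand => [v|].
    by have [sE wE _] := expandP E; rewrite coef1 ?wE // -!size_eq0 sE.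
  by case: w h E.
rewrite coef_pull coefM //; case E: expand => [v|].
  have [sE wE _] := expandP E; rewrite coefM ?wE // sE.
  apply: eq_big_nat => l /andP[_ lw]; rewrite !coef_pull.
  move: E; rewrite -{1}(cat_take_drop l w) expand_cat.
  case E1: (expand u (take l w)) => [v1|] //; case E2: (expand u (drop l w)) => [v2|] // [<-].
  have [s1 _ e1] := expandP E1; have [s2 _ _] := expandP E2.
  by rewrite take_size_cat ?drop_size_cat ?e1 // s1 size_takel.
apply/esym/big1 => l _; rewrite !coef_pull.
move: E; rewrite -{1}(cat_take_drop l w) expand_cat.
by case: expand => [v1|]; case: expand => [v2|] // _; rewrite ?mul0r ?mulr0.
Qed.

Definition pull : {rmorphism cpa K Q -> cpa K Q'} := mk_rmorphism pull_zmod pull_monoid.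

Lemma pullE x : pull x = pullback u x. Proof. by []. Qed.

Lemma pullZ c x : pull (c *: x) = c *: pull x.
Proof.
apply: cpaP => i w h; rewrite coefZ pullE coef_pull pullE coef_pull.
by case: expand => [v|]; rewrite ?coefZ ?mulr0.
Qed.

Lemma pull_kalg c : pull (kalg c) = kalg c.
Proof. by rewrite !kalgE pullZ rmorph1. Qed.

Lemma pull_idem i : pull (idem K i) = idem K i.
Proof.
apply: cpaP => j w h; rewrite pullE coef_pull coef_bas h andbT.
case E: expand => [v|].
  by have [sE wE _] := expandP E; rewrite coef_bas wE h andbT ![[::] == _]eq_sym -!size_eq0 sE.
by case: w h E => //= a w _ _; rewrite andbF.
Qed.

Lemma pull_far n x : far n x -> far n (pull x).
Proof.
move=> /farP fx; apply/farP => i w wn; rewrite pullE coef_pull.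
by case E: expand => [v|] //; have [sE _ _] := expandP E; rewrite fx // sE.
Qed.

End Pullback.

(** ** Quivers with the same vertices and fewer arrows *)

Section SubQuiver.
Variables (K : fieldType) (V : finType) (Q Q' : quiver V).
Variables (e : arr Q -> arr Q').
Variables (u : arr Q' -> option (seq (arr Q))) (u' : arr Q -> option (seq (arr Q'))).
Hypothesis einj : injective e.
Hypothesis e_src : forall a, src (e a) = src a.
Hypothesis e_tgt : forall a, tgt (e a) = tgt a.
Hypothesis ue : forall a, u (e a) = Some [:: a].
Hypothesis u_out : forall a', a' \notin codom e -> u a' = None.
Hypothesis u'E : forall a, u' a = Some [:: e a].

Definition new_arrows : {set arr Q'} := [set a' | a' \notin codom e]%SET.

Lemma extend_letterwise : letterwise u.
Proof.
move=> a' v; case: (boolP (a' \in codom e)) => [/codomP[a ->]|/u_out-> //].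
by rewrite ue => -[<-]; exists a.
Qed.

Lemma restrict_letterwise : letterwise u'.
Proof. by move=> a v; rewrite u'E => -[<-]; exists (e a). Qed.

Definition extend : {rmorphism cpa K Q -> cpa K Q'} := pull K extend_letterwise.
Definition restrict : {rmorphism cpa K Q' -> cpa K Q} := pull K restrict_letterwise.

Lemma expand_e w : expand u (map e w) = Some w.
Proof. by elim: w => //= a w ->; rewrite ue. Qed.

Lemma expand_map_e w : expand u' w = Some (map e w).
Proof. by elim: w => //= a w ->; rewrite u'E. Qed.

Lemma expand_out w : (if expand u w is Some v then w = map e v else has (mem new_arrows) w).
Proof.
elim: w => //= a w IH; case: (boolP (a \in codom e)) => [/codomP[b ->]|ao].
  rewrite ue; case: (expand u w) IH => [v ->|] //= ->.
  by rewrite orbT.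
by rewrite u_out // inE ao.
Qed.

Lemma restrictK x : restrict (extend x) = x.
Proof. by apply: cpaP => i w h; rewrite pullE (coef_pull restrict_letterwise) expand_map_e pullE (coef_pull extend_letterwise) expand_e. Qed.

Lemma extend_restrict x : supp new_arrows (x - extend (restrict x)).
Proof.
move=> i w; rewrite coefB (coef_pull extend_letterwise).
have := expand_out w; case: expand => [v ->|//].
by rewrite (coef_pull restrict_letterwise) expand_map_e subrr eqxx.
Qed.

Lemma restrict0 x : supp new_arrows x -> restrict x = 0.
Proof.
move=> Sx; apply: cpaP => i w h; rewrite pullE (coef_pull restrict_letterwise) expand_map_e coef0.
apply/eqP/negPn/negP => /Sx /hasP[a /mapP[b _ ->]].
by rewrite /= inE codom_f.
Qed.

Lemma walk_e i w : walk i (map e w) = walk i w.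
Proof. by elim: w i => //= a w IH i; rewrite e_src e_tgt IH. Qed.

Lemma extend_bas i w : extend (bas K i w) = bas K i (map e w).
Proof.
apply: cpaP => j v hv; rewrite pullE (coef_pull extend_letterwise) coef_bas.
have := expand_out v; case E: expand => [v'|].
  move=> vE; rewrite coef_bas vE (inj_eq (inj_map einj)) walk_e.
  by [].
move=> vo; rewrite (_ : map e w == v = false) ?andbF //.
by apply/eqP => vE; move: E; rewrite -vE expand_e.
Qed.

Lemma cyc_der_extend a x : cyc_der (e a) (extend x) = extend (cyc_der a x).
Proof.
move: x; apply: path_ind_closed.
- split=> [|c x y Sx Sy]; first by rewrite rmorph0 !cyc_der0 rmorph0.
  by rewrite rmorphD (pullZ extend_letterwise) cyc_der_lin Sx Sy cyc_der_lin rmorphD (pullZ extend_letterwise).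
- move=> x /adic_closureP cx; apply/eqP; rewrite -subr_eq0; apply/eqP/far_eq0 => n.
  have [y yE xy] := cx n.+1.
  rewrite -(subrK (cyc_der (e a) (extend y)) (cyc_der _ _)) {2}yE -addrA -rmorphB.
  rewrite -cyc_derB -rmorphB; apply: farD.
    by apply: cyc_der_far; apply: (pull_far extend_letterwise).
  rewrite -cyc_derB; apply: (pull_far extend_letterwise); apply: cyc_der_far.
  by rewrite -opprB; apply: farN.
move=> i w h; rewrite extend_bas !cyc_der_bas ?walk_e // rmorph_sum size_map.
rewrite big_nat_cond [RHS]big_nat_cond; apply: eq_big => [l|l].
  by case: (ltnP l (size w)) => lw; rewrite ?andbF // (nth_map a) ?(inj_eq einj).
by move=> _; rewrite extend_bas map_cat map_take map_drop e_tgt.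
Qed.

Lemma cyc_der_new a' x : a' \in new_arrows -> cyc_der a' (extend x) = 0.
Proof.
rewrite inE => an; move: x; apply: path_ind_closed.
- split=> [|c x y Sx Sy]; first by rewrite rmorph0 !cyc_der0.
  by rewrite rmorphD (pullZ extend_letterwise) cyc_der_lin Sx Sy scaler0 addr0.
- move=> x /adic_closureP cx; apply/far_eq0 => n.
  have [y yE xy] := cx n.+1.
  rewrite -(subr0 (cyc_der _ _)) -yE -cyc_derB -rmorphB.
  by apply: cyc_der_far; apply: (pull_far extend_letterwise).
move=> i w h; rewrite extend_bas cyc_der_bas ?walk_e // size_map.
rewrite big1_seq // => l /andP[/eqP wl]; rewrite mem_index_iota => /andP[_ lw].
have : a' \in map e w by rewrite -[X in X \in _]wl mem_nth ?size_map.
by case/mapP=> b _ aE; case/negP: an; rewrite aE codom_f.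
Qed.

(** Killing the new arrows identifies a quotient by an ideal containing them
    with a quotient of the smaller path algebra. *)
Lemma restrict_iso (J' : ideal (cpa K Q')) (J : ideal (cpa K Q)) :
  supp new_arrows `<=` ideal_set J' ->
  (forall x, ideal_set J x -> ideal_set J' (extend x)) ->
  (forall x, ideal_set J' x -> ideal_set J (restrict x)) ->
  alg_iso (qalg J' : pzAlgType K) (qalg J).
Proof.
move=> SJ JJ' J'J; apply: (qalg_iso (f := restrict)) => [c|x|x].
- exact: (pull_kalg restrict_letterwise).
- by exists (extend x); apply: restrictK.
split=> [/J'J//|/JJ' Jx]; rewrite -(subrK (extend (restrict x)) x).
by apply: (idealD (idealP J')) => //; apply/SJ/extend_restrict.
Qed.

End SubQuiver.

(** * Truncated Jacobian algebras of reduced parts *)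

Section ReducedPart.
Variables (K : fieldType) (V : finType).
Implicit Types G H M T : gqp K V.

(** Killing the cut after the derivatives or before them gives the same
    quotient. *)
Lemma gtruncated_jacobian_iso G :
  alg_iso (qalg (gtjac G) : pzAlgType K) (gtruncated_jacobian G).
Proof.
pose C := degree1_arrows G; pose Qc := cut_quiver C.
pose e : arr Qc -> arr (gquiv G) := val.
pose u (a : arr (gquiv G)) : option (seq (arr Qc)) :=
  if insub a is Some b then Some [:: b] else None.
have ue a : u (e a) = Some [:: a] by rewrite /u valK.
have u_out a : a \notin codom e -> u a = None.
  by rewrite /u; case: insubP => // b _ <-; rewrite codom_f.
have newC : supp (new_arrows e) `<=` ideal_set (gtjac G).
  apply: supp_min; [exact: idealP|exact: closed_ideal_closed|] => c.
  rewrite inE => cn; apply: tjac_aelt; apply: contraR cn => cC.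
  by apply/codomP; exists (Sub c cC : arr Qc).
apply: (@restrict_iso _ _ Qc (gquiv G) e u (fun a => Some [:: val a]) (fun=> erefl) (fun=> erefl)
   ue u_out (fun=> erefl)) => // x Jx.
  apply: (@closed_ideal_min _ _ _ _ ((extend _ _ _ ue u_out) @^-1` ideal_set (gtjac G))) Jx.
  - by apply: ideal_preim; apply: idealP.
  - by apply: preim_closed; [apply: pull_far|apply: closed_ideal_closed].
  move=> _ [c cC <-]; rewrite /preimage /=.
  pose y := cyc_der c (gpot G); have yJ : ideal_set (gtjac G) y by apply: tjac_der.
  have := @extend_restrict K _ Qc (gquiv G) e u (fun a => Some [:: val a]) (fun=> erefl) (fun=> erefl)
    ue u_out (fun=> erefl) y.
  move=> /newC Jd; rewrite -[pullback _ _](subKr y); apply: (idealB (idealP (gtjac G))) => //.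
pose r := @restrict K _ Qc (gquiv G) e (fun a => Some [:: val a]) (fun=> erefl) (fun=> erefl) (fun=> erefl).
set Jc := closed_ideal _; apply: (@closed_ideal_min _ _ _ _ (r @^-1` ideal_set Jc)) Jx.
- by apply: ideal_preim; apply: idealP.
- by apply: preim_closed; [apply: pull_far|apply: closed_ideal_closed].
move=> _ [c cC [->|->]].
  suff r0 : r (aelt K c) = 0 by rewrite /preimage /mkset r0; exact: ideal0 (idealP Jc).
  apply: restrict0; apply: supp_aelt; rewrite inE; apply/negP => /codomP[b cb].
  by move: (valP b); rewrite -/(e b) -cb cC.
by apply: closed_ideal_sub; exists c.
Qed.

(** A trivial quiver with potential has a semisimple Jacobian algebra, so that
    the radical, and with it every arrow, lies in the Jacobian ideal. *)
Lemma trivial_far1 (Q : quiver V) (W : cpa K Q) x :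
  alg_iso (jacobian W) (cpa K (arrowless_quiver V)) -> far 1 x ->
  ideal_set (closed_ideal [set cyc_der a W | a in setT]) x.
Proof.
case=> F [[F' FK F'K] _] fx; set J := closed_ideal _; apply/qpi0.
apply: (can_inj FK); rewrite rmorph0.
have Fs y : exists z, F (qpi J z) = y.
  by have [z zE] := qpi_surj (F' y); exists z; rewrite zE F'K.
have : far 1 (F (qpi J x)).
  apply/far1P => y; have [y' <-] := Fs y; have [z zE] := (far1P x).1 fx y'.
  exists (F (qpi J z)); rewrite -!rmorphM.
  by rewrite -[1 in LHS](rmorph1 F) -(rmorph1 (qpi J)) -!rmorphB -!rmorphM zE !rmorph1.
move=> fF; apply/funext => p; apply: fF.
by rewrite /plen; case: (pword p) => // -[].
Qed.

Section Sum.
Variables (M T : gqp K V).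
Let H := gqp_sum M T.
Let eM : arr (gquiv M) -> arr (gquiv H) := inl.
Let eT : arr (gquiv T) -> arr (gquiv H) := inr.
Let uM (a : arr (gquiv H)) : option (seq (arr (gquiv M))) :=
  if a is inl b then Some [:: b] else None.
Let uT (a : arr (gquiv H)) : option (seq (arr (gquiv T))) :=
  if a is inr b then Some [:: b] else None.

Lemma uM_out a : a \notin codom eM -> uM a = None.
Proof. by case: a => // b; rewrite (codom_f eM b). Qed.
Lemma uT_out a : a \notin codom eT -> uT a = None.
Proof. by case: a => // b; rewrite (codom_f eT b). Qed.

Let xM := @extend K V (gquiv M) (gquiv H) eM uM (fun=> erefl) (fun=> erefl) (fun=> erefl) uM_out.
Let xT := @extend K V (gquiv T) (gquiv H) eT uT (fun=> erefl) (fun=> erefl) (fun=> erefl) uT_out.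
Let rM := @restrict K V (gquiv M) (gquiv H) eM (fun b => Some [:: eM b]) (fun=> erefl) (fun=> erefl) (fun=> erefl).

Lemma gpot_sum : gpot H = xM (gpot M) + xT (gpot T).
Proof. by []. Qed.

Lemma new_arrows_M a : (a \in new_arrows eM) = if a is inr _ then true else false.
Proof.
rewrite inE; case: a => a; first by rewrite (codom_f eM a).
by apply/negP => /codomP[].
Qed.

Lemma new_arrows_T a : (a \in new_arrows eT) = if a is inl _ then true else false.
Proof.
rewrite inE; case: a => a; last by rewrite (codom_f eT a).
by apply/negP => /codomP[].
Qed.

Lemma eM_inj : injective eM. Proof. by move=> ? ? []. Qed.
Lemma eT_inj : injective eT. Proof. by move=> ? ? []. Qed.

Lemma cyc_der_sumM a : cyc_der (inl a : arr (gquiv H)) (gpot H) = xM (cyc_der a (gpot M)).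
Proof.
rewrite gpot_sum cyc_derD (cyc_der_extend (e := eM)); last exact: eM_inj.
rewrite (cyc_der_new (e := eT)) ?addr0 //; first exact: eT_inj.
by rewrite new_arrows_T.
Qed.

Lemma cyc_der_sumT a : cyc_der (inr a : arr (gquiv H)) (gpot H) = xT (cyc_der a (gpot T)).
Proof.
rewrite gpot_sum cyc_derD (cyc_der_extend (e := eT)); last exact: eT_inj.
rewrite (cyc_der_new (e := eM)) ?add0r //; first exact: eM_inj.
by rewrite new_arrows_M.
Qed.

Lemma uM_letter : letterwise uM. Proof. by case=> a v //= [<-]; exists a. Qed.
Lemma uT_letter : letterwise uT. Proof. by case=> a v //= [<-]; exists a. Qed.
Lemma coef_xM y i w : coef (xM y) i w = if expand uM w is Some v then coef y i v else 0.
Proof. exact: (coef_pull uM_letter). Qed.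
Lemma coef_xT y i w : coef (xT y) i w = if expand uT w is Some v then coef y i v else 0.
Proof. exact: (coef_pull uT_letter). Qed.

Lemma coef_sum_pot i w : coef (gpot H) i w != 0 ->
  (exists2 v, w = map eM v & coef (gpot M) i v != 0) \/
  (exists2 v, w = map eT v & coef (gpot T) i v != 0).
Proof.
rewrite gpot_sum coefD coef_xM coef_xT.
have := @expand_out _ (gquiv M) (gquiv H) eM uM (fun=> erefl) uM_out w.
have := @expand_out _ (gquiv T) (gquiv H) eT uT (fun=> erefl) uT_out w.
case: (expand uM w) => [v|]; case: (expand uT w) => [v'|]; rewrite ?add0r ?addr0 ?eqxx //.
- move=> wT wM; have [v0|v0 _] := eqVneq (coef (gpot M) i v) 0.
    by rewrite v0 add0r; right; exists v'.
  by left; exists v.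
- by move=> _ wM; left; exists v.
by move=> wT _; right; exists v'.
Qed.

Hypotheses (cM : is_cut_gqp M) (cT : is_cut_gqp T).

Lemma sum_deg01 : deg01 H.
Proof. by case: cM cT => _ dM _ [_ dT _] [a|a]; [apply: dM|apply: dT]. Qed.

Lemma walk_eM i w : walk (Q := gquiv H) i (map eM w) = walk i w.
Proof. exact: walk_e. Qed.
Lemma walk_eT i w : walk (Q := gquiv H) i (map eT w) = walk i w.
Proof. exact: walk_e. Qed.

Lemma sum_pot : is_potential (gpot H) /\ is_cut (gpot H) (degree1_arrows H).
Proof.
case: cM cT => pM _ kM [pT _ kT]; split=> p; rewrite -coefE => /coef_sum_pot; rewrite /plen /pend.
  have hp : walk (pstart p) (pword p) := valP p; move: hp.
  set i := pstart p; set w := pword p => hp.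
  case=> -[v wE]; move: hp; rewrite wE ?walk_eM ?walk_eT => hv; rewrite (coef_walk _ hv).
    by case/pM=> pE pl; rewrite size_map /walk_end -map_comp; split.
  by case/pT=> pE pl; rewrite size_map /walk_end -map_comp; split.
have hp : walk (pstart p) (pword p) := valP p; move: hp.
set i := pstart p; set w := pword p => hp.
case=> -[v wE]; move: hp; rewrite wE ?walk_eM ?walk_eT => hv; rewrite (coef_walk _ hv).
  move/kM; rewrite count_map => <-; apply: eq_count => a /=.
  by rewrite !inE.
move/kT; rewrite count_map => <-; apply: eq_count => a /=.
by rewrite !inE.
Qed.

(** The arrow of the cut in a cycle of the potential survives in the derivative
    with respect to any other arrow. *)
Lemma cut_der_supp a : a \notin degree1_arrows T ->
  supp (degree1_arrows T) (cyc_der a (gpot T)).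
Proof.
case: cT => _ _ kT aC i w; case: (boolP (walk i w)) => h; last by rewrite coef_nwalk ?eqxx.
rewrite (coef_walk _ h) /cyc_der => s0.
have [t t0] : exists t : (size w).+1.-tuple (arr (gquiv T)), \sum_(l < (size w).+1 | (tnth t l == a) &&
     ((i, w) == (tgt a, drop l.+1 t ++ take l t))) coef (gpot T) (src (thead t)) t != 0.
  apply/existsP; apply: contraNT s0; rewrite negb_exists => /forallP t0.
  by apply/eqP/big1 => t _; apply/eqP; have := t0 t; rewrite negbK.
have [l] : exists l : 'I_(size w).+1, [&& tnth t l == a, (i, w) == (tgt a, drop l.+1 t ++ take l t)
     & coef (gpot T) (src (thead t)) t != 0].
  apply/existsP; apply: contraNT t0; rewrite negb_exists => /forallP t0.
  apply/eqP/big1 => l /andP[la lw]; apply/eqP; have := t0 l.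
  by rewrite la lw /= negbK.
case/and3P => /eqP ta /eqP[_ wE]; case: (boolP (walk (src (thead t)) t)) => ht; last by rewrite coef_nwalk ?eqxx.
rewrite (coef_walk _ ht) => /kT; rewrite [pword _]/= => t1.
have : has (mem (degree1_arrows T)) t by rewrite has_count t1.
have tE : tval t = take l t ++ a :: drop l.+1 t.
  rewrite -{1}(cat_take_drop l t) (drop_nth a) ?size_tuple // -tnth_nth ta.
  by [].
by rewrite {1}tE has_cat /= (negbTE aC) /= orbC [X in _ -> has _ X]wE has_cat.
Qed.

(** All arrows of T are in the ideal of the sum by [trivial_far1], and killing
    them leaves the potential of M. *)
Lemma sum_tjac_iso : is_trivial T ->
  alg_iso (qalg (gtjac H) : pzAlgType K) (qalg (gtjac M)).
Proof.
case=> T2 Tiso; have JH := idealP (gtjac H).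
have clH : closed (ideal_set (gtjac H)) by apply: closed_ideal_closed.
have xTfar n x : far n x -> far n (xT x) by apply: pull_far.
have xMfar n x : far n x -> far n (xM x) by apply: pull_far.
have rMfar n x : far n x -> far n (rM x) by apply: pull_far.
have xTC x : supp (degree1_arrows T) x -> ideal_set (gtjac H) (xT x).
  move: x; suff : supp (degree1_arrows T) `<=` xT @^-1` ideal_set (gtjac H) by [].
  apply: supp_min; [exact: ideal_preim|exact: preim_closed|] => c cC.
  change (ideal_set (gtjac H) (xT (aelt K c))); rewrite extend_bas; last exact: eT_inj.
  by apply: (@tjac_aelt K V (gquiv H) (degree1_arrows H) (gpot H) (eT c)); rewrite inE; rewrite inE in cC.
have xTJ x : far 1 x -> ideal_set (gtjac H) (xT x).
  move=> /(trivial_far1 Tiso); apply: (closed_ideal_min (J := xT @^-1` ideal_set (gtjac H))).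
  - exact: ideal_preim.
  - exact: preim_closed.
  move=> _ [a _ <-]; change (ideal_set (gtjac H) (xT (cyc_der a (gpot T)))).
  case: (boolP (a \in degree1_arrows T)) => aC; last exact/xTC/cut_der_supp.
  by rewrite -cyc_der_sumT; apply: tjac_der; rewrite inE; rewrite inE in aC.
apply: (@restrict_iso _ _ _ _ eM uM (fun b => Some [:: eM b]) (fun=> erefl) (fun=> erefl)
   (fun=> erefl) uM_out (fun=> erefl)).
- apply: supp_min => // -[a|a]; rewrite new_arrows_M // => _.
  have <- : xT (aelt K a) = aelt K (eT a) by rewrite extend_bas //; exact: eT_inj.
  by apply: xTJ; apply: far_bas.
- apply: (closed_ideal_min (J := xM @^-1` ideal_set (gtjac H))).
  + exact: ideal_preim.
  + exact: preim_closed.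
  move=> _ [c cC [->|->]].
    change (ideal_set (gtjac H) (xM (aelt K c))); rewrite extend_bas; last exact: eM_inj.
    by apply: (@tjac_aelt K V (gquiv H) (degree1_arrows H) (gpot H) (eM c)); rewrite inE; rewrite inE in cC.
  change (ideal_set (gtjac H) (xM (cyc_der c (gpot M)))).
  by rewrite -cyc_der_sumM; apply: tjac_der; rewrite inE; rewrite inE in cC.
apply: (closed_ideal_min (J := rM @^-1` ideal_set (gtjac M))).
- exact/ideal_preim/idealP.
- by apply: preim_closed => //; apply: closed_ideal_closed.
have rT y : far 1 y -> rM (xT y) = 0.
  move=> /farP fy; apply: restrict0 => i w; rewrite coef_xT.
  have := @expand_out _ (gquiv T) (gquiv H) eT uT (fun=> erefl) uT_out w.
  case: (expand uT w) => [v ->|_]; last by rewrite eqxx.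
  case: v => [|a v]; first by rewrite fy ?eqxx.
  by rewrite /= new_arrows_M.
have JM := idealP (gtjac M).
move=> _ [[c|c] cC [->|->]].
- have -> : aelt K (inl c : arr (gquiv H)) = xM (aelt K c) by rewrite extend_bas //; exact: eM_inj.
  change (ideal_set (gtjac M) (rM (xM (aelt K c)))).
  by rewrite restrictK; apply: tjac_aelt; rewrite inE; rewrite inE in cC.
- change (ideal_set (gtjac M) (rM (cyc_der (inl c : arr (gquiv H)) (gpot H)))).
  by rewrite cyc_der_sumM restrictK; apply: tjac_der; rewrite inE; rewrite inE in cC.
- have -> : aelt K (inr c : arr (gquiv H)) = xT (aelt K c) by rewrite extend_bas //; exact: eT_inj.
  change (ideal_set (gtjac M) (rM (xT (aelt K c)))).
  by rewrite rT; [exact: ideal0|exact: far_bas].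
change (ideal_set (gtjac M) (rM (cyc_der (inr c : arr (gquiv H)) (gpot H)))).
rewrite cyc_der_sumT rT; first exact: ideal0.
by apply: cyc_der_far => p pl; apply/eqP/negPn/negP => /T2 p2; rewrite p2 in pl.
Qed.

End Sum.

Lemma reduced_part_iso M G : deg01 G ->
  cutspan (degree1_arrows G) (ideal_set (gtjac G)) (gpot G) -> is_reduced_part M G ->
  alg_iso (qalg (gtjac G) : pzAlgType K) (gtruncated_jacobian M).
Proof.
move=> dG cG [cM _ [T [cT tT GH]]].
have [pH kH] := sum_pot cM cT.
apply: alg_iso_trans _ (gtruncated_jacobian_iso M).
apply: alg_iso_trans _ (sum_tjac_iso M cT tT).
apply: graded_equiv_tjac => //; first exact: sum_deg01.
exact: cut_pot_cutspan.
Qed.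

End ReducedPart.

(** * The mutated potential of an algebra *)

Section SplitPotential.
Variables (K : fieldType) (V : finType) (Q : quiver V) (C : {set arr Q}).
Variable w : arr Q -> cpa K Q.
Hypothesis w_out : forall c, c \notin C -> w c = 0.
Hypothesis w_corner : forall c, corner (tgt c) (src c) (w c) = w c.
Let W : cpa K Q := \sum_c aelt K c * w c.

(** The derivative of c w_c with respect to c is w_c, up to terms through c, and
    the derivatives of the other summands b w_b go through b. *)
Lemma cyc_der_split c : supp C (cyc_der c W - w c).
Proof.
have IC := supp_ideal K C.
rewrite /W cyc_der_sum (bigD1 c) //= addrAC; apply: (idealD IC).
  case: (boolP (c \in C)) => cC; last first.
    by rewrite w_out // mulr0 cyc_der0 subr0; apply: ideal0.
  have := @cder_mul K V Q c (src c) [:: c] (w c).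
  rewrite /= eqxx => /(_ erefl); rewrite big_mkcond big_nat1 /= eqxx.
  rewrite -/(corner _ _ _) w_corner -{2}(w_corner c) /corner !mulrA.
  rewrite [bas K (tgt c) [::] * _](_ : _ = idem K (tgt c)) ?idem_mul ?eqxx //.
  rewrite -[_ * idem K (src c) * bas _ _ _]mulrA idem_mul eqxx -/(corner _ _ _) w_corner.
  apply: (closed_ideal_min IC); first exact: supp_closed.
  by move=> _ ->; apply: supp_bas; rewrite /= cC.
apply: (ideal_sum IC) => b bc; case: (boolP (b \in C)) => bC; last first.
  by rewrite w_out // mulr0 cyc_der0; apply: ideal0.
have := @cder_mul K V Q c (src b) [:: b] (w b).
rewrite /= eqxx => /(_ erefl); rewrite big_mkcond big_nat1 /= (negbTE bc) subr0.
rewrite -/(corner _ _ _) w_corner; apply: (closed_ideal_min IC); first exact: supp_closed.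
by move=> _ ->; apply: supp_bas; rewrite /= bC.
Qed.

Lemma tjac_split c : ideal_set (tjac W C) (w c).
Proof.
have [cC|cC] := boolP (c \in C); last by rewrite w_out //; exact: ideal0 (idealP (tjac W C)).
rewrite -(subKr (cyc_der c W) (w c)); apply: (idealB (idealP (tjac W C))).
  exact: tjac_der.
exact/tjac_supp/cyc_der_split.
Qed.

Lemma tjac_split_min (J : set (cpa K Q)) : is_ideal J -> closed J ->
  (forall c, c \in C -> J (aelt K c)) -> (forall c, J (w c)) -> ideal_set (tjac W C) `<=` J.
Proof.
move=> idJ clJ JC Jw; apply: closed_ideal_min => // _ [c cC [->|->]]; first exact: JC.
rewrite -(subrK (w c) (cyc_der c W)); apply: (idealD idJ) => //.
by apply: (supp_min idJ clJ JC); apply: cyc_der_split.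
Qed.

Lemma cutspan_split : cutspan C (ideal_set (tjac W C)) W.
Proof.
have kS := cutspan_ksub C (ideal_set (tjac W C)); rewrite {2}/W.
apply: (ksub_sum _ kS) => c _; have [cC|cC] := boolP (c \in C); last first.
  by rewrite w_out // mulr0; case: kS.
apply: cutspan_prod; exists (src c), (tgt c), (aelt K c), (w c).
by split; [apply: supp_aelt|apply: tjac_split|rewrite corner_aelt w_corner].
Qed.

End SplitPotential.

Section Premutation.
Variables (K : fieldType) (V : finType) (Q : quiver V) (I : finType).
Variables (R : I -> qrel K Q) (k : V).
Hypothesis k_source : is_source Q k.
Hypothesis rel_tgtk : forall r, rel_tgt (R r) != k.

Let G := assoc_gqp R.
Let P := left_premutation k G.
Let Qm := gquiv P.

Definition theta_arr (x : arr Qm) : option (seq (arr Q)) :=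
  if x is inl c then if val c is inl a then Some [:: a] else None else None.

Lemma theta_letter : letterwise theta_arr.
Proof.
move=> [c|x] v //=; case cE: (val c) => [a|r] // [<-]; exists a => //=.
Qed.

(** Arrows starting at k are killed. As k is a source, no path of Q meets them
    except at its start. *)
Definition theta : {rmorphism cpa K Q -> cpa K Qm} := pull K theta_letter.

(** The cofactor r_a of the arrow a in r = sum_a a r_a, where b is the arrow
    from the end of r to its start. *)
Definition rel_part (b : in_arr k G) (a : out_arr k G) : cpa K Q :=
  if (val b, val a) is (inr r, inl a') then ldiv a' (rel_val (R r)) else 0.

Definition far_rel (c : far_arr k G) : cpa K Q :=
  if val c is inr r then rel_val (R r) else 0.

(** The derivative of the mutated potential with respect to an arrow of the cut,
    up to terms through the cut. *)
Definition mut_cofactor (x : arr Qm) : cpa K Qm :=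
  match x with
  | inl c => theta (far_rel c)
  | inr (inr (inr (b, a))) => theta (rel_part b a) +
      aelt K (out_star a : arr Qm) * aelt K (in_star b : arr Qm)
  | _ => 0
  end.

Let emb_arr (x : arr (gquiv G)) : option (seq (arr Q)) := if x is inl a then Some [:: a] else None.

Lemma emb_letter : letterwise emb_arr.
Proof. by case=> [a|r] v //= [<-]; exists a. Qed.

Lemma in_arrE (b : in_arr k G) : exists2 r, val b = inr r & rel_src (R r) = k.
Proof.
case: b => -[a|r] /= h; last by exists r => //; apply/eqP.
by have := k_source a; rewrite h.
Qed.

Lemma out_arrE (a : out_arr k G) : exists2 a', val a = inl a' & src a' = k.
Proof.
case: a => -[a|r] /= h; first by exists a => //; apply/eqP.
by have := rel_tgtk r; rewrite h.
Qed.

Lemma expand_cons (Q1 Q2 : quiver V) (u : arr Q2 -> option (seq (arr Q1))) a w :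
  expand u (a :: w) =
  if (u a, expand u w) is (Some v, Some v') then Some (v ++ v') else None.
Proof. by []. Qed.

Lemma expand_theta v :
  expand theta_arr v = obind (expand emb_arr) (expand (@uncontract K V k G : arr Qm -> _) v).
Proof.
elim: v => [//|x v IH]; rewrite !expand_cons IH.
move: (expand (_ : arr Qm -> _) v) => o {IH}.
case: x => [c|[a|[b|[b a]]]]; [| by []|by []|].
- rewrite /theta_arr /uncontract; case: (val c) => [a|r]; case: o => [w|] //.
- by rewrite /theta_arr /uncontract; have [r -> _] := in_arrE b; case: o.
Qed.

Lemma coef_assoc_pot i w : coef (@assoc_pot K V Q I R) i w =
  if w is inr r :: v then
    if i == rel_tgt (R r) then
      if expand emb_arr v is Some v' then coef (rel_val (R r)) (rel_src (R r)) v' else 0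
    else 0
  else 0.
Proof.
rewrite /assoc_pot coef_sum.
under eq_bigr => r _ do rewrite coef_aeltM.
case: w => [|[a|r] v]; try by rewrite big1.
rewrite (bigD1 r) //= eqxx /= big1 ?addr0 => [|s sr]; last first.
  rewrite (_ : (inr r == inr s :> arr (assoc_quiver R)) = false) //.
  by apply/eqP => -[rs]; rewrite rs eqxx in sr.
by case: eqP => // _; rewrite (coef_pull emb_letter).
Qed.

Lemma coef_theta x i w :
  coef (theta x) i w = if expand theta_arr w is Some v then coef x i v else 0.
Proof. exact: (coef_pull theta_letter). Qed.

Lemma contracted_potE : @contracted_pot K V k G =
  \sum_c aelt K (common c : arr Qm) * theta (far_rel c) +
  \sum_b \sum_a aelt K (compos b a : arr Qm) * theta (rel_part b a).
Proof.
apply: cpaP => i w h; rewrite (coef_walk _ h) /contracted_pot /pullback /pword /pstart /=.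
rewrite coefD !coef_sum.
under eq_bigr => c _ do rewrite coef_aeltM.
under [X in _ = _ + X]eq_bigr => b _ do
  (rewrite coef_sum; under eq_bigr => a _ do rewrite coef_aeltM).
case: w h => [|x v] h.
  by rewrite /= big1 // big1 ?addr0 ?coef_assoc_pot // => b _; rewrite big1.
have {h}/andP[/eqP <- _] : (src x == i) && walk (tgt x) v by [].
have farN (c : far_arr k G) b a : (inl c == compos b a :> arr Qm) = false by [].
case: x => [c|[a|[b|[b a]]]].
- rewrite (bigD1 c) //= !eqxx /= [X in _ + X + _]big1 ?addr0 => [|d dc]; last first.
    rewrite (_ : (inl c == inl d :> arr Qm) = false) //.
    by apply/eqP => -[cd]; rewrite cd eqxx in dc.
  rewrite [X in _ + X]big1 ?addr0 => [|b _]; last by rewrite big1.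
  rewrite coef_theta expand_theta /far_rel.
  case: (expand _ v) => [v'|] //=; rewrite coef_assoc_pot.
  case: (val c) => [a|r] /=; last by rewrite eqxx.
  by case: expand => // ?; rewrite coef0.
- by rewrite /= !big1 ?addr0 // => *; rewrite big1.
- by rewrite /= !big1 ?addr0 // => *; rewrite big1.
rewrite [X in _ = X + _]big1 ?add0r //.
rewrite (bigD1 b) //= [X in _ + X]big1 ?addr0 => [|d db]; last first.
  rewrite big1 // => a' _; rewrite (_ : (_ == _) = false) //.
  by apply/eqP => -[bd]; rewrite bd eqxx in db.
rewrite (bigD1 a) //= !eqxx /= big1 ?addr0 => [|d da]; last first.
  rewrite (_ : (_ == _) = false) //.
  by apply/eqP => -[ad]; rewrite ad eqxx in da.
rewrite coef_theta expand_theta /rel_part.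
have [r bE rk] := in_arrE b; have [a' aE ak] := out_arrE a.
rewrite bE aE /= (bE : sval b = _) (aE : sval a = _).
case: (expand _ v) => [v'|] //=; rewrite coef_assoc_pot eqxx /=.
by case: expand => // v2; rewrite /= coef_ldiv eqxx ak rk.
Qed.

Lemma mut_potE : gpot P = \sum_x aelt K x * mut_cofactor x.
Proof.
rewrite /= /mut_pot contracted_potE big_sumType /= -addrA; congr (_ + _).
rewrite big_sumType /= [X in _ = X + _]big1 ?add0r => [|a _]; last by rewrite mulr0.
rewrite big_sumType /= [X in _ = X + _]big1 ?add0r => [|a _]; last by rewrite mulr0.
transitivity (\sum_(b : in_arr k G) \sum_(a : out_arr k G)
    aelt K (compos b a : arr Qm) * mut_cofactor (compos b a : arr Qm)).
  rewrite -big_split /=; apply: eq_bigr => b _; rewrite -big_split /=.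
  by apply: eq_bigr => a _; rewrite mulrDr mulrA.
by rewrite pair_bigA; apply: eq_bigr => -[b a] _.
Qed.

Lemma mut_deg1 x : (x \in degree1_arrows P) =
  match x with
  | inl c => if val c is inr _ then true else false
  | inr (inr (inr _)) => true
  | _ => false
  end.
Proof.
rewrite inE /=; case: x => [c|[a|[b|[b a]]]] /=.
- by case: (val c).
- by have [a' -> _] := out_arrE a.
- by have [r -> _] := in_arrE b.
by have [a' -> _] := out_arrE a; have [r -> _] := in_arrE b.
Qed.

Lemma mut_deg01 : deg01 P.
Proof.
move=> x; have := mut_deg1 x; rewrite inE; case: eqP => [->|_]; first by right.
case: x => [c|[a|[b|[b a]]]] //=; first by case: (val c) => // a _; left.
- by have [a' -> _] := out_arrE a; left.
by have [r -> _] := in_arrE b; left.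
Qed.

Lemma rel_corner r : corner (rel_src (R r)) (rel_tgt (R r)) (rel_val (R r)) = rel_val (R r).
Proof.
apply: cpaP => i w h; rewrite /corner coef_Midem coef_idemM (coef_walk _ h).
have [->|/rel_valP[_ <- <-]] := eqVneq (rel_val (R r) (exist _ (i, w) h)) 0.
  by rewrite !if_same.
by rewrite !eqxx.
Qed.

Lemma theta_idem i : theta (idem K i) = idem K i.
Proof. exact: pull_idem. Qed.

Lemma theta_corner i j x : theta (corner i j x) = corner i j (theta x).
Proof. by rewrite /corner !rmorphM !theta_idem. Qed.

Lemma ldiv_corner (a : arr Q) (x : cpa K Q) i j : corner i j x = x -> corner (tgt a) j (ldiv a x) = ldiv a x.
Proof.
move=> xE; rewrite /corner ldiv_idem; apply: cpaP => l w h.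
rewrite coef_Midem !coef_ldiv; case: (eqVneq l (tgt a)) => [->|_]; last by rewrite if_same.
have -> : walk_end (tgt a) w = walk_end (src a) (a :: w) by [].
have xj : x * idem K j = x by rewrite -xE /corner -mulrA idem_mul eqxx.
by rewrite -coef_Midem xj.
Qed.

Lemma mut_cofactor_corner x : corner (tgt x) (src x) (mut_cofactor x) = mut_cofactor x.
Proof.
have c0 i j : corner i j (0 : cpa K Qm) = 0 by rewrite /corner mulr0 mul0r.
case: x => [c|[a|[b|[b a]]]] //=.
  rewrite -theta_corner /far_rel; case: c => -[a|r] h /=; last by rewrite rel_corner.
  by rewrite /corner mulr0 mul0r.
have -> i j x y : corner i j (x + y) = corner i j x + corner i j y :> cpa K Qm.
  by rewrite /corner mulrDr mulrDl.
congr (_ + _).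
  rewrite -theta_corner /rel_part.
  case: b => -[b0|r] hb; first by case/negP: (k_source b0).
  case: a => -[a0|s] ha /=; last by case/negP: (rel_tgtk s).
  by rewrite (ldiv_corner _ (rel_corner r)).
rewrite /corner mulrA idem_aelt eqxx -mulrA aelt_idem.
by rewrite eqxx.
Qed.

Lemma mut_cofactor_out x : x \notin degree1_arrows P -> mut_cofactor x = 0.
Proof.
rewrite mut_deg1; case: x => [c|[a|[b|[b a]]]] //=.
by case: c => -[a|r] h //= _; apply: (rmorph0 theta).
Qed.

Lemma mut_cutspan : cutspan (degree1_arrows P) (ideal_set (gtjac P)) (gpot P).
Proof.
rewrite /gtjac mut_potE; apply: cutspan_split; last exact: mut_cofactor_corner.
exact: mut_cofactor_out.
Qed.

Lemma mut_tjac x : ideal_set (gtjac P) (mut_cofactor x).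
Proof.
rewrite /gtjac mut_potE; apply: tjac_split; last exact: mut_cofactor_corner.
exact: mut_cofactor_out.
Qed.

Lemma mut_tjac_min (J : set (cpa K Qm)) : is_ideal J -> closed J ->
  (forall c, c \in degree1_arrows P -> J (aelt K c)) ->
  (forall c, J (mut_cofactor c)) -> ideal_set (gtjac P) `<=` J.
Proof.
rewrite /gtjac mut_potE; apply: tjac_split_min; last exact: mut_cofactor_corner.
exact: mut_cofactor_out.
Qed.

End Premutation.

(** * Relations starting at a source *)

Section CpaMore.
Variables (K : fieldType) (V : finType) (Q : quiver V).
Implicit Types (x y : cpa K Q) (a b : arr Q).

Lemma far1_rinv (u : cpa K Q) : far 1 u -> exists z, (1 - u) * z = 1.
Proof.
move=> fu; have [z zE] := far1_inv fu; exists z.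
have [z' z'E] : exists z', z' * z = 1.
  have [z' z'E] := far1_inv (farN (farMl z fu)); exists z'.
  by rewrite -[RHS]z'E opprK -zE mulrBr mulr1 subrK.
by rewrite -[1 - u]mul1r -{1}z'E -[z' * z * _]mulrA zE mulr1.
Qed.

Lemma ldivM a x y : far 1 x -> ldiv a (x * y) = ldiv a x * y.
Proof.
move=> /farP fx; apply: cpaP => i w h; rewrite coef_ldiv.
rewrite (coefM _ _ h); case: (eqVneq i (tgt a)) => [ia|ia]; last first.
  by rewrite big1 // => l _; rewrite coef_ldiv (negbTE ia) mul0r.
rewrite coefM /= ?eqxx -?ia // big_nat_recl //= fx // mul0r add0r.
by apply: eq_bigr => l _; rewrite coef_ldiv ia eqxx.
Qed.

Lemma ldivD a x y : ldiv a (x + y) = ldiv a x + ldiv a y.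
Proof.
by apply: cpaP => i w h; rewrite !(coef_ldiv, coefD); case: eqP => // _; rewrite addr0.
Qed.

Lemma ldiv_sumE a (T : Type) (r : seq T) (P : pred T) (F : T -> cpa K Q) :
  ldiv a (\sum_(t <- r | P t) F t) = \sum_(t <- r | P t) ldiv a (F t).
Proof.
elim/big_rec2: _ => [|t x y _ <-]; last by rewrite ldivD.
by apply: cpaP => i w h; rewrite coef_ldiv !coef0 if_same.
Qed.

Lemma ldiv_aeltM a b x : ldiv a (aelt K b * x) = if a == b then idem K (tgt a) * x else 0.
Proof.
apply: cpaP => i w h; rewrite coef_ldiv coef_aeltM.
rewrite (fun_if (fun y => coef y i w)) coef_idemM coef0 [tgt a == i]eq_sym.
case: (eqVneq a b) => [<-|_]; first by rewrite eqxx; case: eqP => // ->.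
by rewrite if_same.
Qed.

Lemma decomp_start x : x = \sum_i coef x i [::] *: idem K i + \sum_a aelt K a * ldiv a x.
Proof.
apply: cpaP => i w h; rewrite coefD !coef_sum; case: w h => [|b w] h.
  rewrite [X in _ + X]big1 ?addr0 => [|a _]; last by rewrite coef_aeltM.
  rewrite (bigD1 i) //= coefZ coef_bas !eqxx mulr1 big1 ?addr0 // => j ji.
  by rewrite coefZ coef_bas (negbTE ji) mulr0.
rewrite [X in X + _]big1 ?add0r => [|j _]; last by rewrite coefZ coef_bas andbF mulr0.
have /andP[/eqP bi hw] := h.
rewrite (bigD1 b) //= coef_aeltM coef_ldiv bi !eqxx big1 ?addr0 // => a ab.
by rewrite coef_aeltM eq_sym (negbTE ab).
Qed.

Lemma idem_decomp i x : idem K i * x =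
  coef x i [::] *: idem K i + \sum_(a | src a == i) aelt K a * ldiv a x.
Proof.
rewrite {1}(decomp_start x) mulrDr !mulr_sumr; congr (_ + _).
  rewrite (bigD1 i) //= -scaleAr idem_mul eqxx big1 ?addr0 // => j ji.
  by rewrite -scaleAr idem_mul eq_sym (negbTE ji) scaler0.
rewrite [RHS]big_mkcond; apply: eq_bigr => a _.
by rewrite mulrA idem_aelt eq_sym; case: eqP; rewrite ?mul0r.
Qed.

Variable k : V.
Hypothesis k_source : is_source Q k.

(** No path of positive length ends at a source. *)
Lemma source_end x : x * idem K k = coef x k [::] *: idem K k.
Proof.
apply: cpaP => i w h; rewrite coef_Midem coefZ coef_bas h andbT.
case: (lastP w) h => [|v b] h.
  by rewrite /walk_end /=; case: (eqVneq k i) => [->|_]; rewrite ?mulr1 ?mulr0.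
rewrite /walk_end map_rcons last_rcons eq_sym (negbTE (k_source b)).
rewrite (_ : ([::] == rcons v b) = false) ?andbF ?mulr0 //.
by case: v {h}.
Qed.

End CpaMore.

Section Relations.
Variables (K : fieldType) (V : finType) (Q : quiver V) (I : finType).
Variables (R : I -> qrel K Q) (k : V).
Hypothesis minR : minimal_rels R.
Hypothesis k_source : is_source Q k.
Local Notation rel r := (rel_val (R r)).

Definition rel_ideal : ideal (cpa K Q) := closed_ideal [set rel_val (R i) | i in setT].
Local Notation Il := (ideal_set rel_ideal).

Lemma rel_far r : far 2 (rel r).
Proof. by move=> p pl; apply/eqP/negPn/negP => /rel_valP[]; rewrite leqNgt pl. Qed.

Lemma rel_ideal_far x : Il x -> far 2 x.
Proof.
apply: (closed_ideal_min (far_ideal K Q 2)); first exact: far_closed_set.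
by move=> _ [r _ <-]; apply: rel_far.
Qed.

Lemma rel_ideal_rel r : Il (rel r).
Proof. by apply: closed_ideal_sub; exists r. Qed.

Lemma rel_neq0 r : rel r <> 0.
Proof.
move=> r0; apply: (minR (i := r)); rewrite r0; apply: sub_adic_closure.
by case: (@ideal_span_ideal (cpa K Q) [set rel j | j in [set j | j <> r]]).
Qed.

Lemma rel_tgt_source r : rel_tgt (R r) != k.
Proof.
apply/eqP => tk; apply: (@rel_neq0 r); apply: cpaP => i w h; rewrite coef0 (coef_walk _ h).
apply/eqP/negPn/negP => /rel_valP[]; rewrite /plen /pword /= => wl _; rewrite tk /pend /pstart /pword /=.
clear h; case: (lastP w) wl => // v b _; rewrite /walk_end map_rcons last_rcons.
exact/eqP/k_source.
Qed.

Lemma rel_src_idem r : idem K (rel_src (R r)) * rel r = rel r.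
Proof. by rewrite -{1}(rel_corner R r) /corner !mulrA idem_mul eqxx -/(corner _ _ _) rel_corner. Qed.

Lemma rel_tgt_idem r : rel r * idem K (rel_tgt (R r)) = rel r.
Proof. by rewrite -{1}(rel_corner R r) /corner -!mulrA idem_mul eqxx mulrA -/(corner _ _ _) rel_corner. Qed.

(* The relations not starting at k generate the part of the ideal which does
   not start at k, no path coming back to a source. *)
Definition off_ideal : ideal (cpa K Q) :=
  closed_ideal [set rel_val (R i) | i in [set i | rel_src (R i) != k]].

Lemma rel_ideal_off x : Il x -> ideal_set off_ideal (x - idem K k * x).
Proof.
have idI := idealP off_ideal.
have IM a x' : ideal_set off_ideal (x' - idem K k * x') ->
    ideal_set off_ideal (a * x' - idem K k * (a * x')).
  move=> Ix; have -> : a * x' - idem K k * (a * x') = (1 - idem K k) * a * (x' - idem K k * x').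
    have ae : (1 - idem K k) * (a * idem K k) = 0.
      by rewrite (source_end k_source) -scaleAr mulrBl mul1r idem_mul eqxx subrr scaler0.
    rewrite mulrBr -[(1 - idem K k) * a * (_ * _)]mulrA [a * (_ * _)]mulrA.
    by rewrite [(1 - _) * (_ * _)]mulrA ae mul0r subr0 !mulrBl !mul1r -!mulrA.
  exact: (idealMl idI).
suff : Il `<=` [set x | ideal_set off_ideal (x - idem K k * x)] by apply.
apply: closed_ideal_min.
- split=> [|y z Iy Iz|a y Iy] /=.
  + by rewrite mulr0 subr0; apply: (ideal0 idI).
  + have -> : y - z - idem K k * (y - z) = (y - idem K k * y) - (z - idem K k * z).
      by rewrite mulrBr !opprB [_ - idem K k * y]addrC addrACA [- z + _]addrC.
    exact: (idealB idI).
  split; first exact: IM.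
  by rewrite mulrA -mulrBl; apply: (idealMr idI).
- move=> y /adic_closureP cy; apply: closed_ideal_closed; apply/adic_closureP => n.
  have [z Iz yz] := cy n; exists (z - idem K k * z) => //.
  have -> : y - idem K k * y - (z - idem K k * z) = (y - z) - idem K k * (y - z).
    by apply/esym; rewrite mulrBr !opprB [_ - idem K k * y]addrC addrACA [- z + _]addrC.
  by apply: farB => //; apply: farMl.
move=> _ [r _ <-] /=; case: (eqVneq (rel_src (R r)) k) => rk.
  by rewrite -{1}rel_src_idem rk subrr; apply: (ideal0 idI).
rewrite -{2}(rel_src_idem r) mulrA idem_mul eq_sym (negbTE rk) mul0r subr0.
by apply: closed_ideal_sub; exists r.
Qed.

Lemma rel_ideal_off_idem i x : i != k -> Il x -> idem K i * x = x -> ideal_set off_ideal x.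
Proof.
move=> ik /rel_ideal_off Ix xE; move: Ix.
by rewrite -xE mulrA idem_mul eq_sym (negbTE ik) mul0r subr0.
Qed.

Lemma source_tgt (a : arr Q) : tgt a != k. Proof. exact: k_source. Qed.

(** The elements whose part at k is a combination of relations at k and of
    products a j, with j in the ideal of relations, form an ideal containing the
    relations. It is dense in the closed ideal of relations, which contains a
    power of the arrow ideal. *)
Lemma rel_ideal_decomp N z : (forall x, far N x -> Il x) -> Il z ->
  exists y : I -> cpa K Q, forall a, src a = k ->
    Il (ldiv a z - \sum_(r | rel_src (R r) == k) ldiv a (rel r) * y r).
Proof.
move=> fN Iz; have idI := idealP rel_ideal.
pose D z := Il z /\ exists (y : I -> cpa K Q) (j : arr Q -> cpa K Q), (forall a, Il (j a)) /\
  idem K k * z = \sum_(r | rel_src (R r) == k) rel r * y r +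
     \sum_(a | src a == k) aelt K a * j a.
have Dideal : is_ideal D.
  split=> [|u v [Iu [y1 [j1 [J1 E1]]]] [Iv [y2 [j2 [J2 E2]]]]|b u [Iu [y [j [J E]]]]].
  - split; first exact: (ideal0 idI).
    exists (fun=> 0), (fun=> 0); split=> [a|]; first exact: (ideal0 idI).
    by rewrite mulr0 !big1 ?addr0 // => *; rewrite mulr0.
  - split; first exact: (idealB idI).
    exists (fun r => y1 r - y2 r), (fun a => j1 a - j2 a); split=> [a|]; first exact: (idealB idI).
    rewrite mulrBr E1 E2 opprD addrACA -!sumrB.
    by congr (_ + _); apply: eq_bigr => *; rewrite mulrBr.
  split; split; [exact: (idealMl idI)| |exact: (idealMr idI)|].
    exists (fun r => coef b k [::] *: y r), (fun a => coef b k [::] *: j a + ldiv a b * u).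
    split=> [a|].
      by apply: (ideal_ksub idI).2 => //; apply: (idealMl idI).
    rewrite mulrA idem_decomp mulrDl -scaleAl E scalerDr -addrA !scaler_sumr.
    congr (_ + _); first by apply: eq_bigr => *; rewrite -scaleAr.
    rewrite mulr_suml -big_split; apply: eq_bigr => a _ /=.
    by rewrite mulrDr -scaleAr mulrA.
  exists (fun r => y r * b), (fun a => j a * b); split=> [a|]; first exact: (idealMr idI).
  rewrite mulrA E mulrDl !mulr_suml.
  by congr (_ + _); apply: eq_bigr => *; rewrite mulrA.
have /adic_closureP cz : adic_closure D z.
  apply: adic_closure_mono Iz => u; apply=> // _ [r _ <-]; split; first exact: rel_ideal_rel.
  case: (eqVneq (rel_src (R r)) k) => rk.
    exists (fun s => if s == r then 1 else 0), (fun=> 0); split=> [a|]; first exact: (ideal0 idI).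
    rewrite (bigD1 r) ?rk //= eqxx mulr1 big1 => [|s /andP[_ sr]]; last first.
      by rewrite (negbTE sr) mulr0.
    rewrite big1 ?addr0 => [|a _]; last by rewrite mulr0.
    by rewrite -{1}rk rel_src_idem.
  exists (fun=> 0), (fun=> 0); split=> [a|]; first exact: (ideal0 idI).
  rewrite -{1}(rel_src_idem r) mulrA idem_mul eq_sym (negbTE rk) mul0r.
  by rewrite !big1 ?addr0 // => *; rewrite mulr0.
have [z' [Iz' [y [j [J E]]]] zz'] := cz N.+1; exists y => a ak.
have f1 r : far 1 (rel r) by apply: farW (rel_far r).
have ka b : ldiv b (idem K (src b) * z') = ldiv b z'.
  by apply: cpaP => i w h; rewrite !coef_ldiv coef_idemM eqxx.
have E' : ldiv a z' = \sum_(r | rel_src (R r) == k) ldiv a (rel r) * y r + idem K (tgt a) * j a.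
  rewrite -ka ak E ldivD !ldiv_sumE; congr (_ + _).
    by apply: eq_bigr => r _; rewrite ldivM.
  rewrite (bigD1 a) ?ak //= ldiv_aeltM eqxx big1 ?addr0 // => b /andP[_ ba].
  by rewrite ldiv_aeltM eq_sym (negbTE ba).
rewrite -(subrK (ldiv a z') (ldiv a z)) -ldivB -addrA.
apply: (idealD idI); first by apply: fN; apply: ldiv_far.
by rewrite E' addrAC subrr add0r; apply: (idealMl idI).
Qed.

(** A combination of the columns of the relations at k which vanishes has its
    coefficients in the radical: otherwise a relation would be redundant. *)
Lemma rel_minimal_coef (z : I -> cpa K Q) :
  (forall a, src a = k -> Il (\sum_(r | rel_src (R r) == k) ldiv a (rel r) * z r)) ->
  forall r, rel_src (R r) = k -> coef (z r) (rel_tgt (R r)) [::] = 0.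
Proof.
move=> zI r0 rk0; apply/eqP/negPn/negP => c0.
set c := coef _ _ _ in c0.
pose J := closed_ideal [set rel j | j in [set j | j <> r0]].
have idJ := idealP J.
have subJ x : ideal_set off_ideal x -> ideal_set J x.
  apply: closed_ideal_min => //; first exact: closed_ideal_closed.
  move=> _ [r rk <-]; apply: closed_ideal_sub; exists r => // rr.
  by move: rk; rewrite /mkset /= rr rk0 eqxx.
have f1 r : far 1 (rel r) by apply: farW (rel_far r).
have relE r : rel_src (R r) = k -> rel r = \sum_(a | src a == k) aelt K a * ldiv a (rel r).
  move=> rk; rewrite -{1}rel_src_idem rk idem_decomp.
  by have /farP -> := f1 r; rewrite ?scale0r ?add0r.
have sumJ : ideal_set J (\sum_(r | rel_src (R r) == k) rel r * z r).
  rewrite (eq_bigr (fun r => \sum_(a | src a == k) aelt K a * (ldiv a (rel r) * z r))) => [|r /eqP rk].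
    rewrite exchange_big /=; apply: (ideal_sum idJ) => a /eqP ak.
    rewrite -mulr_sumr; apply: (idealMl idJ); apply: subJ.
    apply: (rel_ideal_off_idem (source_tgt a)); first exact: zI.
    by rewrite mulr_sumr; apply: eq_bigr => r _; rewrite mulrA ldiv_idem.
  by rewrite {1}(relE _ rk) mulr_suml; apply: eq_bigr => a _; rewrite mulrA.
have r0J : ideal_set J (rel r0 * z r0).
  rewrite -[rel r0 * z r0](addrK (\sum_(r | (rel_src (R r) == k) && (r != r0)) rel r * z r)).
  apply: (idealB idJ); first by rewrite -(bigD1 r0 (P := fun r => rel_src (R r) == k)) ?rk0.
  apply: (ideal_sum idJ) => r /andP[_ /eqP rr]; apply: (idealMr idJ).
  by apply: closed_ideal_sub; exists r.
pose t := rel_tgt (R r0).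
(* If c is nonzero, z r0 is invertible at the end of r0, and r0 is in the ideal
   of the other relations. *)
pose u : cpa K Q := 1 - c^-1 *: (idem K t * z r0).
have relu : rel r0 * (1 - u) = c^-1 *: (rel r0 * z r0).
  by rewrite subKr -scaleAr mulrA rel_tgt_idem.
have fu : far 1 (idem K t * u * idem K t).
  apply/farP => i [|//] _; rewrite coef_Midem coef_idemM /=.
  case: (eqVneq t i) => // <-; rewrite coefB coef1 // coefZ coef_idemM eqxx -/c.
  by rewrite mulVf // subrr.
clearbody u; have [v vE] := far1_rinv fu.
apply: (minR (i := r0)); rewrite -/(ideal_set J _) -[rel r0]mulr1 -vE mulrA.
apply: (idealMr idJ).
have -> : rel r0 * (1 - idem K t * u * idem K t) = rel r0 * (1 - u) * idem K t.
  have tE : rel r0 * idem K t = rel r0 := rel_tgt_idem r0.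
  by rewrite !mulrBr !mulr1 !mulrA tE mulrBl tE.
by rewrite relu; apply: (idealMr idJ); apply: (ksubZ _ (ideal_ksub idJ)).
Qed.

End Relations.

(** * Dual bases of projective modules *)

Lemma submod_val_linear (A : pzRingType) (M : lmodType A) (S : submod M) c (x y : submodT S) :
  val (c *: x + y) = c *: val x + val y.
Proof. by []. Qed.

Section HomLemmas.
Variables (A : pzRingType) (M N : lmodType A) (f : hom M N).
Lemma hom0E : f 0 = 0.
Proof. exact: (raddf0 (f : {linear M -> N})). Qed.
Lemma homB x y : f (x - y) = f x - f y.
Proof. exact: (raddfB (f : {linear M -> N})). Qed.
Lemma hom_sum (T : Type) (r : seq T) (P : pred T) F :
  f (\sum_(t <- r | P t) F t) = \sum_(t <- r | P t) f (F t).
Proof. exact: (raddf_sum (f : {linear M -> N})). Qed.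
End HomLemmas.

Section DualBasis.
Variables (A : pzRingType) (P : lmodType A) (S : choiceType) (p : S -> P).

Lemma sum_support (c : S -> A) (l l' : seq S) : uniq l -> uniq l' ->
  (forall s, s \notin l -> c s = 0) -> (forall s, s \notin l' -> c s = 0) ->
  \sum_(s <- l) c s *: p s = \sum_(s <- l') c s *: p s.
Proof.
have red m : \sum_(s <- m) c s *: p s = \sum_(s <- [seq s <- m | c s != 0]) c s *: p s.
  rewrite big_filter [LHS](bigID (fun s => c s != 0)) /= [X in _ + X]big1 ?addr0 // => s.
  by rewrite negbK => /eqP ->; rewrite scale0r.
move=> ul ul' cl cl'; rewrite red [RHS]red; apply: perm_big.
apply: uniq_perm; rewrite ?filter_uniq // => s; rewrite !mem_filter.
case: (eqVneq (c s) 0) => //= cs; have [sl|/cl cs0] := boolP (s \in l); last by rewrite cs0 eqxx in cs.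
by have [//|/cl' cs0] := boolP (s \in l'); rewrite cs0 eqxx in cs.
Qed.

Definition finite_support : set (S -> A^o) :=
  [set f | exists l : seq S, forall s, s \notin l -> f s = 0].

Lemma finite_support_submod : is_submod finite_support.
Proof.
split; first by exists [::].
move=> a f g [l lP] [l' lP']; exists (l ++ l') => s; rewrite mem_cat negb_or => /andP[sl sl'].
by rewrite [LHS](_ : _ = a * f s + g s) // lP // lP' // mulr0 addr0.
Qed.

Let free : lmodType A := submodT (Submod finite_support_submod).

Lemma free_support (f : free) : exists l, uniq l /\ forall s, s \notin l -> val f s = 0.
Proof.
have /asboolP[l lP] := valP f; exists (undup l); split; first exact: undup_uniq.
by move=> s; rewrite mem_undup; apply: lP.
Qed.

Definition support_seq (f : free) := sval (cid (free_support f)).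
Lemma support_uniq f : uniq (support_seq f).
Proof. by rewrite /support_seq; case: cid => l []. Qed.
Lemma support_out f s : s \notin support_seq f -> val f s = 0.
Proof. by rewrite /support_seq; case: cid => l [ul lP] /=; apply: lP. Qed.

Definition free_map (f : free) : P := \sum_(s <- support_seq f) (val f s : A) *: p s.

Lemma free_mapE (f : free) l : uniq l -> (forall s, s \notin l -> val f s = 0) ->
  free_map f = \sum_(s <- l) (val f s : A) *: p s.
Proof. by move=> ul lP; apply: sum_support => //; [apply: support_uniq|apply: support_out]. Qed.

Lemma free_map_linear : linear free_map.
Proof.
move=> a f g; pose l := undup (support_seq f ++ support_seq g).
have ul : uniq l := undup_uniq _.
have lf s : s \notin l -> val f s = 0.
  by rewrite mem_undup mem_cat negb_or => /andP[/support_out].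
have lg s : s \notin l -> val g s = 0.
  by rewrite mem_undup mem_cat negb_or => /andP[_ /support_out].
rewrite !(free_mapE ul) // => [|s sl]; last first.
  by rewrite submod_val_linear [LHS](_ : _ = a * val f s + val g s) // lf // lg // mulr0 addr0.
rewrite scaler_sumr -big_split; apply: eq_bigr => s _ /=.
by rewrite scalerA -scalerDl.
Qed.

(** The coordinates of a section of the free module on S over P. The finite set
    of indices depends on x and may be enlarged at will. *)
Lemma dual_basis : projective P ->
  (forall x, exists (l : seq S) (c : S -> A), uniq l /\ x = \sum_(s <- l) c s *: p s) ->
  exists phi : P -> S -> A, (forall a x y s, phi (a *: x + y) s = a * phi x s + phi y s) /\
    forall x, exists l : seq _, forall l' : seq _, uniq l' -> {subset l <= l'} ->
      x = \sum_(s <- l') phi x s *: p s.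
Proof.
move=> projP gen; pose q := mk_hom free_map_linear.
have qs : surjective q.
  move=> x; have [l [c [ul ->]]] := gen x.
  pose f : S -> A^o := fun s => if s \in l then c s else 0.
  have fP : submod_pred (Submod finite_support_submod) f.
    by apply/asboolP; exists l => s sl; rewrite /f (negbTE sl).
  exists (exist _ f fP : free); rewrite [LHS](free_mapE (l := l)) //.
    by rewrite !big_seq; apply: eq_bigr => s sl; rewrite /= /f sl.
  by move=> s sl; rewrite /= /f (negbTE sl).
have [h hE] := projP _ _ q (idfun : {linear P -> P}) qs.
exists (fun x s => val (h x) s); split=> [a x y s|x].
  by rewrite hom_app_add hom_app_scale submod_val_linear.
exists (support_seq (h x)) => l ul sl.
rewrite -[LHS](hE x : _ = x) [LHS](free_mapE (l := l)) // => s sn.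
by apply: support_out; apply: contra sn; apply: sl.
Qed.

End DualBasis.

Lemma dual_basis_self (A : pzRingType) (P : lmodType A) : projective P ->
  exists phi : P -> P -> A, (forall a x y s, phi (a *: x + y) s = a * phi x s + phi y s) /\
    forall (J : finType) (x : J -> P), exists l : seq P,
      forall j, x j = \sum_(s <- l) phi (x j) s *: s.
Proof.
move=> projP; have [|phi [phiD phiE]] := @dual_basis A P P id projP.
  by move=> x; exists [:: x], (fun=> 1); rewrite big_seq1 scale1r.
exists phi; split=> // J x.
have /choice[l lP] : forall j, exists l : seq _, forall l' : seq _, uniq l' -> {subset l <= l'} ->
      x j = \sum_(s <- l') phi (x j) s *: s by move=> j; apply: phiE.
exists (undup (flatten [seq l j | j <- enum J])) => j.
apply: lP; first exact: undup_uniq.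
move=> s sl; rewrite mem_undup; apply/flattenP; exists (l j) => //.
by apply: map_f; rewrite mem_enum.
Qed.

(** * Injectivity of the columns of relations *)

Section Columns.
Variables (K : fieldType) (V : finType) (Q : quiver V) (I : finType).
Variables (R : I -> qrel K Q) (k : V).
Hypothesis minR : minimal_rels R.
Hypothesis fdR : fin_dim (bound_algebra R).
Hypothesis k_source : is_source Q k.
Local Notation rel r := (rel_val (R r)).
Local Notation Lam := (bound_algebra R).

Definition pr : {rmorphism cpa K Q -> Lam} := qpi (rel_ideal R).

Lemma pr0 x : pr x = 0 <-> ideal_set (rel_ideal R) x. Proof. exact: qpi0. Qed.
Lemma pr_surj (u : Lam) : exists x, pr x = u. Proof. exact: qpi_surj. Qed.
Lemma pr_kalg c : pr (kalg c) = kalg c. Proof. by []. Qed.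
Lemma prZ c x : pr (c *: x) = kalg c * pr x. Proof. by rewrite -kalgM rmorphM. Qed.

Definition vtx i : Lam := pr (idem K i).
Definition col r a : Lam := pr (ldiv a (rel r)).

Lemma rel_ideal_nil : exists N, forall x, far N x -> ideal_set (rel_ideal R) x.
Proof. by apply: fin_dim_far => //; apply: closed_ideal_closed. Qed.

Lemma vtx_col r a : vtx (tgt a) * col r a = col r a.
Proof. by rewrite -rmorphM ldiv_idem. Qed.

Lemma col_vtx r a : col r a * vtx (rel_tgt (R r)) = col r a.
Proof.
by rewrite -rmorphM -ldivM ?rel_tgt_idem //; apply: farW (rel_far R r).
Qed.

Lemma sum_arw_col r : rel_src (R r) = k -> \sum_(a | src a == k) pr (aelt K a) * col r a = 0.
Proof.
move=> rk; have prr : pr (rel r) = 0 by apply/pr0/rel_ideal_rel.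
have rE : rel r = \sum_(a | src a == k) aelt K a * ldiv a (rel r).
  rewrite -{1}rel_src_idem rk idem_decomp.
  have /farP -> // : far 1 (rel r) by apply: farW (rel_far R r).
  by rewrite scale0r add0r.
rewrite -[RHS]prr [in RHS]rE rmorph_sum.
by apply: eq_bigr => a _; rewrite rmorphM.
Qed.

(** Exactness in the middle of the complex of right modules from the relations
    at k to the arrows at k to e_k Lam, given by the columns. *)
Lemma columns_exact (x : arr Q -> Lam) :
  \sum_(a | src a == k) pr (aelt K a) * x a = 0 ->
  exists y : I -> Lam, forall a, src a = k ->
    vtx (tgt a) * x a = \sum_(r | rel_src (R r) == k) col r a * y r.
Proof.
have /choice[w wE] : forall a, exists w, pr w = x a by move=> a; apply: pr_surj.
move=> x0; pose z := \sum_(a | src a == k) aelt K a * w a.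
have Iz : ideal_set (rel_ideal R) z.
  by apply/pr0; rewrite rmorph_sum -[RHS]x0; apply: eq_bigr => a _; rewrite rmorphM wE.
have [N fN] := rel_ideal_nil; have [y yE] := rel_ideal_decomp k fN Iz.
exists (fun r => pr (y r)) => a ak.
have zE : ldiv a z = idem K (tgt a) * w a.
  rewrite /z ldiv_sumE (bigD1 a) ?ak //= ldiv_aeltM eqxx big1 ?addr0 // => b /andP[_ ba].
  by rewrite ldiv_aeltM eq_sym (negbTE ba).
move/yE: (ak) => /pr0/eqP; rewrite zE rmorphB subr_eq0 rmorph_sum rmorphM wE => /eqP ->.
by apply: eq_bigr => r _; rewrite rmorphM.
Qed.

Definition syz (z : I -> Lam) : Prop :=
  forall a, src a = k -> \sum_(r | rel_src (R r) == k) col r a * z r = 0.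

Definition radn n (u : Lam) : Prop := exists2 x, far n x & u = pr x.

Lemma radn_mul m n u v : radn m u -> radn n v -> radn (m + n) (u * v).
Proof. by move=> [x fx ->] [y fy ->]; exists (x * y); rewrite ?rmorphM //; apply: farM. Qed.

Lemma radn_sum n (T : Type) (r : seq T) (P : pred T) F :
  (forall t, P t -> radn n (F t)) -> radn n (\sum_(t <- r | P t) F t).
Proof.
move=> rF; elim/big_rec: _ => [|t u Pt [y fy ->]]; first by exists 0; rewrite ?rmorph0.
by have [x fx ->] := rF t Pt; exists (x + y); rewrite ?rmorphD //; apply: farD.
Qed.

Lemma radn_all u : radn 0 u.
Proof. by have [x <-] := pr_surj u; exists x. Qed.

Lemma radn_nil : exists N, forall u, radn N u -> u = 0.
Proof.
by have [N fN] := rel_ideal_nil; exists N => u [x fx ->]; apply/pr0/fN.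
Qed.

Lemma syz_rad z r : syz z -> rel_src (R r) = k -> radn 1 (vtx (rel_tgt (R r)) * z r).
Proof.
have /choice[w wE] : forall r, exists w, pr w = z r by move=> s; apply: pr_surj.
move=> sz rk; have zI a : src a = k ->
    ideal_set (rel_ideal R) (\sum_(r | rel_src (R r) == k) ldiv a (rel r) * w r).
  move=> ak; apply/pr0; rewrite rmorph_sum -[RHS](sz a ak).
  by apply: eq_bigr => s _; rewrite rmorphM wE.
exists (idem K (rel_tgt (R r)) * w r); last by rewrite rmorphM wE.
apply/farP => i [|//] _; rewrite coef_idemM; case: eqP => // <-.
exact: (rel_minimal_coef minR k_source zI).
Qed.

Lemma rad_submod : is_submod (radn 1 : set Lam^o).
Proof.
split; first by exists 0; rewrite ?rmorph0.
move=> a u v ru [y fy ->]; have [x fx xE] : radn 1 (a * u) by apply: (radn_mul (radn_all a) ru).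
by exists (x + y); [apply: farD|rewrite rmorphD -xE].
Qed.

Let top : lmodType Lam := modquot (Submod rad_submod).
Let to_top := modquot_pi (Submod rad_submod).

Lemma top_linear : linear (to_top : Lam^o -> top).
Proof. by move=> a x y; rewrite /to_top modquot_piD modquot_piZ. Qed.

(** A projective module inherits the exactness of Lam through the coordinates of
    a dual basis. *)
Lemma exact_projective (P : lmodType Lam) (n : arr Q -> P) : projective P ->
  \sum_(a | src a == k) pr (aelt K a) *: n a = 0 ->
  exists y : I -> P, forall a, src a = k ->
    vtx (tgt a) *: n a = \sum_(r | rel_src (R r) == k) col r a *: y r.
Proof.
move=> /dual_basis_self[phi [phiD phiE]] n0; have [l lE] := phiE _ n.
have phi0 s : phi 0 s = 0.
  by have := phiD (-1) 0 0 s; rewrite scaler0 addr0 mulN1r addNr.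
have phi_sum (T : finType) (Pr : pred T) (c : T -> Lam) (u : T -> P) s :
    phi (\sum_(t | Pr t) c t *: u t) s = \sum_(t | Pr t) c t * phi (u t) s.
  by elim/big_rec2: _ => [|t y x _ <-]; rewrite ?phi0 ?phiD.
have /choice[y yE] : forall s, exists y : I -> Lam, forall a, src a = k ->
    vtx (tgt a) * phi (n a) s = \sum_(r | rel_src (R r) == k) col r a * y r.
  by move=> s; apply: columns_exact; rewrite -phi_sum n0 phi0.
exists (fun r => \sum_(s <- l) y s r *: s) => a ak.
rewrite {1}(lE a) scaler_sumr.
under [RHS]eq_bigr => r _ do rewrite scaler_sumr.
rewrite [RHS]exchange_big; apply: eq_bigr => s _ /=.
rewrite scalerA yE // scaler_suml; apply: eq_bigr => r _.
by rewrite scalerA.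
Qed.

Lemma syz_projective (P : lmodType Lam) (v : I -> P) : projective P ->
  (forall a, src a = k -> \sum_(r | rel_src (R r) == k) col r a *: v r = 0) ->
  exists (l : seq P) (z : P -> I -> Lam), (forall s, syz (z s)) /\
    forall r, v r = \sum_(s <- l) z s r *: s.
Proof.
move=> /dual_basis_self[phi [phiD phiE]] v0; have [l lE] := phiE _ v.
have phi0 s : phi 0 s = 0.
  by have := phiD (-1) 0 0 s; rewrite scaler0 addr0 mulN1r addNr.
have phi_sum (T : finType) (Pr : pred T) (c : T -> Lam) (u : T -> P) s :
    phi (\sum_(t | Pr t) c t *: u t) s = \sum_(t | Pr t) c t * phi (u t) s.
  by elim/big_rec2: _ => [|t y x _ <-]; rewrite ?phi0 ?phiD.
exists l, (fun s r => phi (v r) s); split=> // s a ak.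
by rewrite -phi_sum v0.
Qed.

Hypothesis gld : gldim_le Lam 2.

(** A syzygy z of the columns has coefficients in the radical, so it vanishes on
    the top of Lam. Following it through a projective resolution of length two
    of the top writes it as a combination of syzygies with coefficients in the
    radical. This is the vanishing of Tor_3 between the simple right module at k
    and the top, by dimension shifting. *)
Lemma syz_shift z : syz z -> exists (T : Type) (l : seq T) (zs : T -> I -> Lam) (rho : T -> Lam),
  [/\ forall t, syz (zs t), forall t, radn 1 (rho t) &
      forall r, rel_src (R r) = k -> vtx (rel_tgt (R r)) * z r = \sum_(t <- l) zs t r * rho t].
Proof.
move=> sz; pose z' r := if rel_src (R r) == k then vtx (rel_tgt (R r)) * z r else 0.
have sz' : syz z'.
  move=> a ak; rewrite -[RHS](sz a ak); apply: eq_bigr => r rk.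
  by rewrite /z' rk mulrA col_vtx.
have rz' r : radn 1 (z' r).
  rewrite /z'; case: eqP => rk; first exact: syz_rad.
  by exists 0; rewrite ?rmorph0.
have [L1 [P0 [i0 [p0 [projP0 i0inj p0s ex0 [L2 [P1 [i1 [p1 [projP1 i1inj p1s ex1 projL2]]]]]]]]]] := gld top.
have [pi piE] := p0s (to_top 1).
have t0 : to_top 0 = 0 by rewrite -[X in to_top X](subrr 0) /to_top modquot_piB subrr.
have topE (x : Lam) : to_top x = x *: to_top 1.
  have xE : x *: (1 : Lam^o) + 0 = x by rewrite addr0; apply: mulr1.
  by rewrite -[in LHS]xE top_linear t0 addr0.
have top0 x : to_top x = 0 <-> radn 1 x.
  rewrite -t0; split=> [/modquot_piE|rx]; first by rewrite subr0.
  by apply/modquot_piE; rewrite subr0.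
have /choice[l lE] : forall r, exists l, i0 l = z' r *: pi.
  move=> r; apply/ex0; rewrite hom_app_scale piE -topE; exact/top0.
have l0 a : src a = k -> \sum_(r | rel_src (R r) == k) col r a *: l r = 0.
  move=> ak; apply: i0inj; rewrite hom_sum hom0E -[RHS](scale0r pi) -(sz' a ak) scaler_suml.
  by apply: eq_bigr => r _; rewrite hom_app_scale lE scalerA.
have /choice[m mE] : forall r, exists m, p1 m = l r by move=> r; apply: p1s.
have /choice[n nE] : forall a, exists n, src a = k ->
    i1 n = \sum_(r | rel_src (R r) == k) col r a *: m r.
  move=> a; case: (eqVneq (src a) k) => ak; last by exists 0 => /eqP; rewrite (negbTE ak).
  have /ex1[n nE] : p1 (\sum_(r | rel_src (R r) == k) col r a *: m r) = 0.
    rewrite hom_sum -[RHS](l0 a ak); apply: eq_bigr => r _.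
    by rewrite hom_app_scale mE.
  by exists n.
have n0 : \sum_(a | src a == k) pr (aelt K a) *: n a = 0.
  apply: i1inj; rewrite hom_sum hom0E.
  transitivity (\sum_(a | src a == k) \sum_(r | rel_src (R r) == k) (pr (aelt K a) * col r a) *: m r).
    apply: eq_bigr => a /eqP ak; rewrite hom_app_scale nE // scaler_sumr.
    by apply: eq_bigr => r _; rewrite scalerA.
  rewrite exchange_big big1 //= => r /eqP rk.
  by rewrite -scaler_suml sum_arw_col // scale0r.
have [y yE] := exact_projective projL2 n0.
(* The m r form a syzygy up to elements of the second kernel; there the columns
   are exact, so m can be corrected. *)
pose v r := m r - i1 (y r).
have v0 a : src a = k -> \sum_(r | rel_src (R r) == k) col r a *: v r = 0.
  move=> ak; rewrite (eq_bigr (fun r => col r a *: m r - col r a *: i1 (y r))) => [|r _]; last first.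
    by rewrite scalerBr.
  rewrite sumrB; apply/eqP; rewrite subr_eq0; apply/eqP.
  transitivity (vtx (tgt a) *: i1 (n a)).
    by rewrite nE // scaler_sumr; apply: eq_bigr => r _; rewrite scalerA vtx_col.
  rewrite -hom_app_scale yE // hom_sum.
  by apply: eq_bigr => r _; rewrite hom_app_scale.
have [s [zs [szs vE]]] := syz_projective projP1 v0.
(* A lift of p0 to Lam sends pi to a unit, which allows to write z' by its
   image in P0. *)
have [h hE] := projP0 _ _ (mk_hom top_linear) p0 (fun t => ex_intro _ _ (modquot_reprK t)).
have [c cE] : exists c, h pi * c = 1.
  have [w fw wE] : radn 1 (1 - (h pi : Lam)).
    have : to_top (h pi) = to_top 1 by rewrite -piE -hE.
    by move/esym/modquot_piE.
  have [c cE] := far1_rinv fw; exists (pr c).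
  by rewrite -(subKr 1 (h pi : Lam)) wE -(rmorph1 pr) -rmorphB -rmorphM cE rmorph1.
exists P1, s, zs, (fun t => (h (i0 (p1 t)) : Lam) * c); split=> [//|t|r rk].
  apply: (@radn_mul 1 0); last exact: radn_all.
  apply/top0; have <- : p0 (i0 (p1 t)) = 0 by apply/ex0; exists (p1 t).
  exact: hE.
have -> : vtx (rel_tgt (R r)) * z r = z' r by rewrite /z' rk eqxx.
rewrite -[z' r]mulr1 -cE mulrA.
have -> : z' r * h pi = h (z' r *: pi) :> Lam by rewrite hom_app_scale.
rewrite -lE -mE.
have -> : p1 (m r) = p1 (v r).
  rewrite homB; have -> : p1 (i1 (y r)) = 0 by apply/ex1; exists (y r).
  by rewrite subr0.
rewrite vE !hom_sum mulr_suml; apply: eq_bigr => t _.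
by rewrite !hom_app_scale mulrA.
Qed.

(** By [syz_shift] the coefficients lie in every power of the radical, which is
    nilpotent. *)
Lemma columns_inj z : syz z -> forall r, rel_src (R r) = k -> vtx (rel_tgt (R r)) * z r = 0.
Proof.
move=> sz r rk; have [N rN] := radn_nil; apply: rN.
elim: N z sz r rk => [|n IH] z sz r rk; first exact: radn_all.
have [T [l [zs [rho [szs rrho zE]]]]] := syz_shift sz.
have -> : vtx (rel_tgt (R r)) * z r = \sum_(t <- l) vtx (rel_tgt (R r)) * zs t r * rho t.
  have vv : vtx (rel_tgt (R r)) * vtx (rel_tgt (R r)) = vtx (rel_tgt (R r)).
    by rewrite -rmorphM idem_mul eqxx.
  by rewrite -{1}vv -mulrA zE // mulr_sumr; apply: eq_bigr => t _; rewrite mulrA.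
apply: radn_sum => t _; rewrite -[n.+1]addn1; apply: radn_mul => //.
exact: IH.
Qed.

End Columns.

(** * The inverse translate of the simple projective module *)

Section RightAction.
Variables (A : pzRingType) (P : lmodType A^c).
(** Right modules are left modules over the converse ring. *)
Definition ract (p : P) (u : A) : P := (u : A^c) *: p.
Lemma ractM p u v : ract p (u * v) = ract (ract p u) v.
Proof. by rewrite /ract scalerA. Qed.
Lemma ract1 p : ract p 1 = p. Proof. exact: scale1r. Qed.
Lemma ractx0 p : ract p 0 = 0. Proof. exact: scale0r. Qed.
Lemma ract0 u : ract 0 u = 0. Proof. exact: scaler0. Qed.
Lemma ractB p u v : ract p (u - v) = ract p u - ract p v. Proof. exact: scalerBl. Qed.
Lemma ract_sum (T : Type) (r : seq T) (Pr : pred T) (F : T -> A) p :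
  ract p (\sum_(t <- r | Pr t) F t) = \sum_(t <- r | Pr t) ract p (F t).
Proof. exact: scaler_suml. Qed.
End RightAction.

Lemma hom_ract (A : pzRingType) (P P' : lmodType A^c) (f : hom P P') p u :
  f (ract p u) = ract (f p) u.
Proof. exact: hom_app_scale. Qed.

Lemma star_ract (A : pzRingType) (P : lmodType A^c) (f : star P) p u :
  f (ract p u) = (f p : A) * u :> A.
Proof. exact: (hom_app_scale (f : hom P (A^c)^o)). Qed.

Lemma star_hom_sum (A : pzRingType) (P : lmodType A^c) (f : star P)
    (T : Type) (r : seq T) (Pr : pred T) F :
  f (\sum_(t <- r | Pr t) F t) = \sum_(t <- r | Pr t) (f (F t) : A) :> A.
Proof. exact: (hom_sum (f : hom P (A^c)^o)). Qed.

Lemma dual_basis_fin (A : pzRingType) (P : lmodType A^c) (S : finType) (p : S -> P) :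
  projective P -> (forall x, exists c : S -> A, x = \sum_s ract (p s) (c s)) ->
  exists phi : P -> S -> A,
    [/\ forall x u s, phi (ract x u) s = phi x s * u,
        forall x y s, phi (x + y) s = phi x s + phi y s &
        forall x, x = \sum_s ract (p s) (phi x s)].
Proof.
move=> projP gen; have [x|phi [phiD phiE]] := dual_basis (p := p) projP.
  by have [c xE] := gen x; exists (index_enum S), c; split; [apply: index_enum_uniq|].
have phi0 s : phi 0 s = 0.
  by have := phiD (-1) 0 0 s; rewrite scaler0 addr0 mulN1r addNr.
exists phi; split=> [x u s|x y s|x].
- by have := phiD u x 0 s; rewrite addr0 phi0 addr0.
- by have := phiD 1 x y s; rewrite scale1r mul1r.
have [l lE] := phiE x; apply: (lE (index_enum S)); first exact: index_enum_uniq.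
by move=> s _; apply: mem_index_enum.
Qed.

Section InverseTranslate.
Variables (K : fieldType) (V : finType) (Q : quiver V) (I : finType).
Variables (R : I -> qrel K Q) (k : V).
Hypothesis fdR : fin_dim (bound_algebra R).
Hypothesis k_source : is_source Q k.
Local Notation Lam := (bound_algebra R).
Local Notation pr := (pr R).
Local Notation vtx i := (vtx R i).
Local Notation arw a := (pr (aelt K a)).

(** The coefficient of e_i does not depend on the representative, as relations
    have length at least 2. *)
Definition eps i (u : Lam) : K := coef (qalg_repr u) i [::].

Lemma pr_repr (u : Lam) : pr (qalg_repr u) = u. Proof. exact: qalg_reprK. Qed.

Lemma eps_pr i x : eps i (pr x) = coef x i [::].
Proof.
have /pr0/rel_ideal_far/farP/(_ i [::] isT) : pr (qalg_repr (pr x) - x) = 0.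
  by rewrite rmorphB pr_repr subrr.
by rewrite coefB => /eqP; rewrite subr_eq0 => /eqP.
Qed.

Lemma eps_kalg i c : eps i (kalg c) = c.
Proof. by rewrite [LHS](eps_pr i (kalg c)) kalgE coefZ coef1 // mulr1. Qed.

Lemma vtx_vtx i : vtx i * vtx i = vtx i.
Proof. by rewrite -rmorphM idem_mul eqxx. Qed.

Lemma arw_vtx a : arw a * vtx (tgt a) = arw a.
Proof. by rewrite -rmorphM aelt_idem eqxx. Qed.

Lemma vtx_arw a : vtx (src a) * arw a = arw a.
Proof. by rewrite -rmorphM idem_aelt eqxx. Qed.

(** The projective module at a source is one dimensional. *)
Lemma mul_vtxk (u : Lam) : u * vtx k = kalg (eps k u) * vtx k.
Proof.
have [x <-] := pr_surj u; rewrite -rmorphM (source_end k_source) eps_pr.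
by rewrite prZ.
Qed.

Lemma vtxk_mul (u : Lam) : eps k u = 0 ->
  exists v : arr Q -> Lam, vtx k * u = \sum_(a | src a == k) arw a * v a.
Proof.
have [x <-] := pr_surj u; rewrite eps_pr => x0; exists (fun a => pr (ldiv a x)).
rewrite -rmorphM idem_decomp x0 scale0r add0r rmorph_sum.
by apply: eq_bigr => a _; rewrite rmorphM.
Qed.

(** Arrows are independent modulo the square of the radical, which contains the
    relations. *)
Lemma arw_indep (s : arr Q -> Lam) a : src a = k ->
  arw a = \sum_(b | src b == k) arw b * s b ->
  forall b, src b = k -> radn 1 (vtx (tgt b) * s b - (if a == b then vtx (tgt b) else 0)).
Proof.
have /choice[w wE] : forall b, exists w, pr w = s b by move=> b; apply: pr_surj.
move=> ak sE b bk; pose z := \sum_(c | src c == k) aelt K c * w c - aelt K a.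
have /pr0/rel_ideal_far fz : pr z = 0.
  rewrite rmorphB rmorph_sum sE; apply/eqP; rewrite subr_eq0; apply/eqP.
  by apply: eq_bigr => c _; rewrite rmorphM wE.
exists (ldiv b z); first exact: ldiv_far.
have -> : ldiv b z = idem K (tgt b) * w b - (if a == b then idem K (tgt b) else 0).
  rewrite /z ldivB ldiv_sumE (bigD1 b) ?bk //= ldiv_aeltM eqxx big1 => [|c /andP[_ cb]].
    by rewrite addr0 -[aelt K a]mulr1 ldiv_aeltM mulr1 eq_sym.
  by rewrite ldiv_aeltM eq_sym (negbTE cb).
by rewrite rmorphB rmorphM wE; case: eqP => // _; rewrite rmorph0.
Qed.

Lemma proj_gen_subproof i :
  submod_pred (Submod (left_ideal_submod (vtx i : Lam))) (vtx i : Lam^o).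
Proof. by apply/asboolP; exists 1; rewrite ?mul1r. Qed.

Definition proj_gen i : proj_at R i := exist _ (vtx i : Lam^o) (proj_gen_subproof i).

Local Notation gen_k := (proj_gen k).

Lemma proj_k_gen (u : Lam) : u *: gen_k = kalg (eps k u) *: gen_k.
Proof. by apply: val_inj; rewrite /= [LHS]mul_vtxk. Qed.

Variables (P1 P0 : lmodType Lam^c) (f : hom P1 P0) (g : hom P0 (dual (proj_at R k))).
Hypothesis mpp : min_proj_presentation f g.

Lemma dual_eq (phi psi : dual (proj_at R k)) :
  phi (gen_k : restr _) = psi (gen_k : restr _) -> phi = psi.
Proof.
move=> pE; apply: homP => x.
have [u xE] : exists u : Lam, x = u *: gen_k.
  have /asboolP[u _ uE] := valP (x : proj_at R k); exists u.
  by apply: val_inj; rewrite /= -uE.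
have {}xE : x = eps k u *: (gen_k : restr _) by rewrite xE; apply: proj_k_gen.
by rewrite xE !hom_app_scale; congr (_ *: _); exact: pE.
Qed.

Lemma dual_ract (phi : dual (proj_at R k)) (u : Lam) :
  (ract phi u : dual _) (gen_k : restr _) = eps k u * phi (gen_k : restr _).
Proof.
rewrite [LHS](_ : _ = phi (u *: gen_k : restr _)) // proj_k_gen.
exact: (hom_app_scale phi).
Qed.

Lemma val_linear (c : Lam) (x y : proj_at R k) : val (c *: x + y) = c * (val x : Lam) + val y.
Proof. exact: submod_val_linear. Qed.

Lemma eps_linear : linear ((fun x => eps k (val (x : proj_at R k))) : restr (proj_at R k) -> K^o).
Proof.
move=> c x y; transitivity (eps k (val (kalg c *: (x : proj_at R k) + (y : proj_at R k)))); first by exact: erefl.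
rewrite val_linear.
have [[u <-] [v <-]] := (pr_surj (val (x : proj_at R k)), pr_surj (val (y : proj_at R k))).
by rewrite -pr_kalg -rmorphM -rmorphD !eps_pr kalgM coefD coefZ.
Qed.

(** The dual of the simple projective module at k is the simple right module at
    k, and P0, being its projective cover, is e_k Lam. *)
Lemma cover_gen : exists p : P0,
  [/\ ract p (vtx k) = p, forall u, g (ract p u) = 0 <-> eps k u = 0,
      forall x, exists u, x = ract p u &
      exists psi : star P0, psi p = vtx k :> Lam].
Proof.
have [[_ projP0] gs _ _ kerg] := mpp.
have [p' gp'] := gs (mk_hom eps_linear).
have vk1 : eps k (vtx k) = 1 by rewrite eps_pr coef_bas !eqxx.
pose p := ract p' (vtx k); have pk : ract p (vtx k) = p by rewrite -ractM vtx_vtx.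
have gp u : g (ract p u) (gen_k : restr _) = eps k u.
  by rewrite !hom_ract !dual_ract gp' [X in _ * (_ * X)]vk1 !(vk1, mulr1).
have gp0 u : g (ract p u) = 0 <-> eps k u = 0.
  split=> [g0|u0]; first by rewrite -gp g0.
  by apply: dual_eq; rewrite gp u0.
have pgen x : exists u, x = ract p u.
  have : (fun x => exists u, x = ract p u) x; last by [].
  apply: (kerg (fun x => exists u, x = ract p u)) => {x}.
    split; first by exists 0; rewrite ractx0.
    by move=> a _ _ [u ->] [v ->]; exists (u * a + v); rewrite /ract scalerDl scalerA.
  move=> x; pose c := g x (gen_k : restr _); exists (ract p (kalg c)); first by exists (kalg c).
  by apply: dual_eq; rewrite gp eps_kalg.
exists p; split=> //.
have [x|phi [phiM phiD phiE]] := dual_basis_fin (p := fun _ : unit => p) projP0.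
  by have [v ->] := pgen x; exists (fun=> v); rewrite big_const card_unit /= addr0.
have pE : p = ract p (phi p tt) by rewrite {1}(phiE p) (bigD1 tt) //= big1 ?addr0 // => -[].
have e1 : eps k (phi p tt) = 1.
  by rewrite -gp -pE -[p]ract1 gp -(rmorph1 kalg) eps_kalg.
have aE : phi p tt = vtx k by rewrite -{1}pk phiM mul_vtxk e1 rmorph1 mul1r.
have psiL : linear ((fun x => phi x tt) : P0 -> (Lam^c)^o).
  by move=> u x y; rewrite -[u *: x]/(ract x u) phiD phiM.
by exists (mk_hom psiL : star P0).
Qed.

End InverseTranslate.

Section TransposePresentation.
Variables (K : fieldType) (V : finType) (Q : quiver V) (I : finType).
Variables (R : I -> qrel K Q) (k : V).
Hypothesis fdR : fin_dim (bound_algebra R).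
Hypothesis k_source : is_source Q k.
Local Notation Lam := (bound_algebra R).
Local Notation pr := (pr R).
Local Notation vtx i := (vtx R i).
Local Notation arw a := (pr (aelt K a)).

Variables (P1 P0 : lmodType Lam^c) (f : hom P1 P0) (g : hom P0 (dual (proj_at R k))).
Hypothesis mpp : min_proj_presentation f g.

Lemma sum_addr_ract (A : pzRingType) (P : lmodType A^c) (p : P) u v : ract p (u + v) = ract p u + ract p v.
Proof. exact: scalerDl. Qed.

(** P1 covers the kernel of P0 -> S_k, which is generated by the arrows starting
    at k. The chosen generators of P1 are independent because they are so modulo
    the radical. *)
Lemma cover_arrows : exists (p : P0) (q : arr Q -> P1) (phi : P1 -> arr Q -> Lam),
  [/\ forall a, src a = k -> f (q a) = ract p (arw a),
      forall a, src a != k -> q a = 0,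
      [/\ forall x u a, phi (ract x u) a = phi x a * u,
        forall x y a, phi (x + y) a = phi x a + phi y a &
        forall x, x = \sum_a ract (q a) (phi x a)],
      forall x : arr Q -> Lam, \sum_a ract (q a) (x a) = 0 ->
        forall a, src a = k -> vtx (tgt a) * x a = 0 &
      (forall a, ract (q a) (vtx (tgt a)) = q a) /\
      exists psi : star P0, psi p = vtx k :> Lam].
Proof.
have [[projP1 projP0] gs ex kerf kerg] := mpp.
have [p [pk gp0 pgen [psi psip]]] := cover_gen k_source mpp.
have p0 u : ract p u = 0 -> vtx k * u = 0.
  by move=> pu; rewrite -psip -star_ract pu; apply: (hom0E (psi : hom P0 (Lam^c)^o)).
have /choice[q qE] : forall a, exists x, [/\ src a = k -> f x = ract p (arw a),
    src a != k -> x = 0 & ract x (vtx (tgt a)) = x].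
  move=> a; case: (eqVneq (src a) k) => ak; last first.
    by exists 0; split=> [ak'|//|]; [rewrite ak' eqxx in ak|apply: ract0].
  have /ex[x xE] : g (ract p (arw a)) = 0 by apply/gp0; rewrite eps_pr coef_bas andbF.
  exists (ract x (vtx (tgt a))); split=> //.
    by move=> _; rewrite hom_ract xE -ractM arw_vtx.
  by rewrite -ractM vtx_vtx.
have qf a : src a = k -> f (q a) = ract p (arw a) by have [] := qE a.
have q0 a : src a != k -> q a = 0 by have [] := qE a.
have qv a : ract (q a) (vtx (tgt a)) = q a by have [] := qE a.
have fsum (c : arr Q -> Lam) :
    f (\sum_a ract (q a) (c a)) = ract p (\sum_(a | src a == k) arw a * c a).
  rewrite hom_sum ract_sum (bigID (fun a => src a == k)) /= [X in _ + X]big1 ?addr0.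
    by apply: eq_bigr => a /eqP ak; rewrite hom_ract qf // ractM.
  by move=> a ak; rewrite q0 // ract0 hom0E.
have qgen x : exists c : arr Q -> Lam, x = \sum_a ract (q a) (c a).
  have : (fun x => exists c : arr Q -> Lam, x = \sum_a ract (q a) (c a)) x; last by [].
  apply: (kerf (fun x => exists c : arr Q -> Lam, x = \sum_a ract (q a) (c a))) => {x}.
    split; first by exists (fun=> 0); rewrite big1 // => a _; rewrite ractx0.
    move=> u _ _ [c ->] [d ->]; exists (fun a => c a * u + d a).
    rewrite scaler_sumr -big_split; apply: eq_bigr => a _ /=.
    by rewrite sum_addr_ract ractM.
  move=> x; have [u uE] := pgen (f x).
  have u0 : eps k u = 0 by apply/gp0; rewrite -uE; apply/ex; exists x.
  have [v vE] := vtxk_mul u0; exists (\sum_a ract (q a) (v a)); first by exists v.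
  by rewrite fsum -vE ractM pk uE.
have [phi [phiM phiD phiE]] := dual_basis_fin projP1 qgen.
have indep (x : arr Q -> Lam) : \sum_a ract (q a) (x a) = 0 ->
    forall a, src a = k -> vtx (tgt a) * x a = 0.
  move=> x0; pose x' a := vtx (tgt a) * x a.
  have x'0 b : \sum_a phi (q a) b * x' a = 0.
    have phi0 : phi 0 b = 0 by rewrite -(ract0 P1 0) phiM mulr0.
    have phis (T : Type) (r : seq T) (F : T -> P1) : phi (\sum_(t <- r) F t) b = \sum_(t <- r) phi (F t) b.
      by elim/big_rec2: _ => [|t y z _ <-]; rewrite ?phi0 ?phiD.
    rewrite -[RHS]phi0 -[X in _ = phi X b]x0 phis; apply: eq_bigr => a _.
    by rewrite -phiM /x' ractM qv.
  have phiq0 a b : src a != k -> phi (q a) b = 0.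
    by move=> ak; rewrite q0 // -(ract0 P1 0) phiM mulr0.
  (* The coordinates of the generators form the identity matrix modulo the
     radical. *)
  have cong a b : src a = k -> src b = k ->
      radn 1 (vtx (tgt b) * phi (q a) b - (if a == b then vtx (tgt b) else 0)).
    move=> ak bk; apply: (arw_indep (s := phi (q a)) ak) => //.
    apply/eqP; rewrite -subr_eq0; apply/eqP.
    have := p0 (arw a - \sum_(b | src b == k) arw b * phi (q a) b).
    rewrite ractB -fsum -phiE qf // subrr => /(_ erefl).
    have E1 : vtx k * arw a = arw a by rewrite -ak vtx_arw.
    rewrite mulrBr E1 mulr_sumr => E2; rewrite -[RHS]E2; congr (_ - _).
    by apply: eq_bigr => c /eqP ck; rewrite mulrA -ck vtx_arw.
  have [N rN] := radn_nil fdR; move=> a ak; apply: rN; rewrite -/(x' a).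
  elim: N a ak => [|n IH] a ak; first exact: radn_all.
  have -> : x' a = - \sum_(b | src b == k)
      (vtx (tgt a) * phi (q b) a - (if b == a then vtx (tgt a) else 0)) * x' b.
    rewrite (eq_bigr (fun b => vtx (tgt a) * (phi (q b) a * x' b) - (if b == a then x' a else 0))).
      rewrite sumrB -mulr_sumr.
      have -> : \sum_(b | src b == k) phi (q b) a * x' b = 0.
        rewrite -[RHS](x'0 a) [RHS](bigID (fun b => src b == k)) /= [X in _ + X]big1 ?addr0 // => b bk.
        by rewrite phiq0 ?mul0r.
      rewrite mulr0 sub0r opprK (bigD1 a) ?ak //= eqxx big1 ?addr0 // => b /andP[_ ba].
      by rewrite (negbTE ba).
    move=> b _; rewrite mulrBl -mulrA; congr (_ - _); case: (eqVneq b a) => [->|_]; last by rewrite mul0r.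
    by rewrite /x' mulrA vtx_vtx.
  rewrite -mulN1r; apply: (@radn_mul _ _ _ _ _ 0); first exact: radn_all.
  apply: radn_sum => b /eqP bk; rewrite -[n.+1]add1n; apply: radn_mul; last exact: IH.
  exact: cong.
by exists p, q, phi; split=> //; split=> //; exists psi.
Qed.

End TransposePresentation.

Section AprPresentation.
Variables (K : fieldType) (V : finType) (Q : quiver V) (I : finType).
Variables (R : I -> qrel K Q) (k : V).
Hypothesis fdR : fin_dim (bound_algebra R).
Hypothesis k_source : is_source Q k.
Local Notation Lam := (bound_algebra R).
Local Notation pr := (pr R).
Local Notation vtx i := (vtx R i).
Local Notation arw a := (pr (aelt K a)).

(** Dualising the minimal presentation of the simple right module at k: the
    inverse translate is generated by one element for each arrow starting at k,
    with a single relation. *)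
Lemma tau_inv_presentation (N : lmodType Lam) : is_tau_inv (proj_at R k) N ->
  exists nu : arr Q -> N,
  [/\ forall a, src a = k -> vtx (tgt a) *: nu a = nu a,
      \sum_(a | src a == k) arw a *: nu a = 0,
      forall n, exists x : arr Q -> Lam, n = \sum_(a | src a == k) x a *: nu a &
      forall x : arr Q -> Lam, \sum_(a | src a == k) x a *: nu a = 0 ->
        exists l, forall a, src a = k -> x a * vtx (tgt a) = l * arw a].
Proof.
move=> [P1 [P0 [f [g [mpp [F Fbij]]]]]].
have [p [q [phi [qf q0 [phiM phiD phiE] indep [qv [psi psip]]]]]] := cover_arrows fdR k_source mpp.
have Lq (a : arr Q) : linear ((fun x => vtx (tgt a) * phi x a : Lam) : P1 -> (Lam^c)^o).
  by move=> u x y; rewrite -[u *: x]/(ract x u) phiD phiM mulrDr mulrA.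
pose qs a : star P1 := mk_hom (Lq a).
have qsq a b : src a = k -> src b = k -> (qs a (q b) : Lam) = if b == a then vtx (tgt a) else 0.
  move=> ak bk; have := indep (fun c => phi (q b) c - (if b == c then 1 else 0)).
  have -> : \sum_c ract (q c) (phi (q b) c - (if b == c then 1 else 0)) = 0.
    rewrite (eq_bigr (fun c => ract (q c) (phi (q b) c) - ract (q c) (if b == c then 1 else 0))).
      rewrite sumrB -phiE (bigD1 b) //= eqxx ract1 big1 ?addr0 ?subrr // => c cb.
      by rewrite eq_sym (negbTE cb) ractx0.
    by move=> c _; rewrite ractB.
  move=> /(_ erefl a ak); rewrite mulrBr => /eqP; rewrite subr_eq0 => /eqP E.
  rewrite [LHS]E; case: eqP => _; by rewrite ?mulr1 ?mulr0.
have starE (c : Lam) (h : star P1) x : (c *: h : star P1) x = c * (h x : Lam) :> Lam by [].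
have star_sumE (T : Type) (r : seq T) (Pr : pred T) (G : T -> star P1) x :
    (\sum_(t <- r | Pr t) G t : star P1) x = \sum_(t <- r | Pr t) (G t x : Lam) :> Lam.
  by elim/big_rec2: _ => [|t y h _ <-].
have qs_gen (h : star P1) : h = \sum_(a | src a == k) (h (q a) : Lam) *: qs a.
  apply: homP => x; rewrite [RHS]star_sumE {1}(phiE x) [LHS]star_hom_sum.
  rewrite [LHS](bigID (fun a => src a == k)) /= [X in _ + X]big1 ?addr0.
    apply: eq_bigr => a _; rewrite [LHS]star_ract.
    transitivity ((h (q a) : Lam) * (vtx (tgt a) * phi x a)); last by [].
    have hv : (h (q a) : Lam) * vtx (tgt a) = h (q a) by rewrite -[LHS]star_ract qv.
    by rewrite mulrA hv.
  by move=> a ak; rewrite q0 // ract0; apply: (hom0E (h : hom P1 (Lam^c)^o)).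
pose S := Submod (star_image_submod f).
have piL : linear (modquot_pi S : star P1 -> transpose f).
  by move=> a x y; rewrite modquot_piD modquot_piZ.
pose pi : hom (star P1) (transpose f) := mk_hom piL.
have [G FG GF] := Fbij; pose nu a := G (pi (qs a)).
have Fnu a : F (nu a) = pi (qs a) by rewrite /nu GF.
have Finj := can_inj FG.
have pi0 h : pi h = 0 <-> exists h0, star_map f h0 = h.
  rewrite -(hom0E pi); split=> [/modquot_piE|[h0 hE]].
    by rewrite subr0 => -[h0 _ hE]; exists h0.
  by apply/modquot_piE; rewrite subr0; exists h0.
exists nu; split.
- move=> a ak; apply: Finj; rewrite hom_app_scale Fnu -hom_app_scale; congr (hom_app pi _).
  by apply: homP => x; rewrite [LHS]starE /= mulrA vtx_vtx.
- apply: Finj; rewrite hom_sum hom0E.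
  rewrite (eq_bigr (fun a => pi (arw a *: qs a))) => [|a _]; last by rewrite !hom_app_scale Fnu.
  rewrite -hom_sum; apply/pi0; exists psi.
  rewrite [RHS](_ : _ = \sum_(a | src a == k) arw a *: qs a) // [LHS]qs_gen.
  apply: eq_bigr => a /eqP ak; congr (_ *: _); rewrite [LHS](_ : _ = psi (f (q a))) //.
  by rewrite qf // [LHS]star_ract psip -{1}ak vtx_arw.
- move=> n; have [h hE] : exists h, pi h = F n by exists (modquot_repr (F n)); apply: modquot_reprK.
  exists (fun a => (h (q a) : Lam)); apply: Finj; rewrite -hE [in LHS](qs_gen h) !hom_sum.
  by apply: eq_bigr => a _; rewrite !hom_app_scale Fnu.
move=> x x0; have /pi0[h0 hE] : pi (\sum_(a | src a == k) x a *: qs a) = 0.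
  transitivity (F (\sum_(a | src a == k) x a *: nu a)); last by rewrite x0 hom0E.
  rewrite !hom_sum; by apply: eq_bigr => a _; rewrite !hom_app_scale Fnu.
exists (h0 p : Lam) => a ak.
transitivity ((\sum_(a | src a == k) x a *: qs a : star P1) (q a) : Lam).
  rewrite [RHS]star_sumE (bigD1 a) ?ak //= big1 ?addr0 => [|b /andP[/eqP bk ba]].
    by rewrite [RHS](_ : _ = x a * (qs a (q a) : Lam)) // qsq // eqxx.
  transitivity (x b * (qs b (q a) : Lam)) => //.
  by rewrite qsq // eq_sym (negbTE ba) mulr0.
by rewrite -hE [LHS](_ : _ = h0 (f (q a))) // qf // [LHS]star_ract.
Qed.

(** The generators of the tilting module are indexed by arrows and vertices of
    Q; those which count are the arrows starting at k and the vertices other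
    than k. *)
Definition gen_ok (s : arr Q + V) : bool := match s with inl a => src a == k | inr i => i != k end.
Definition gen_end (s : arr Q + V) : V := match s with inl a => tgt a | inr i => i end.

(** A presentation of T by projective modules. As the generator at s is fixed by
    the idempotent e_v of its end, its coefficients only matter after
    multiplication by e_v. *)
Definition presents (T : lmodType Lam) (tau : arr Q + V -> T) : Prop :=
  [/\ forall s, gen_ok s -> vtx (gen_end s) *: tau s = tau s,
      \sum_(a | src a == k) arw a *: tau (inl a) = 0,
      forall t, exists x : arr Q + V -> Lam, t = \sum_(s | gen_ok s) x s *: tau s &
      forall x : arr Q + V -> Lam, \sum_(s | gen_ok s) x s *: tau s = 0 ->
        exists l, forall s, gen_ok s -> x s * vtx (gen_end s) =
          match s with inl a => l * arw a | inr _ => 0 end].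

Lemma apr_presentation (N : lmodType Lam) : is_tau_inv (proj_at R k) N ->
  exists tau, presents (T := apr_tilting k N) tau.
Proof.
move=> /tau_inv_presentation[nu [nuv nu0 nugen nurel]].
pose W := proj_others R k.
pose del (i : V) : W := fun j => if val j == i then proj_gen R (val j) else 0.
pose tau (s : arr Q + V) : apr_tilting k N :=
  match s with inl a => (nu a, 0 : W) | inr i => (0 : N, del i) end.
have sumE (x : arr Q + V -> Lam) : \sum_(s | gen_ok s) x s *: tau s =
    (\sum_(a | src a == k) x (inl a) *: nu a, \sum_(i | i != k) x (inr i) *: del i) :> (N * W)%type.
  rewrite big_sumType /=.
  have -> : \sum_(a | src a == k) x (inl a) *: ((nu a, 0 : W) : (N * W)%type) =
      (\sum_(a | src a == k) x (inl a) *: nu a, 0).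
    elim/big_rec2: _ => [//|a y z _ ->]; congr pair; rewrite /=.
    by rewrite scaler0 addr0.
  have -> : \sum_(i | i != k) x (inr i) *: ((0 : N, del i) : (N * W)%type) =
      (0, \sum_(i | i != k) x (inr i) *: del i).
    elim/big_rec2: _ => [//|a y z _ ->]; congr pair; rewrite /=.
    by rewrite scaler0 addr0.
  by congr pair; rewrite /= ?addr0 ?add0r.
have dsumE (T : Type) (r : seq T) (Pr : pred T) (F : T -> W) j :
    (\sum_(t <- r | Pr t) F t) j = \sum_(t <- r | Pr t) F t j.
  by elim/big_rec2: _ => [//|t y z _ <-].
have delE (x : V -> Lam) (j : {i | i != k}) :
    (\sum_(i | i != k) x i *: del i) j = x (val j) *: proj_gen R (val j).
  rewrite dsumE (bigD1 (val j)) ?(valP j) //= big1 ?addr0 => [|i /andP[_ ij]].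
    rewrite [LHS](_ : _ = x (val j) *: del (val j) j) //.
    by rewrite /del eqxx.
  rewrite [LHS](_ : _ = x i *: del i j) //.
  by rewrite /del eq_sym (negbTE ij) scaler0.
exists tau; split.
- case=> [a /eqP ak|i ik]; congr pair; rewrite /= ?scaler0 ?nuv //.
  apply: functional_extensionality_dep => j.
  rewrite [LHS](_ : _ = vtx i *: del i j) // /del.
  case: eqP => [ji|_]; last by rewrite scaler0.
  by apply: val_inj; rewrite /= -ji [LHS]vtx_vtx.
- have := sumE (fun s => if s is inl a then arw a else 0).
  rewrite big_sumType /= [X in _ + X = _]big1 ?addr0 => [->|i _]; last by rewrite scale0r.
  by congr pair => //; rewrite big1 // => i _; rewrite scale0r.
- move=> [n d]; have [x nE] := nugen n.
  have /choice[y yE] : forall j : {i | i != k}, exists u : Lam, d j = u *: proj_gen R (val j).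
    move=> j; have /asboolP[u _ uE] := valP (d j); exists u.
    by apply: val_inj; rewrite /= -uE.
  exists (fun s => match s with inl a => x a | inr i => if insub i is Some j then y j else 0 end).
  rewrite sumE -nE; congr pair; apply: functional_extensionality_dep => j.
  by rewrite delE valK -yE.
move=> x; rewrite sumE => /pair_equal_spec[/nurel[l lE] d0]; exists l.
case=> [a /eqP ak|i ik /=]; first exact: lE.
have := congr1 (fun d : W => val (d (exist _ i ik : {i | i != k})) : Lam) d0.
by rewrite delE.
Qed.

End AprPresentation.

(** * A vertex without arrows *)

Section NoArrow.
Variables (K : fieldType) (V : finType) (Q : quiver V) (I : finType).
Variables (R : I -> qrel K Q) (k : V).
Hypothesis k_source : is_source Q k.
Local Notation Lam := (bound_algebra R).
Local Notation pr := (pr R).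
Local Notation vtx i := (vtx R i).
Local Notation gen_k := (proj_gen R k).

(** Over an algebra whose elements are scalars, a submodule of Y which is
    maximal among those meeting X in the kernel of g is a hyperplane, the kernel
    of an extension of g. *)
Lemma scalar_injective : (forall u : Lam, u = kalg (eps k u)) -> injective_mod (proj_at R k).
Proof.
move=> scal X Y i g iinj.
have genE (t : proj_at R k) : exists c, t = kalg c *: gen_k.
  have /asboolP[u _ uE] := valP t; exists (eps k u).
  by rewrite -(proj_k_gen k_source); apply: val_inj; rewrite /= -uE.
have gen0 c : kalg c *: gen_k = 0 -> c = 0.
  have e0 : eps k (0 : Lam) = 0 by rewrite -(rmorph0 pr) eps_pr coef0.
  have eE : eps k (val (kalg c *: gen_k : proj_at R k)) = c.
    transitivity (eps k (pr (kalg c * idem K k))); first by rewrite rmorphM.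
    by rewrite eps_pr kalgM coefZ coef_bas !eqxx mulr1.
  by move=> E; rewrite -eE E; apply: e0.
have [g0|] := pselect (forall x, g x = 0).
  by exists 0 => x; rewrite g0.
move=> /existsNP[x0 gx0]; have [c0 c0E] := genE (g x0).
have c00 : c0 != 0 by apply/eqP => cz; apply: gx0; rewrite c0E cz rmorph0 scale0r.
have [x1 gx1] : exists x1, g x1 = gen_k.
  exists (kalg c0^-1 *: x0); rewrite hom_app_scale c0E scalerA -rmorphM mulVf //.
  by rewrite rmorph1 scale1r.
pose G0 : set Y := [set y | exists2 x, g x = 0 & y = i x].
pose good (G : set Y) := is_submod G /\ forall x, G (i x) -> g x = 0.
have [A [[smA Ag] Amax]] : exists A, good (A `|` G0) /\ forall B, A `<` B -> ~ good (B `|` G0).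
  apply: (Zorn_bigcup (P := fun A => good (A `|` G0))) => F FP Ftot; split; last first.
    move=> x [[B FB Bix]|[x' gx' /iinj->]] //.
    by have [_] := FP B FB; apply; left.
  have smG0 : is_submod G0.
    split; first by exists 0; rewrite ?hom0E.
    move=> a _ _ [x gx ->] [y gy ->]; exists (a *: x + y).
      by rewrite hom_app_add hom_app_scale gx gy scaler0 addr0.
    by rewrite hom_app_add hom_app_scale.
  split; first by right; case: smG0.
  move=> a u v.
  have up B w : F B -> (B `|` G0) w -> (\bigcup_(B in F) B `|` G0) w.
    by move=> FB [Bw|Gw]; [left; exists B|right].
  case=> [[B FB Bu]|Gu] [[C FC Cv]|Gv].
  - have [BC|CB] := Ftot B C FB FC.
      by apply: (up C) => //; have [[_ sm] _] := FP C FC; apply: sm; left => //; apply: BC.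
    by apply: (up B) => //; have [[_ sm] _] := FP B FB; apply: sm; left => //; apply: CB.
  - by apply: (up B) => //; have [[_ sm] _] := FP B FB; apply: sm; [left|right].
  - by apply: (up C) => //; have [[_ sm] _] := FP C FC; apply: sm; [right|left].
  by right; case: smG0 => _; apply.
set G := A `|` G0 in smA Ag; have [G00 GD] := smA.
have GZ a u : G u -> G (a *: u) by move=> Gu; rewrite -[_ *: _]addr0; apply: GD.
have GB u v : G u -> G v -> G (u - v).
  by move=> Gu Gv; rewrite addrC -scaleN1r; apply: GD.
(* Otherwise the submodule generated by G and y would contradict the maximality
   of G. *)
have split y : exists c, G (y - kalg c *: i x1).
  apply: contrapT => /forallNP yG.
  pose B : set Y := [set v | exists c u, G u /\ v = u + kalg c *: y].
  have GsB : G `<=` B.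
    by move=> u Gu; exists 0, u; split=> //; rewrite rmorph0 scale0r addr0.
  have BG : B `|` G0 = B.
    by apply/seteqP; split=> u; [case=> // Gu; apply: GsB; right|left].
  apply: (Amax B).
    split; first by move=> u Au; apply: GsB; left.
    move=> BA; apply: (yG 0); rewrite rmorph0 scale0r subr0; left; apply: BA.
    by exists 1, 0; split=> //; rewrite rmorph1 scale1r add0r.
  rewrite BG; split.
    split; first exact: GsB.
    move=> a _ _ [c [u [Gu ->]]] [d [v [Gv ->]]].
    exists (eps k a * c + d), (a *: u + v); split; first exact: GD.
    rewrite [in LHS](scal a) scalerDr scalerA -rmorphM addrACA -scalerDl -rmorphD.
    by rewrite -(scal a).
  move=> x [c [u [Gu xE]]]; have [c_0|cn0] := eqVneq c 0.
    by apply: Ag; rewrite xE c_0 rmorph0 scale0r addr0.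
  have [d dE] := genE (g x); case: (yG (c^-1 * d)).
  have -> : y - kalg (c^-1 * d) *: i x1 = kalg c^-1 *: (i (x - kalg d *: x1) - u).
    rewrite homB hom_app_scale xE addrAC [u + _]addrC addrK.
    by rewrite scalerBr !scalerA -!rmorphM mulVf // rmorph1 scale1r.
  apply/GZ/GB => //; right; exists (x - kalg d *: x1) => //.
  by rewrite homB hom_app_scale gx1 dE subrr.
have uniq c : G (kalg c *: i x1) -> c = 0.
  by rewrite -hom_app_scale => /Ag; rewrite hom_app_scale gx1 => /gen0.
have /choice[c cE] := split.
have cU y d : G (y - kalg d *: i x1) -> d = c y.
  move=> Gd; apply/eqP; rewrite -subr_eq0; apply/eqP/uniq.
  have -> : kalg (d - c y) *: i x1 = (y - kalg (c y) *: i x1) - (y - kalg d *: i x1).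
    by rewrite rmorphB scalerBl opprB [RHS]addrC addrA subrK.
  exact: GB.
have hL : linear (fun y => kalg (c y) *: gen_k).
  move=> a y z; have kE d e (Z : lmodType Lam) (t : Z) :
      kalg (eps k a * d + e) *: t = a *: (kalg d *: t) + kalg e *: t.
    by rewrite rmorphD rmorphM scalerDl [in RHS](scal a) scalerA.
  have -> : c (a *: y + z) = eps k a * c y + c z.
    apply/esym/cU; have -> : a *: y + z - kalg (eps k a * c y + c z) *: i x1 =
        a *: (y - kalg (c y) *: i x1) + (z - kalg (c z) *: i x1).
      rewrite scalerBr addrACA -opprD; congr (_ - _).
      exact: kE.
    by apply: GD; apply: cE.
  exact: kE.
exists (mk_hom hL) => x; rewrite [LHS](_ : _ = kalg (c (i x)) *: gen_k) //.
have := cE (i x); rewrite -hom_app_scale -homB => /Ag /eqP.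
by rewrite homB hom_app_scale gx1 subr_eq0 => /eqP.
Qed.

(** If no arrow starts at the source k, a connected quiver is reduced to k and
    Lam is the base field. *)
Lemma source_arrow : connected_quiver Q -> ~ injective_mod (proj_at R k) ->
  exists a : arr Q, src a = k.
Proof.
move=> conn ninj; apply: contrapT => /forallNP nok; apply: ninj.
have Vk j : j = k.
  have /connectP[[|v s] /=] := conn k j; first by move=> _ ->.
  case/andP=> /existsP[a /orP[]] /andP[/eqP sa /eqP ta] _ _; first by case: (nok a).
  by have := k_source a; rewrite ta eqxx.
apply: scalar_injective => u; have [x <-] := pr_surj u.
rewrite eps_pr -pr_kalg; congr (_ _); apply: cpaP => i w h.
rewrite kalgE coefZ coef1 // (Vk i); case: w h => [|a w] h; first by rewrite mulr1.
by case: (nok a); apply: Vk.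
Qed.

End NoArrow.

(** * Morphisms from a complete path algebra *)

Section UniversalProperty.
Variables (K : fieldType) (V : finType) (Q : quiver V) (B : pzAlgType K).
Variables (e : V -> B) (phi : arr Q -> B).
Hypothesis eM : forall i j, e i * e j = if i == j then e i else 0.
Hypothesis e1 : \sum_i e i = 1.
Hypothesis ephi : forall a, e (src a) * phi a = phi a.
Hypothesis phie : forall a, phi a * e (tgt a) = phi a.
Variable N : nat.

Definition word_val i (w : seq (arr Q)) : B := e i * \prod_(a <- w) phi a.
Hypothesis phiN : forall i w, walk i w -> (N <= size w)%N -> word_val i w = 0.

Lemma word_val_end i w : walk i w -> word_val i w * e (walk_end i w) = word_val i w.
Proof.
rewrite /word_val; case: (lastP w) => [|v b]; first by rewrite big_nil mulr1 eM eqxx.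
move=> _; rewrite /walk_end map_rcons last_rcons -cats1 big_cat big_seq1 -!mulrA.
by rewrite phie.
Qed.

Lemma word_val_cat i w v : walk i w -> walk (walk_end i w) v ->
  word_val i (w ++ v) = word_val i w * word_val (walk_end i w) v.
Proof.
move=> hw _; rewrite [X in _ * X]/word_val mulrA word_val_end //.
by rewrite /word_val big_cat /= mulrA.
Qed.

(** The sum stops at the length N from which words vanish. *)
Definition lift_fun (x : cpa K Q) : B :=
  \sum_(m < N) \sum_(w : m.-tuple (arr Q)) \sum_i kalg (coef x i w) * word_val i w.

Lemma lift_lin c x y : lift_fun (c *: x + y) = kalg c * lift_fun x + lift_fun y.
Proof.
rewrite /lift_fun mulr_sumr -big_split; apply: eq_bigr => m _ /=.
rewrite mulr_sumr -big_split; apply: eq_bigr => w _ /=.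
rewrite mulr_sumr -big_split; apply: eq_bigr => i _ /=.
by rewrite coefD coefZ rmorphD rmorphM mulrDl mulrA.
Qed.

Lemma lift_far x : far N x -> lift_fun x = 0.
Proof.
move=> /farP fx; rewrite /lift_fun big1 // => m _; rewrite big1 // => w _.
by rewrite big1 // => i _; rewrite fx ?rmorph0 ?mul0r // size_tuple.
Qed.

Lemma lift_bas i w : walk i w -> lift_fun (bas K i w) = word_val i w.
Proof.
move=> h; case: (ltnP (size w) N) => wN; last by rewrite phiN // lift_far //; apply: far_bas.
rewrite /lift_fun (bigD1 (Ordinal wN)) //= (bigD1 (in_tuple w)) //= (bigD1 i) //=.
rewrite coef_bas !eqxx h rmorph1 mul1r.
rewrite [X in _ + X + _ + _]big1 => [|j ji]; last first.
  by rewrite coef_bas eq_sym (negbTE ji) rmorph0 mul0r.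
rewrite [X in _ + _ + X + _]big1 => [|u uw]; last first.
  rewrite big1 // => j _; rewrite coef_bas (_ : w == u = false) ?andbF ?rmorph0 ?mul0r //.
  by apply: contraNF uw => /eqP uw; apply/eqP/val_inj.
rewrite [X in _ + _ + _ + X]big1 ?addr0 // => -[m mN] /eqP mw.
rewrite big1 // => u _; rewrite big1 // => j _.
rewrite coef_bas (_ : w == u = false) ?andbF ?rmorph0 ?mul0r //.
by apply/eqP => uw; apply: mw; apply: val_inj; rewrite /= uw size_tuple.
Qed.

Lemma lift0 : lift_fun 0 = 0. Proof. exact: lift_far. Qed.

Lemma liftM x y : lift_fun (x * y) = lift_fun x * lift_fun y.
Proof.
move: x; apply: (path_ind (S := fun x => lift_fun (x * y) = lift_fun x * lift_fun y) (n := N)).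
- split=> [|c x x' Ex Ex']; first by rewrite mul0r lift0 mul0r.
  by rewrite mulrDl -scaleAl !lift_lin Ex Ex' mulrDl mulrA.
- by move=> x fx; rewrite (lift_far (farMr y fx)) (lift_far fx) mul0r.
move=> i w hw; move: y.
apply: (path_ind (S := fun y => lift_fun (bas K i w * y) = lift_fun (bas K i w) * lift_fun y) (n := N)).
- split=> [|c y y' Ey Ey']; first by rewrite mulr0 lift0 mulr0.
  by rewrite mulrDr -scaleAr !lift_lin Ey Ey' mulrDr !mulrA kalg_central.
- by move=> y fy; rewrite (lift_far (farMl _ fy)) (lift_far fy) mulr0.
move=> j v hv; rewrite bas_mul // !lift_bas //; case: eqP => [jE|/eqP jE].
  by rewrite lift_bas ?walk_cat ?hw ?jE // -jE word_val_cat // jE.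
by rewrite lift0 -(word_val_end hw) /word_val -!mulrA [e _ * (e j * _)]mulrA eM (negbTE jE) mul0r !mulr0.
Qed.

(** As long products of arrows vanish in B, only finitely many terms of an
    element of the complete path algebra contribute to its value. *)
Lemma cpa_lift : exists F : {rmorphism cpa K Q -> B},
  [/\ forall c, F (kalg c) = kalg c, forall i, F (idem K i) = e i,
      forall a, F (aelt K a) = phi a & forall x, far N x -> F x = 0].
Proof.
have Fz : zmod_morphism lift_fun.
  by move=> x y; rewrite addrC -scaleN1r lift_lin rmorphN rmorph1 mulN1r addrC.
have F1 : lift_fun 1 = 1.
  rewrite -(sum_idem K Q) -e1; elim/big_rec2: _ => [|i x y _ <-]; first exact: lift0.
  rewrite -[idem K i]scale1r lift_lin rmorph1 mul1r lift_bas // /word_val big_nil mulr1.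
  by [].
have Fm : monoid_morphism lift_fun by split=> // x y; apply: liftM.
exists (mk_rmorphism Fz Fm); split=> [c|i|a|x fx].
- have E : kalg c = c *: (1 : cpa K Q) + 0 :> cpa K Q by rewrite addr0.
  by rewrite E [LHS]lift_lin F1 lift0 mulr1 addr0.
- by rewrite [LHS]lift_bas // /word_val big_nil mulr1.
- by rewrite [LHS]lift_bas /= ?eqxx // /word_val big_seq1 ephi.
exact: lift_far.
Qed.

End UniversalProperty.

Lemma far_path_ind (K : fieldType) (V : finType) (Q : quiver V) (S : set (cpa K Q)) n x :
  ksub S -> closed S -> (forall i w, walk i w -> (n <= size w)%N -> S (bas K i w)) ->
  far n x -> S x.
Proof.
move=> kS clS Sb /farP fx; apply: clS; apply/adic_closureP => m.
exists (trunc m x); last exact: trunc_far.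
do 3!(apply: (ksub_sum _ kS) => ? _); set i := (X in bas _ X); set w := (X in bas _ _ X).
case: (ltnP (size w) n) => wn; first by rewrite fx // scale0r; case: kS.
apply: (ksubZ _ kS); case: (boolP (walk i w)) => h; first exact: Sb.
by rewrite bas_nwalk //; case: kS.
Qed.

(** * Evaluating the mutated path algebra on the tilting module *)

Section Evaluation.
Variables (K : fieldType) (V : finType) (Q : quiver V) (I : finType).
Variables (R : I -> qrel K Q) (k : V).
Hypothesis minR : minimal_rels R.
Hypothesis fdR : fin_dim (bound_algebra R).
Hypothesis k_source : is_source Q k.
Local Notation Lam := (bound_algebra R).
Local Notation pr := (pr R).
Local Notation vtx i := (vtx R i).
Local Notation arw a := (pr (aelt K a)).
Local Notation rel r := (rel_val (R r)).
Local Notation P := (left_premutation k (assoc_gqp R)).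
Local Notation Qm := (gquiv P).
Local Notation gen_ok := (gen_ok k).
Variables (T : lmodType Lam) (tau : arr Q + V -> T).
Local Notation ap f := (hom_app (f : hom T T)).
Hypothesis tauP : presents k tau.

Lemma tau_vtx s : gen_ok s -> vtx (gen_end s) *: tau s = tau s.
Proof. by case: tauP => + _ _ _; apply. Qed.

Lemma tau_rel : \sum_(a | src a == k) arw a *: tau (inl a) = 0.
Proof. by case: tauP. Qed.

Lemma tau_gen t : exists x : arr Q + V -> Lam, t = \sum_(s | gen_ok s) x s *: tau s.
Proof. by case: tauP => _ _ + _; apply. Qed.

Lemma rel_tgtk r : rel_tgt (R r) != k.
Proof. exact: rel_tgt_source. Qed.

Lemma hom_tau_ext (X : lmodType Lam) (f g : hom T X) :
  (forall s, gen_ok s -> f (tau s) = g (tau s)) -> f = g.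
Proof.
move=> fg; apply: homP => t; have [x ->] := tau_gen t.
by rewrite !hom_sum; apply: eq_bigr => s sok; rewrite !hom_app_scale fg.
Qed.

Lemma hom_tau_lift (X : lmodType Lam) (t : arr Q + V -> X) :
  (forall s, gen_ok s -> vtx (gen_end s) *: t s = t s) ->
  \sum_(a | src a == k) arw a *: t (inl a) = 0 ->
  exists f : hom T X, forall s, gen_ok s -> f (tau s) = t s.
Proof.
move=> tv t0; have /choice[x xE] : forall u, exists x : arr Q + V -> Lam,
    u = \sum_(s | gen_ok s) x s *: tau s by move=> u; apply: tau_gen.
have wd (y : arr Q + V -> Lam) : \sum_(s | gen_ok s) y s *: tau s = 0 ->
    \sum_(s | gen_ok s) y s *: t s = 0.
  case: tauP => _ _ _ trel /trel[l lE].
  rewrite (eq_bigr (fun s => match s with inl a => l *: (arw a *: t (inl a)) | inr _ => 0 end)).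
    by rewrite big_sumType /= [X in _ + X]big1 // addr0 -scaler_sumr t0 scaler0.
  move=> s sok; rewrite -tv // scalerA lE //; case: s sok => [a|i] _; last by rewrite scale0r.
  by rewrite scalerA.
have wd2 (y z : arr Q + V -> Lam) : \sum_(s | gen_ok s) y s *: tau s = \sum_(s | gen_ok s) z s *: tau s ->
    \sum_(s | gen_ok s) y s *: t s = \sum_(s | gen_ok s) z s *: t s.
  move=> yz; apply/eqP; rewrite -subr_eq0 -sumrB; apply/eqP.
  rewrite -[RHS](wd (fun s => y s - z s)); first by apply: eq_bigr => s _; rewrite scalerBl.
  rewrite (eq_bigr (fun s => y s *: tau s - z s *: tau s)) => [|s _]; last by rewrite scalerBl.
  by rewrite sumrB yz subrr.
have L : linear (fun u => \sum_(s | gen_ok s) x u s *: t s).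
  move=> a u v; rewrite (wd2 _ (fun s => a * x u s + x v s)).
    by rewrite scaler_sumr -big_split; apply: eq_bigr => s _; rewrite /= scalerDl scalerA.
  rewrite -xE (eq_bigr (fun s => a *: (x u s *: tau s) + x v s *: tau s)) => [|s _].
    by rewrite big_split /= -scaler_sumr -!xE.
  by rewrite scalerDl scalerA.
exists (mk_hom L) => s sok; rewrite [LHS](_ : _ = \sum_(s' | gen_ok s') x (tau s) s' *: t s') //.
rewrite (wd2 _ (fun s' => if s' == s then 1 else 0)) -?xE.
  rewrite (bigD1 s) //= eqxx scale1r big1 ?addr0 // => s' /andP[_ /negbTE->].
  by rewrite scale0r.
rewrite (bigD1 s) //= eqxx scale1r big1 ?addr0 // => s' /andP[_ /negbTE->].
by rewrite scale0r.
Qed.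

(** Generators at arrows are together the summand at k of the tilting module. *)
Definition gen_vertex (s : arr Q + V) : V := match s with inl _ => k | inr i => i end.

Definition vertex_act (i : V) (s : arr Q + V) : T := if gen_vertex s == i then tau s else 0.

(** An arrow of Q away from k acts by right multiplication, the star of an arrow
    a : k -> v sends the generator at v to the one at a, and the star of a
    relation r = sum_a a r_a sends the generator at a to - r_a times the
    generator at the end of r. The arrows of the cut act by zero. *)
Definition arrow_act (x : arr Qm) (s : arr Q + V) : T :=
  match x, s with
  | inl c, inr i => if val c is inl b then
      (if src b == i then arw b *: tau (inr (tgt b)) else 0) else 0
  | inr (inl a), inr i => if val a is inl b then
      (if tgt b == i then tau (inl b) else 0) else 0
  | inr (inr (inl b)), inl a => if val b is inr r then
      - (col R r a *: tau (inr (rel_tgt (R r)))) else 0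
  | _, _ => 0
  end.

Lemma vertex_hom i : exists f : endalg T, forall s, gen_ok s -> ap f (tau s) = vertex_act i s.
Proof.
apply: hom_tau_lift => [s sok|]; rewrite /vertex_act.
  by case: eqP => _; rewrite ?scaler0 ?tau_vtx.
rewrite /=; case: eqP => _; first exact: tau_rel.
by rewrite big1 // => a _; rewrite scaler0.
Qed.

Lemma arrow_hom x : exists f : endalg T, forall s, gen_ok s -> ap f (tau s) = arrow_act x s.
Proof.
apply: hom_tau_lift => [s sok|].
  case: x => [[[b|r] h]|[[[b|r] h]|[[[b|r] h]|[b a]]]]; case: s sok => [s|i] sok /=; rewrite ?scaler0 //.
  - case: eqP => [<-|_]; last by rewrite scaler0.
    by rewrite scalerA vtx_arw.
  - case: eqP => [<-|_]; last by rewrite scaler0.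
    by apply: (tau_vtx (s := inl b)).
  by rewrite scalerN scalerA vtx_col.
case: x => [[[b|r] h]|[[[b|r] h]|[[[b|r] h]|[b a]]]]; rewrite /=;
  try by rewrite big1 // => *; rewrite scaler0.
rewrite (eq_bigr (fun a => - ((arw a * col R r a) *: tau (inr (rel_tgt (R r)))))) => [|a _].
  by rewrite sumrN -scaler_suml sum_arw_col ?scale0r ?oppr0 //; apply/eqP.
by rewrite scalerN scalerA.
Qed.

(** The filtration of T by the powers of the radical. *)
Definition level n (t : T) : Prop := exists x : arr Q + V -> Lam,
  (forall s, radn n (x s)) /\ t = \sum_(s | gen_ok s) x s *: tau s.

Lemma radnD n (u v : Lam) : radn n u -> radn n v -> radn n (u + v).
Proof.
by move=> [x fx ->] [y fy ->]; exists (x + y); rewrite ?rmorphD //; apply: farD.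
Qed.

Lemma radn0 n : radn n (0 : Lam).
Proof. by exists 0; rewrite ?rmorph0. Qed.

Lemma level0 n : level n 0.
Proof.
exists (fun=> 0); split=> [s|]; first exact: radn0.
by rewrite big1 // => s _; rewrite scale0r.
Qed.

Lemma levelD n t u : level n t -> level n u -> level n (t + u).
Proof.
move=> [x [rx ->]] [y [ry ->]]; exists (fun s => x s + y s); split=> [s|].
  by apply: radnD.
by rewrite -big_split; apply: eq_bigr => s _; rewrite scalerDl.
Qed.

Lemma levelZ m n u t : radn m u -> level n t -> level (m + n) (u *: t).
Proof.
move=> ru [x [rx ->]]; exists (fun s => u * x s); split=> [s|]; first exact: radn_mul.
by rewrite scaler_sumr; apply: eq_bigr => s _; rewrite scalerA.
Qed.

Lemma level_tau s : gen_ok s -> level 0 (tau s).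
Proof.
move=> sok; exists (fun s' => if s' == s then 1 else 0); split=> [s'|]; first exact: radn_all.
rewrite (bigD1 s) //= eqxx scale1r big1 ?addr0 // => s' /andP[_ /negbTE->].
by rewrite scale0r.
Qed.

Lemma level_sum n (J : Type) (r : seq J) (Pr : pred J) F :
  (forall j, Pr j -> level n (F j)) -> level n (\sum_(j <- r | Pr j) F j).
Proof.
move=> lF; elim/big_rec: _ => [|j t Pj lt]; first exact: level0.
by apply: levelD => //; apply: lF.
Qed.

(** All arrows but the stars of arrows raise the level. *)
Definition up_arrow (x : arr Qm) : bool := if x is inr (inl _) then false else true.

Lemma level_act x s : gen_ok s -> level (up_arrow x) (arrow_act x s).
Proof.
move=> sok; case: x => [[[b|r] h]|[[[b|r] h]|[[[b|r] h]|[b a]]]]; case: s sok => [s|i] sok /=;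
  try exact: level0.
- case: eqP => _; last exact: level0.
  rewrite -[X in level X _]addn0; apply: levelZ; last by apply: level_tau; apply: k_source.
  by exists (aelt K b) => //; apply: far_bas.
- by case: eqP => _; [apply: level_tau|apply: level0].
rewrite -scaleNr; rewrite -[X in level X _]addn0; apply: levelZ; last by apply: level_tau; apply: rel_tgtk.
by exists (- ldiv s (rel r)); rewrite ?rmorphN //; apply: farN; apply: ldiv_far; apply: rel_far.
Qed.

Lemma end_mulE (f g : endalg T) t : ap (f * g) t = ap g (ap f t). Proof. by []. Qed.

Lemma end_sumE (J : Type) (r : seq J) (Pr : pred J) (F : J -> endalg T) t :
  ap (\sum_(j <- r | Pr j) F j) t = \sum_(j <- r | Pr j) ap (F j) t.
Proof. by elim/big_rec2: _ => [|j y f _ <-]. Qed.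

Lemma level_prod (A : arr Qm -> endalg T) w n t :
  (forall x s, gen_ok s -> ap (A x) (tau s) = arrow_act x s) ->
  level n t -> level (count up_arrow w + n) (ap (\prod_(x <- w) A x) t).
Proof.
move=> AE; elim: w n t => [|x w IH] n t lt; first by rewrite big_nil.
rewrite big_cons end_mulE /=.
have -> : (up_arrow x + count up_arrow w + n = count up_arrow w + (up_arrow x + n))%N.
  by rewrite addnCA addnA.
apply: IH.
case: lt => y [ry ->]; rewrite hom_sum; apply: level_sum => s sok.
by rewrite hom_app_scale AE // addnC; apply: levelZ => //; apply: level_act.
Qed.

(** The star of an arrow ends at k, and only stars of relations start at k. *)
Lemma star_twice w i : walk i w -> (size w <= (count up_arrow w).*2.+1)%N.
Proof.
elim/ltn_ind: {w}(size w) {-2}w (erefl (size w)) i => n IH [|x w] wn i //= /andP[_ hw].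
case: (boolP (up_arrow x)) => ux.
  by rewrite add1n doubleS; have := IH _ _ w erefl _ hw; rewrite -wn /= ltnSn => /(_ erefl)/leqW.
case: w wn hw => [|y w] wn //= /andP[yk hw].
have uy : up_arrow y.
  case: x ux yk {wn} => [//|[a|//]] _; case: y hw => [//|[[[b|r] h]|//]] _ /eqP /= yk.
    by have := k_source b; rewrite yk eqxx.
  by have := rel_tgtk r; move: h; rewrite /= => ->.
rewrite uy add0n add1n doubleS !ltnS.
by have := IH _ _ w erefl _ hw; rewrite -wn /=; apply; rewrite ltnS leqnSn.
Qed.

(** The action extends to the complete path algebra because long paths raise the
    level, by [star_twice], and the radical is nilpotent. *)
Lemma evaluation : exists F : {rmorphism cpa K Qm -> endalg T},
  [/\ forall c, F (kalg c) = kalg c,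
      forall i s, gen_ok s -> ap (F (idem K i)) (tau s) = vertex_act i s,
      forall x s, gen_ok s -> ap (F (aelt K x)) (tau s) = arrow_act x s &
      exists N, forall x, far N x -> F x = 0].
Proof.
have /choice[E EE] := vertex_hom; have /choice[A AE] := arrow_hom.
have [N rN] := radn_nil fdR.
have E0 i s : gen_ok s -> gen_vertex s != i -> ap (E i) (tau s) = 0.
  by move=> sok si; rewrite EE // /vertex_act (negbTE si).
have E1 i s : gen_ok s -> gen_vertex s = i -> ap (E i) (tau s) = tau s.
  by move=> sok <-; rewrite EE // /vertex_act eqxx.
have [||||j w hw wN|F [Fk Fi Fa Ffar]] := @cpa_lift K V Qm (endalg T) E A _ _ _ _ N.*2.+1 _.
- move=> i j; apply: hom_tau_ext => s sok; rewrite end_mulE EE // /vertex_act.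
  case: (eqVneq (gen_vertex s) i) => [si|si]; last first.
    by rewrite hom0E; case: eqP => _ //; rewrite E0.
  case: (eqVneq i j) => [ij|ij]; first by rewrite E1 ?E1 // si.
  by rewrite E0 // si.
- apply: hom_tau_ext => s sok; rewrite end_sumE (bigD1 (gen_vertex s)) //= E1 // big1 ?addr0 // => i si.
  by rewrite E0 // eq_sym.
- move=> x; apply: hom_tau_ext => s sok; rewrite end_mulE EE // /vertex_act.
  case: eqP => [//|sx]; rewrite hom0E AE //.
  case: x sx => [[[b|r] h]|[[[b|r] h]|[[[b|r] h]|[b a]]]]; case: s sok => [s|i] sok //= sx.
  + by case: eqP => // bi; case: sx.
  by case: eqP => // bi; case: sx.
- move=> x; apply: hom_tau_ext => s sok; rewrite end_mulE !AE //.
  case: x => [[[b|r] h]|[[[b|r] h]|[[[b|r] h]|[b a]]]]; case: s sok => [s|i] sok; rewrite [arrow_act _ _]/= ?hom0E //.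
  + case: eqP => _; last by rewrite hom0E.
    by rewrite hom_app_scale E1 //; apply: k_source.
  + case: eqP => _; last by rewrite hom0E.
    by rewrite E1.
  by rewrite -scaleNr hom_app_scale E1 //; apply: rel_tgtk.
- apply: hom_tau_ext => s sok; rewrite /word_val end_mulE [RHS](_ : _ = 0) //.
  have [x EsE] := tau_gen (ap (E j) (tau s)).
  have l0 : level 0 (ap (E j) (tau s)) by exists x; split=> // s'; apply: radn_all.
  have [y [ry ->]] := level_prod w AE l0; rewrite big1 // => s' _.
  rewrite (rN (y s')) ?scale0r //; have [z fz ->] := ry s'.
  exists z => //; apply: farW fz; rewrite addn0 -leq_double -ltnS.
  by apply: leq_trans (star_twice hw).
exists F; split=> // [i s sok|x s sok|]; first by rewrite Fi EE.
  by rewrite Fa AE.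
by exists N.*2.+1.
Qed.

End Evaluation.

(** * The kernel and the image of the evaluation *)

Section Kernel.
Variables (K : fieldType) (V : finType) (Q : quiver V) (I : finType).
Variables (R : I -> qrel K Q) (k : V).
Hypothesis minR : minimal_rels R.
Hypothesis fdR : fin_dim (bound_algebra R).
Hypothesis k_source : is_source Q k.
Hypothesis gld : gldim_le (bound_algebra R) 2.
Local Notation Lam := (bound_algebra R).
Local Notation pr := (pr R).
Local Notation vtx i := (vtx R i).
Local Notation arw a := (pr (aelt K a)).
Local Notation rel r := (rel_val (R r)).
Local Notation P := (left_premutation k (assoc_gqp R)).
Local Notation Qm := (gquiv P).
Local Notation gen_ok := (gen_ok k).
Local Notation theta := (theta R k).
Variables (T : lmodType Lam) (tau : arr Q + V -> T).
Local Notation ap f := (hom_app (f : hom T T)).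
Hypothesis tauP : presents k tau.
Variable F : {rmorphism cpa K Qm -> endalg T}.
Hypothesis Fk : forall c, F (kalg c) = kalg c.
Hypothesis Fi : forall i s, gen_ok s -> ap (F (idem K i)) (tau s) = vertex_act k tau i s.
Hypothesis Fa : forall x s, gen_ok s -> ap (F (aelt K x)) (tau s) = arrow_act tau x s.
Variable N : nat.
Hypothesis FN : forall x, far N x -> F x = 0.

(** ** Elements of the path algebra of Q *)

Lemma expand_theta1 w b : expand (@theta_arr K V Q I R k) w = Some [:: b] ->
  exists2 c : far_arr k (assoc_gqp R), w = [:: common c : arr Qm] & val c = inl b.
Proof.
case: w => [//|x w]; rewrite expand_cons.
case xE: (theta_arr x) => [v|] //; case wE: (expand _ w) => [v'|] // [vE].
have [b' vb _] := theta_letter xE.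
have [sE _ _] := expandP (@theta_letter K V Q I R k) wE.
move: vE; rewrite vb => -[bb v0]; move: sE; rewrite v0; case: w {wE} => // _.
case: x xE => [c|//]; rewrite /theta_arr; case cE: (val c) => [b2|//] [E].
by exists c => //; move: vb; rewrite -E cE => -[->]; rewrite bb.
Qed.

Lemma theta_source b : src b = k -> theta (aelt K b) = 0.
Proof.
move=> bk; apply: cpaP => i w hw; rewrite coef_theta coef0.
case E: (expand _ w) => [v|] //; rewrite coef_bas.
case: (eqVneq [:: b] v) => [vE|]; last by rewrite andbF.
have [c _ cE] := expand_theta1 (etrans E (congr1 Some (esym vE))).
by have /andP[] := valP c; rewrite cE /= bk eqxx.
Qed.

Lemma theta_far_arrow (c : far_arr k (assoc_gqp R)) b : val c = inl b ->
  theta (aelt K b) = aelt K (common c : arr Qm).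
Proof.
move=> cE; apply: cpaP => i w hw; rewrite coef_theta coef_bas hw andbT.
have sE : src (common c : arr Qm) = src b by rewrite [LHS](_ : _ = src (val c)) // cE.
rewrite sE; case E: (expand _ w) => [v|].
  have [_ wE _] := expandP (@theta_letter K V Q I R k) E.
  rewrite coef_bas wE hw andbT; congr (nat_of_bool (_ && _))%:R.
  apply/eqP/eqP => [vE|wc].
    have [d -> dE] := expand_theta1 (etrans E (congr1 Some (esym vE))).
    by congr [:: inl _]; apply: val_inj; rewrite cE dE.
  by move: E; rewrite -wc expand_cons /theta_arr /common cE => -[].
case: eqP => //= _; case: eqP => //= wc.
by move: E; rewrite -wc expand_cons /theta_arr /common cE.
Qed.

Lemma far_arrow b : src b != k ->
  exists c : far_arr k (assoc_gqp R), val c = inl b.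
Proof.
move=> bk; have h : (src (inl b : arr (gquiv (assoc_gqp R))) != k) &&
    (tgt (inl b : arr (gquiv (assoc_gqp R))) != k) by rewrite /= bk k_source.
by exists (exist _ (inl b) h).
Qed.

Lemma thetaZ c x : theta (c *: x) = c *: theta x.
Proof. exact: pullZ. Qed.

Lemma FZ c x : F (c *: x) = kalg c * F x.
Proof. by rewrite -kalgM rmorphM Fk. Qed.

Lemma hom_app0 (X Y : lmodType Lam) t : hom_app (0 : hom X Y) t = 0.
Proof. by []. Qed.

Lemma F_lin c x y t : ap (F (c *: x + y)) t = kalg c *: ap (F x) t + ap (F y) t.
Proof.
rewrite rmorphD FZ -hom_app_scale.
by [].
Qed.

(** All generators at vertices at once, tau (inr j) being e_j tau_sum. *)
Definition tau_sum : T := \sum_(j | j != k) tau (inr j).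

Lemma vtx_vtx0 i j : i != j -> vtx i * vtx j = 0.
Proof. by move=> ij; rewrite -rmorphM idem_mul (negbTE ij) rmorph0. Qed.

Lemma vtx_tau_sum j : j != k -> vtx j *: tau_sum = tau (inr j).
Proof.
move=> jk; rewrite /tau_sum scaler_sumr (bigD1 j) //= big1 ?addr0 => [|i /andP[ik ij]].
  exact: (tau_vtx tauP (s := inr j)).
by rewrite -(tau_vtx tauP (s := inr i)) //= scalerA vtx_vtx0 ?scale0r // eq_sym.
Qed.

Lemma tau_sumE u : u *: tau_sum = \sum_(j | j != k) (u * vtx j) *: tau (inr j).
Proof.
rewrite {1}/tau_sum scaler_sumr; apply: eq_bigr => j jk.
by rewrite -{1}(tau_vtx tauP (s := inr j)) //= scalerA.
Qed.

Lemma F_theta x :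
  (forall i, i != k -> ap (F (theta x)) (tau (inr i)) = (vtx i * pr x) *: tau_sum) /\
  (forall a, src a = k -> ap (F (theta x)) (tau (inl a)) = kalg (coef x k [::]) *: tau (inl a)).
Proof.
have [N' fN'] := rel_ideal_nil fdR.
pose S := [set x | (forall i, i != k -> ap (F (theta x)) (tau (inr i)) = (vtx i * pr x) *: tau_sum) /\
  (forall a, src a = k -> ap (F (theta x)) (tau (inl a)) = kalg (coef x k [::]) *: tau (inl a))].
have kS : ksub S.
  split=> [|c y z [Y1 Y2] [Z1 Z2]].
    split=> [i ik|a ak]; rewrite !rmorph0 hom_app0.
      by rewrite mulr0 scale0r.
    by rewrite coef0 rmorph0 scale0r.
  split=> [i ik|a ak]; rewrite rmorphD thetaZ F_lin.
    by rewrite Y1 // Z1 // rmorphD prZ scalerA -scalerDl mulrDr !mulrA kalg_central.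
  by rewrite Y2 // Z2 // coefD coefZ rmorphD rmorphM scalerDl scalerA.
apply: (path_ind (S := S) (n := maxn 1 (maxn N N'))) => // [y fy|i w hw].
  have F0 : F (theta y) = 0.
    by apply: FN; apply: pull_far; apply: farW fy; rewrite leq_max leq_max leqnn orbT.
  have p0 : pr y = 0.
    by apply/pr0/fN'; apply: farW fy; rewrite leq_max leq_max leqnn !orbT.
  split=> [j jk|a ak]; rewrite F0 [LHS](_ : _ = 0) //; first by rewrite p0 mulr0 scale0r.
  have /farP -> // : far 1 y by apply: farW fy; rewrite leq_max leqnn.
  by rewrite rmorph0 scale0r.
elim: w i hw => [|b w IH] i hw.
  split=> [j jk|a ak]; (rewrite theta_idem Fi; last by rewrite /= ?ak); rewrite /vertex_act /=.
    rewrite -rmorphM idem_mul; case: eqP => _; last by rewrite rmorph0 scale0r.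
    by rewrite vtx_tau_sum.
  rewrite coef_bas andbT [k == i]eq_sym; case: eqP => _ /=; last by rewrite rmorph0 scale0r.
  by rewrite rmorph1 scale1r.
move: hw => /= /andP[/eqP <- hw]; rewrite -aelt_bas; have {IH hw}[IH1 IH2] := IH _ hw.
set y := bas _ _ _ in IH1 IH2 *.
split=> [j jk|a ak]; rewrite (rmorphM theta) (rmorphM F) end_mulE.
  case: (eqVneq (src b) k) => bk.
    rewrite theta_source // rmorph0 [ap 0 _](_ : _ = 0) // hom0E (rmorphM pr) mulrA.
    by rewrite -[vtx j * _]rmorphM idem_aelt bk (negbTE jk) rmorph0 mul0r scale0r.
  have [c cE] := far_arrow bk; rewrite (theta_far_arrow cE) Fa // /arrow_act /common cE; case: eqP => [bj|bj].
    rewrite hom_app_scale IH1; last exact: k_source.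
    by rewrite scalerA (rmorphM pr) !mulrA -bj arw_vtx vtx_arw.
  rewrite hom0E (rmorphM pr) mulrA -[vtx j * _]rmorphM idem_aelt eq_sym.
  by case: eqP bj => //; rewrite rmorph0 mul0r scale0r.
rewrite coef_aeltM rmorph0 scale0r; case: (eqVneq (src b) k) => bk.
  by rewrite theta_source // rmorph0 [ap 0 _](_ : _ = 0) // hom0E.
have [c cE] := far_arrow bk.
by rewrite (theta_far_arrow cE) Fa /= ?ak // hom0E.
Qed.

(** ** The truncated Jacobian ideal lies in the kernel *)

Lemma col_eps r a i : i != tgt a -> coef (ldiv a (rel r)) i [::] = 0.
Proof. by move=> ia; rewrite coef_ldiv (negbTE ia). Qed.

Lemma F_kernel_ideal : is_ideal [set x | F x = 0].
Proof.
split=> [|x y x0 y0|a x x0] /=; first exact: rmorph0.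
  by rewrite rmorphB x0 y0 subrr.
by rewrite !rmorphM x0 mulr0 mul0r.
Qed.

Lemma F_kernel_closed : closed [set x | F x = 0].
Proof. exact: (far_closed (ideal_ksub F_kernel_ideal) FN). Qed.

Lemma F_zero x : (forall s, gen_ok s -> ap (F x) (tau s) = 0) -> F x = 0.
Proof. by move=> x0; apply: (hom_tau_ext tauP) => s sok; rewrite x0. Qed.

(** For the arrow of the cut from a relation r and an arrow a at k, this says
    that r_a is minus the product of the stars of a and r, which is how these
    stars act. *)
Lemma F_tjac x : ideal_set (gtjac P) x -> F x = 0.
Proof.
have rtk := rel_tgtk minR k_source.
suff : ideal_set (gtjac P) `<=` [set x | F x = 0] by apply.
apply: (mut_tjac_min k_source rtk F_kernel_ideal F_kernel_closed) => c.
  rewrite (mut_deg1 k_source rtk) /= => cC; apply: F_zero => s sok; rewrite Fa //.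
  by case: c cC => [[[b|r] h]|[a|[b|[b a]]]] //= _; case: s sok.
case: c => [c|[a|[b|[b a]]]] /=; try exact: rmorph0.
  apply: F_zero => -[a /eqP ak|i ik]; rewrite /far_rel.
    rewrite -/theta -[pullback _ _]/(theta _) (F_theta _).2 //.
    case: (val c) => [b|r]; first by rewrite coef0 rmorph0 scale0r.
    have /farP -> // : far 1 (rel r) by apply: farW (rel_far R r).
    by rewrite rmorph0 scale0r.
  rewrite -[pullback _ _]/(theta _) (F_theta _).1 //.
  case: (val c) => [b|r]; first by rewrite rmorph0 mulr0 scale0r.
  have -> : pr (rel r) = 0 by apply/pr0/rel_ideal_rel.
  by rewrite mulr0 scale0r.
have [r bE rk] := in_arrE k_source b; have [a' aE ak] := out_arrE rtk a.
rewrite -[pullback _ _]/(theta _) /rel_part bE aE.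
apply: F_zero => s sok; rewrite rmorphD rmorphM.
rewrite [LHS](_ : _ = ap (F (theta (ldiv a' (rel r)))) (tau s) +
   ap (F (aelt K (out_star a : arr Qm)) * F (aelt K (in_star b : arr Qm))) (tau s)) //.
rewrite end_mulE Fa //; case: s sok => [a0 /eqP a0k|i ik].
  rewrite (F_theta _).2 // col_eps; last by rewrite eq_sym; apply: k_source.
  by rewrite rmorph0 scale0r [arrow_act _ _ _]/= hom0E addr0.
rewrite (F_theta _).1 // /arrow_act /out_star aE.
case: (eqVneq (tgt a') i) => [<-|ai].
  rewrite Fa; last by rewrite /= ak.
  rewrite /arrow_act /in_star bE -/(col R r a') vtx_col -[col R r a']col_vtx.
  rewrite -!scalerA vtx_tau_sum ?rtk // (tau_vtx tauP (s := inr _)) ?subrr //.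
  exact: rtk.
rewrite hom0E addr0 -/(col R r a') -vtx_col mulrA vtx_vtx0 ?mul0r ?scale0r //.
by rewrite eq_sym.
Qed.

(** ** The stars of the arrows and relations starting at k *)

(** Stars are indexed by arrows and relations of Q, and are 0 for those which do
    not start at k. *)
Definition star_arrow a : cpa K Qm :=
  oapp (fun a' : out_arr k (assoc_gqp R) => aelt K (out_star a' : arr Qm)) 0 (insub (inl a)).
Definition star_rel r : cpa K Qm :=
  oapp (fun b : in_arr k (assoc_gqp R) => aelt K (in_star b : arr Qm)) 0 (insub (inr r)).

Lemma star_arrowE a : src a = k -> exists2 a' : out_arr k (assoc_gqp R),
  val a' = inl a & star_arrow a = aelt K (out_star a' : arr Qm).
Proof.
move=> /eqP ak; exists (exist _ (inl a) ak) => //.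
rewrite /star_arrow; case: insubP => [a' _ a'E|]; last by rewrite /= ak.
by rewrite /=; congr (aelt K (out_star _ : arr Qm)); apply: val_inj.
Qed.

Lemma star_relE r : rel_src (R r) = k -> exists2 b : in_arr k (assoc_gqp R),
  val b = inr r & star_rel r = aelt K (in_star b : arr Qm).
Proof.
move=> /eqP rk; exists (exist _ (inr r) rk) => //.
rewrite /star_rel; case: insubP => [b _ bE|]; last by rewrite /= rk.
by rewrite /=; congr (aelt K (in_star _ : arr Qm)); apply: val_inj.
Qed.

Lemma out_starE (a : out_arr k (assoc_gqp R)) : exists a',
  [/\ src a' = k, val a = inl a' & aelt K (out_star a : arr Qm) = star_arrow a'].
Proof.
have [a' aE ak] := out_arrE (rel_tgtk minR k_source) a; exists a'; split=> //.
have [a2 a2E ->] := star_arrowE ak; congr (aelt K (out_star _ : arr Qm)).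
by apply: val_inj; rewrite aE a2E.
Qed.

Lemma in_starE (b : in_arr k (assoc_gqp R)) : exists2 r, rel_src (R r) = k &
  aelt K (in_star b : arr Qm) = star_rel r.
Proof.
have [r bE rk] := in_arrE k_source b; exists r => //.
have [b2 b2E ->] := star_relE rk; congr (aelt K (in_star _ : arr Qm)).
by apply: val_inj; rewrite bE b2E.
Qed.

Lemma idem_star_arrow i a : src a = k ->
  idem K i * star_arrow a = if i == tgt a then star_arrow a else 0.
Proof.
move=> /star_arrowE[a' aE ->]; rewrite idem_aelt.
by rewrite (_ : src (out_star a' : arr Qm) = tgt a) // [LHS](_ : _ = tgt (val a')) // aE.
Qed.

Lemma star_arrow_idem i a : src a = k ->
  star_arrow a * idem K i = if i == k then star_arrow a else 0.
Proof. by move=> /star_arrowE[a' aE ->]; rewrite aelt_idem. Qed.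

Lemma idem_star_rel i r : rel_src (R r) = k ->
  idem K i * star_rel r = if i == k then star_rel r else 0.
Proof. by move=> /star_relE[b bE ->]; rewrite idem_aelt. Qed.

Lemma star_rel_idem i r : rel_src (R r) = k ->
  star_rel r * idem K i = if i == rel_tgt (R r) then star_rel r else 0.
Proof.
move=> /star_relE[b bE ->]; rewrite aelt_idem.
by rewrite (_ : tgt (in_star b : arr Qm) = rel_tgt (R r)) // [LHS](_ : _ = src (val b)) // bE.
Qed.

Lemma F_star_arrow a : src a = k ->
  ap (F (star_arrow a)) tau_sum = tau (inl a) /\
  forall c, src c = k -> ap (F (star_arrow a)) (tau (inl c)) = 0.
Proof.
move=> ak; have [a' aE ->] := star_arrowE ak; split=> [|c ck]; last by rewrite Fa //= ck.
have tk : tgt a != k by apply: k_source.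
rewrite /tau_sum hom_sum (bigD1 (tgt a)) //= big1 ?addr0 => [|i /andP[ik ai]].
  by rewrite Fa // /arrow_act /out_star aE eqxx.
by rewrite Fa // /arrow_act /out_star aE eq_sym (negbTE ai).
Qed.

Lemma F_star_rel r : rel_src (R r) = k ->
  (forall i, i != k -> ap (F (star_rel r)) (tau (inr i)) = 0) /\
  forall c, src c = k ->
    ap (F (star_rel r)) (tau (inl c)) = - (col R r c *: tau_sum).
Proof.
move=> rk; have [b bE ->] := star_relE rk; split=> [i ik|c ck]; rewrite Fa //=; last by rewrite ck.
rewrite (bE : sval b = _) -{2}[col R r c]col_vtx -scalerA vtx_tau_sum //.
exact: rel_tgtk.
Qed.

(** ** Normal forms *)

(** Modulo the Jacobian relations a path can be made to leave k only at its
    start, by the star of a relation, and to enter k only at its end, by the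
    star of an arrow. *)
Definition normal_form (x : cpa K Q) (xa : arr Q -> cpa K Q) (w : I -> cpa K Q)
    (wa : I -> arr Q -> cpa K Q) : cpa K Qm :=
  theta x + \sum_(a | src a == k) theta (xa a) * star_arrow a +
  \sum_(r | rel_src (R r) == k) (star_rel r * theta (w r) +
    \sum_(a | src a == k) star_rel r * theta (wa r a) * star_arrow a).

Lemma F_theta_sum x : 
  (forall i, i != k -> ap (F (theta x)) (tau (inr i)) = (vtx i * pr x) *: tau_sum).
Proof. by case: (F_theta x). Qed.

Lemma ap_add (f g : endalg T) t : ap (f + g) t = ap f t + ap g t.
Proof. by []. Qed.

Lemma F_normal_form_far x xa w wa i : i != k ->
  ap (F (normal_form x xa w wa)) (tau (inr i)) =
  (vtx i * pr x) *: tau_sum + \sum_(a | src a == k) (vtx i * pr (xa a)) *: tau (inl a).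
Proof.
move=> ik; rewrite /normal_form rmorphD ap_add rmorphD ap_add F_theta_sum //.
rewrite [X in _ + X](_ : _ = 0) ?addr0.
  congr (_ + _); rewrite (rmorph_sum F) end_sumE; apply: eq_bigr => a /eqP ak.
  by rewrite (rmorphM F) end_mulE F_theta_sum // hom_app_scale (F_star_arrow ak).1.
rewrite (rmorph_sum F) end_sumE; apply: big1 => r /eqP rk; rewrite rmorphD ap_add (rmorphM F) end_mulE (F_star_rel rk).1 // hom0E add0r.
rewrite (rmorph_sum F) end_sumE; apply: big1 => a _.
by rewrite -mulrA (rmorphM F) end_mulE (F_star_rel rk).1 // hom0E.
Qed.

Lemma F_theta_col r c x : ap (F (theta x)) (col R r c *: tau_sum) = (col R r c * pr x) *: tau_sum.
Proof.
have rk := rel_tgtk minR k_source r.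
rewrite -{1}[col R r c]col_vtx -scalerA vtx_tau_sum // hom_app_scale F_theta_sum //.
by rewrite scalerA mulrA col_vtx.
Qed.

Lemma F_normal_form_near x xa w wa c : src c = k ->
  ap (F (normal_form x xa w wa)) (tau (inl c)) =
  kalg (coef x k [::]) *: tau (inl c) -
  \sum_(r | rel_src (R r) == k) ((col R r c * pr (w r)) *: tau_sum +
    \sum_(a | src a == k) (col R r c * pr (wa r a)) *: tau (inl a)).
Proof.
move=> ck; rewrite /normal_form rmorphD ap_add rmorphD ap_add (F_theta _).2 //.
rewrite [X in _ + X + _](_ : _ = 0) ?addr0; last first.
  rewrite (rmorph_sum F) end_sumE; apply: big1 => a /eqP ak.
  by rewrite (rmorphM F) end_mulE (F_theta _).2 // hom_app_scale (F_star_arrow ak).2 // scaler0.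
congr (_ + _); rewrite (rmorph_sum F) end_sumE -sumrN; apply: eq_bigr => r /eqP rk.
have homN (f : hom T T) t : f (- t) = - f t by rewrite -sub0r homB hom0E sub0r.
rewrite rmorphD ap_add (rmorphM F) end_mulE (F_star_rel rk).2 // homN F_theta_col opprD.
congr (_ + _); rewrite (rmorph_sum F) end_sumE -sumrN; apply: eq_bigr => a /eqP ak.
rewrite !(rmorphM F) !end_mulE (F_star_rel rk).2 // !homN F_theta_col.
by rewrite hom_app_scale (F_star_arrow ak).1.
Qed.

(** ** Surjectivity *)

Lemma vtx_mul_vtxk i u : i != k -> vtx i * u * vtx k = 0.
Proof. by move=> ik; rewrite -mulrA mul_vtxk // mulrA -kalg_central -mulrA vtx_vtx0 ?mulr0. Qed.

Lemma vtx_mul_arw i u a : src a = k -> i != k -> vtx i * (u * arw a) = 0.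
Proof. by move=> ak ik; rewrite -vtx_arw ak !mulrA vtx_mul_vtxk // mul0r. Qed.

Lemma arw_source l a : src a = k -> l * arw a = kalg (eps k l) * arw a.
Proof.
move=> ak; have E : vtx k * arw a = arw a by rewrite -{1}ak vtx_arw.
by rewrite -{1}E mulrA mul_vtxk // -mulrA E.
Qed.

(** Applying f to sum_a a t_a = 0 gives another relation between the generators,
    which is a multiple of this one. Hence, up to a scalar multiple of the t_a,
    the coefficients of the images of the t_a at each generator are killed by
    the arrows at k, and [columns_exact] applies to them. *)
Lemma image_columns f : exists l0 (W : arr Q + V -> I -> Lam), forall c, src c = k ->
  ap f (tau (inl c)) = kalg l0 *: tau (inl c) +
    \sum_(s | gen_ok s) (\sum_(r | rel_src (R r) == k) col R r c * W s r) *: tau s.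
Proof.
have /choice[y yE] : forall c, exists y : arr Q + V -> Lam,
  ap f (tau (inl c)) = \sum_(s | gen_ok s) y s *: tau s by move=> c; apply: (tau_gen tauP).
have [l lE] : exists l, forall s, gen_ok s ->
    (\sum_(c | src c == k) arw c * y c s) * vtx (gen_end s) =
    match s with inl a => l * arw a | inr _ => 0 end.
  case: tauP => _ t0 _; apply.
  transitivity (ap f (\sum_(a | src a == k) arw a *: tau (inl a))); last by rewrite t0 hom0E.
  rewrite hom_sum; under [RHS]eq_bigr => c _ do rewrite hom_app_scale yE scaler_sumr.
  rewrite exchange_big; apply: eq_bigr => s _; rewrite scaler_suml.
  by apply: eq_bigr => c _; rewrite scalerA.
pose l0 := eps k l.
pose d (s : arr Q + V) c : Lam := if s == inl c then kalg l0 * vtx (tgt c) else 0.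
have /choice[W WE] : forall s, exists W : I -> Lam, gen_ok s -> forall c, src c = k ->
    vtx (tgt c) * (y c s * vtx (gen_end s) - d s c) =
    \sum_(r | rel_src (R r) == k) col R r c * W r.
  move=> s; case: (boolP (gen_ok s)) => [sok|_]; last by exists (fun=> 0).
  have [|W WE] := @columns_exact _ _ _ _ R k fdR (fun c => y c s * vtx (gen_end s) - d s c); last by exists W.
  rewrite (eq_bigr (fun c => arw c * y c s * vtx (gen_end s) - arw c * d s c)) => [|c _]; last by rewrite mulrBr mulrA.
  rewrite sumrB -mulr_suml lE //; case: s sok => [a|j] sok; last first.
    by rewrite big1 ?subrr // => c _; rewrite mulr0.
  transitivity (l * arw a - \sum_(c | src c == k) arw c * d (inl a) c) => //.
  rewrite (bigD1 a) // big1 => [|c /andP[_ ca]]; last first.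
    rewrite /d; case: eqP => [[ac]|_]; last by rewrite mulr0.
    by rewrite ac eqxx in ca.
  by rewrite [X in _ - X]addr0 /d eqxx mulrA -kalg_central -mulrA arw_vtx arw_source ?subrr //; apply/eqP.
exists l0, W => c ck; have cok : gen_ok (inl c) by apply/eqP.
transitivity (\sum_(s | gen_ok s) ((\sum_(r | rel_src (R r) == k) col R r c * W s r) + vtx (tgt c) * d s c) *: tau s).
  rewrite -{1}(tau_vtx tauP cok) hom_app_scale yE scaler_sumr; apply: eq_bigr => s sok.
  by rewrite -WE // mulrBr subrK mulrA -!scalerA (tau_vtx tauP sok).
rewrite (eq_bigr (fun s => (vtx (tgt c) * d s c) *: tau s +
  (\sum_(r | rel_src (R r) == k) col R r c * W s r) *: tau s)) => [|s _]; last by rewrite addrC scalerDl.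
rewrite big_split /=; congr (_ + _); rewrite (bigD1 (inl c)) //= big1 ?addr0 => [|s /andP[_ sc]].
  by rewrite /d eqxx mulrA -kalg_central -mulrA vtx_vtx -scalerA (tau_vtx tauP cok).
by rewrite /d (negbTE sc) mulr0 scale0r.
Qed.

Lemma vtx_lift i (y : V -> Lam) : i != k ->
  vtx i * pr (\sum_(j | j != k) idem K j * qalg_repr (y j)) = vtx i * y i.
Proof.
move=> ik; rewrite rmorph_sum mulr_sumr (bigD1 i) // big1 => [|j /andP[_ ji]].
  by rewrite [LHS]addr0 rmorphM pr_repr mulrA vtx_vtx.
by rewrite rmorphM mulrA vtx_vtx0 ?mul0r // eq_sym.
Qed.

Lemma normal_form_surj f : exists x xa w wa, F (normal_form x xa w wa) = f.
Proof.
have /choice[x xE] : forall i, exists x : arr Q + V -> Lam,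
  ap f (tau (inr i)) = \sum_(s | gen_ok s) x s *: tau s by move=> i; apply: (tau_gen tauP).
have [l0 [W WE]] := image_columns f.
pose u i := \sum_(j | j != k) x i (inr j) * vtx j.
pose X := l0 *: idem K k + \sum_(i | i != k) idem K i * qalg_repr (u i).
have Xk : coef X k [::] = l0.
  rewrite coefD coefZ /idem coef_bas eqxx mulr1 coef_sum big1 ?addr0 // => i ik.
  by rewrite coef_idemM (negbTE ik).
have Xi i : i != k -> vtx i * pr X = vtx i * u i.
  move=> ik; rewrite rmorphD prZ mulrDr mulrA -kalg_central -mulrA vtx_vtx0 // mulr0 add0r.
  exact: vtx_lift.
pose xa i a := x i (inl a).
exists X, (fun a => \sum_(i | i != k) idem K i * qalg_repr (xa i a)),
  (fun r => qalg_repr (- (\sum_(j | j != k) W (inr j) r * vtx j))), (fun r a => qalg_repr (- W (inl a) r)).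
apply: (hom_tau_ext tauP) => -[c /eqP ck|i ik].
  rewrite F_normal_form_near // Xk WE //; congr (_ + _).
  rewrite [RHS]big_sumType [RHS]addrC -sumrN.
  rewrite (eq_bigr (fun r => (\sum_(j | j != k) (col R r c * W (inr j) r) *: tau (inr j)) +
     \sum_(a | src a == k) (col R r c * W (inl a) r) *: tau (inl a))) => [|r _].
    rewrite big_split /=; congr (_ + _); rewrite exchange_big; apply: eq_bigr => s _;
      by rewrite scaler_suml.
  rewrite opprD pr_repr mulrN scaleNr opprK; congr (_ + _).
    rewrite mulr_sumr scaler_suml; apply: eq_bigr => j jk.
    by rewrite -scalerA -[W _ _ * _ *: _]scalerA vtx_tau_sum // scalerA.
  by rewrite -sumrN; apply: eq_bigr => a _; rewrite pr_repr mulrN scaleNr opprK.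
rewrite F_normal_form_far // Xi // -[in RHS](tau_vtx tauP (s := inr i) ik) hom_app_scale xE.
rewrite big_sumType scalerDr addrC; congr (_ + _).
  rewrite scaler_sumr; apply: eq_bigr => a _; rewrite scalerA; congr (_ *: _).
  exact: (vtx_lift (xa^~ a)).
rewrite -scalerA; congr (_ *: _); rewrite scaler_suml; apply: eq_bigr => j jk.
by rewrite -scalerA vtx_tau_sum.
Qed.

(** ** Injectivity on normal forms *)

Lemma tjac_ideal : is_ideal (ideal_set (gtjac P)).
Proof. exact: idealP. Qed.

Lemma theta_near y : theta (idem K k * y) = coef y k [::] *: idem K k.
Proof.
rewrite idem_decomp rmorphD thetaZ theta_idem rmorph_sum big1 ?addr0 // => a /eqP ak.
by rewrite rmorphM theta_source // mul0r.
Qed.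

Lemma star_cofactor a r : src a = k -> rel_src (R r) = k ->
  ideal_set (gtjac P) (theta (ldiv a (rel r)) + star_arrow a * star_rel r).
Proof.
move=> ak rk; have [a' aE ->] := star_arrowE ak; have [b bE ->] := star_relE rk.
have := mut_tjac k_source (rel_tgtk minR k_source) (compos b a' : arr Qm).
rewrite [X in ideal_set _ X](_ : _ = theta (rel_part b a') +
  aelt K (out_star a' : arr Qm) * aelt K (in_star b : arr Qm)) //.
by rewrite /rel_part bE aE.
Qed.

Lemma theta_rel x : ideal_set (rel_ideal R) x -> ideal_set (gtjac P) (theta x).
Proof.
have clJ : closed (ideal_set (gtjac P)) by apply: closed_ideal_closed.
have [pI pC] : is_ideal [set x | ideal_set (gtjac P) (theta x)] /\
    closed [set x | ideal_set (gtjac P) (theta x)].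
  split; first exact: (ideal_preim _ tjac_ideal).
  by apply: (preim_closed _ clJ) => n y fy; apply: pull_far.
move: x; apply: (closed_ideal_min pI pC) => _ [r _ <-]; change (ideal_set (gtjac P) (theta (rel r))).
have [rk|rk] := eqVneq (rel_src (R r)) k.
  rewrite -[rel r]rel_src_idem rk theta_near.
  have /farP -> // : far 1 (rel r) by apply: farW (rel_far R r).
  by rewrite scale0r; apply: ideal0 tjac_ideal.
have rtk := rel_tgtk minR k_source r.
have h : (src (inr r : arr (gquiv (assoc_gqp R))) != k) &&
    (tgt (inr r : arr (gquiv (assoc_gqp R))) != k) by rewrite /= rk rtk.
pose c : far_arr k (assoc_gqp R) := exist _ (inr r) h.
have := mut_tjac k_source (rel_tgtk minR k_source) (common c : arr Qm).
by rewrite [X in ideal_set _ X](_ : _ = theta (rel r)).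
Qed.

Lemma tjac_theta_vtx x : (forall i, i != k -> vtx i * pr x = 0) -> coef x k [::] = 0 ->
  ideal_set (gtjac P) (theta x).
Proof.
move=> x0 xk; rewrite -[x]mul1r -sum_idem mulr_suml rmorph_sum.
apply: (ideal_sum tjac_ideal) => i _; have [->|ik] := eqVneq i k.
  by rewrite theta_near xk scale0r; apply: ideal0 tjac_ideal.
by apply/theta_rel/pr0; rewrite rmorphM x0.
Qed.

Lemma vtx_ext i u : i != k -> (forall j, j != k -> vtx i * u * vtx j = 0) -> vtx i * u = 0.
Proof.
move=> ik u0; rewrite -[LHS]mulr1 -[1](rmorph1 pr) -sum_idem rmorph_sum mulr_sumr.
by apply: big1 => j _; have [->|/u0//] := eqVneq j k; rewrite vtx_mul_vtxk.
Qed.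

Variable a0 : arr Q.
Hypothesis a0k : src a0 = k.

(** The coefficients are read off from the images of the generators. The arrow
    a0 at k detects the coefficient of e_k, which is a scalar, while all columns
    of relations lie in the radical; then [columns_inj] removes the terms
    starting with the star of a relation. *)
Lemma normal_form_inj x xa w wa : F (normal_form x xa w wa) = 0 ->
  ideal_set (gtjac P) (normal_form x xa w wa).
Proof.
move=> n0; have trel : forall y : arr Q + V -> Lam, \sum_(s | gen_ok s) y s *: tau s = 0 ->
    exists l, forall s, gen_ok s -> y s * vtx (gen_end s) =
      match s with inl a => l * arw a | inr _ => 0 end by case: tauP.
have far0 i : i != k -> vtx i * pr x = 0 /\
    forall a, src a = k -> vtx i * pr (xa a) * vtx (tgt a) = 0.
  move=> ik; have := F_normal_form_far x xa w wa ik; rewrite n0 hom_app0 => /esym E.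
  have [|l lE] := trel (fun s => match s with inl a => vtx i * pr (xa a) | inr j => vtx i * pr x * vtx j end).
    rewrite -[RHS]E tau_sumE big_sumType addrC; congr (_ + _).
  split=> [|a ak].
    apply: (vtx_ext ik) => j jk; have /= := lE (inr j) jk.
    by rewrite -!mulrA vtx_vtx !mulrA.
  have aok : gen_ok (inl a) by apply/eqP.
  have := congr1 (fun u => vtx i * u) (lE _ aok); rewrite vtx_mul_arw // => <-.
  by rewrite !mulrA vtx_vtx.
have near0 c : src c = k -> 
    (forall j, j != k -> \sum_(r | rel_src (R r) == k) col R r c * (pr (w r) * vtx j) = 0) /\
    (forall a, src a = k -> \sum_(r | rel_src (R r) == k) col R r c * (pr (wa r a) * vtx (tgt a)) =
      if a == c then kalg (coef x k [::]) * vtx (tgt a) else 0).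
  move=> ck; have := F_normal_form_near x xa w wa ck; rewrite n0 hom_app0 => /esym E.
  have [|l lE] := trel (fun s => match s with
    | inl a => (if a == c then kalg (coef x k [::]) else 0) - \sum_(r | rel_src (R r) == k) col R r c * pr (wa r a)
    | inr j => - \sum_(r | rel_src (R r) == k) col R r c * pr (w r) * vtx j end).
    have S1 : \sum_(a | src a == k) (if a == c then kalg (coef x k [::]) else 0 : Lam) *: tau (inl a) =
        kalg (coef x k [::]) *: tau (inl c).
      rewrite (bigD1 c) ?ck //= eqxx big1 ?addr0 // => a /andP[_ /negbTE->].
      by rewrite scale0r.
    rewrite -[RHS]E big_sumType (eq_bigr (fun a => (if a == c then kalg (coef x k [::]) else 0) *: tau (inl a) -
      \sum_(r | rel_src (R r) == k) (col R r c * pr (wa r a)) *: tau (inl a))) => [|a _]; last by rewrite scalerBl scaler_suml.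
    rewrite sumrB S1 -[LHS]addrA; congr (_ + _).
    rewrite [X in _ = - X]big_split opprD [LHS]addrC; congr (_ + _); last by rewrite exchange_big.
    under [X in _ = - X]eq_bigr => r _ do rewrite tau_sumE.
    rewrite exchange_big -[RHS]sumrN; apply: eq_bigr => j _.
    by rewrite scaleNr scaler_suml.
  split=> [j jk|a ak].
    have := lE (inr j) jk; rewrite mulNr mulr_suml => /eqP; rewrite oppr_eq0 => /eqP; apply: etrans.
    by apply: eq_bigr => r _; rewrite -!mulrA vtx_vtx.
  have aok : gen_ok (inl a) by apply/eqP.
  have := congr1 (fun u => vtx (tgt c) * u) (lE _ aok); rewrite vtx_mul_arw ?k_source // mulrBl mulrBr.
  move/eqP; rewrite subr_eq0 => /eqP E1.
  transitivity (vtx (tgt c) * ((\sum_(r | rel_src (R r) == k) col R r c * pr (wa r a)) * vtx (tgt a))).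
    rewrite mulr_suml mulr_sumr; apply: eq_bigr => r _.
    by rewrite !mulrA vtx_col.
  rewrite -E1; case: eqP => [->|_]; last by rewrite mul0r mulr0.
  by rewrite mulrA -kalg_central -mulrA vtx_vtx.
have xk : coef x k [::] = 0.
  have := (near0 _ a0k).2 _ a0k; rewrite eqxx => E.
  have [y fy yE] : radn 1 (kalg (coef x k [::]) * vtx (tgt a0)).
    rewrite -E; apply: radn_sum => r _; apply: (radn_mul (m := 1) (n := 0)) (radn_all _).
    by exists (ldiv a0 (rel r)) => //; apply: ldiv_far; apply: rel_far.
  have := congr1 (eps (tgt a0)) yE; rewrite -prZ !eps_pr coefZ /idem coef_bas eqxx mulr1 => ->.
  by move/farP: fy => ->.
have wa0 r a : rel_src (R r) = k -> src a = k -> vtx (rel_tgt (R r)) * (pr (wa r a) * vtx (tgt a)) = 0.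
  move=> rk ak; apply: (columns_inj minR fdR k_source gld (z := fun r => pr (wa r a) * vtx (tgt a))) => // c ck.
  by rewrite ((near0 _ ck).2 _ ak) xk rmorph0 mul0r if_same.
have w0 r : rel_src (R r) = k -> vtx (rel_tgt (R r)) * pr (w r) = 0.
  move=> rk; apply: vtx_ext => [|j jk]; first exact: rel_tgtk.
  rewrite -mulrA; apply: (columns_inj minR fdR k_source gld (z := fun r => pr (w r) * vtx j)) => // c ck.
  exact: (near0 _ ck).1.
have idJ := tjac_ideal; apply: (idealD idJ); first apply: (idealD idJ).
- by apply: tjac_theta_vtx xk => i /far0[].
- apply: (ideal_sum idJ) => a /eqP ak.
  have -> : star_arrow a = idem K (tgt a) * star_arrow a by rewrite idem_star_arrow // eqxx.
  rewrite -theta_idem mulrA -rmorphM; apply: (idealMr idJ); apply: tjac_theta_vtx => [i ik|].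
    by rewrite rmorphM mulrA ((far0 i ik).2 _ ak).
  by rewrite coef_Midem /= (negbTE (k_source a)).
apply: (ideal_sum idJ) => r /eqP rk.
have rE : star_rel r = star_rel r * idem K (rel_tgt (R r)) by rewrite star_rel_idem // eqxx.
apply: (idealD idJ).
  rewrite rE -mulrA -theta_idem -rmorphM; apply: (idealMl idJ); apply/theta_rel/pr0.
  by rewrite rmorphM w0.
apply: (ideal_sum idJ) => a /eqP ak.
have aE : idem K (tgt a) * star_arrow a = star_arrow a by rewrite idem_star_arrow // eqxx.
rewrite [X in ideal_set _ X](_ : _ = star_rel r *
  (theta (idem K (rel_tgt (R r)) * (wa r a * idem K (tgt a))) * star_arrow a)); last first.
  by rewrite !rmorphM !theta_idem -!mulrA aE !mulrA -rE.
apply: (idealMl idJ); apply: (idealMr idJ); apply/theta_rel/pr0.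
by rewrite !rmorphM wa0.
Qed.

(** ** Every element has a normal form *)

(** Lower bounds for the lengths in the coefficients. The bound d for x is
    separate: a product with the star of a relation is controlled only if x has
    no term at e_k. *)
Definition has_normal_form d n : set (cpa K Qm) := [set z | exists x xa w wa,
  [/\ far d x, forall a, far n (xa a), forall r, far n (w r), forall r a, far n (wa r a) &
      ideal_set (gtjac P) (z - normal_form x xa w wa)]].

Lemma normal_form_linear c x x' xa xa' w w' wa wa' :
  normal_form (c *: x + x') (fun a => c *: xa a + xa' a) (fun r => c *: w r + w' r)
    (fun r a => c *: wa r a + wa' r a) =
  c *: normal_form x xa w wa + normal_form x' xa' w' wa'.
Proof.
have lin y z : theta (c *: y + z) = c *: theta y + theta z by rewrite rmorphD thetaZ.
have sumL (J : finType) (p : pred J) (f g h : J -> cpa K Qm) :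
    (forall j, p j -> f j = c *: g j + h j) ->
    \sum_(j | p j) f j = c *: (\sum_(j | p j) g j) + \sum_(j | p j) h j.
  by move=> E; rewrite (eq_bigr _ E) big_split -scaler_sumr.
rewrite /normal_form lin !scalerDr.
rewrite (sumL _ _ _ (fun a => theta (xa a) * star_arrow a) (fun a => theta (xa' a) * star_arrow a)); last first.
  by move=> a _; rewrite lin mulrDl scaleAl.
rewrite (sumL _ _ _ (fun r => star_rel r * theta (w r) +
      \sum_(a | src a == k) star_rel r * theta (wa r a) * star_arrow a)
   (fun r => star_rel r * theta (w' r) +
      \sum_(a | src a == k) star_rel r * theta (wa' r a) * star_arrow a)); last first.
  move=> r _; rewrite (sumL _ _ _ (fun a => star_rel r * theta (wa r a) * star_arrow a)
    (fun a => star_rel r * theta (wa' r a) * star_arrow a)); last first.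
    by move=> a _; rewrite lin mulrDr mulrDl scaleAl scaleAr.
  by rewrite lin mulrDr scalerDr scaleAr addrACA.
by rewrite (addrACA (c *: theta x)) [LHS]addrACA.
Qed.

Lemma normal_form_ksub d n : ksub (has_normal_form d n).
Proof.
have idJ := tjac_ideal.
split=> [|c y z [x [xa [w [wa [fx fxa fw fwa yE]]]]] [x' [xa' [w' [wa' [fx' fxa' fw' fwa' zE]]]]]].
  exists 0, (fun=> 0), (fun=> 0), (fun _ _ => 0); split=> //.
  have := normal_form_linear (-1) 0 0 (fun=> 0) (fun=> 0) (fun=> 0) (fun=> 0) (fun _ _ => 0) (fun _ _ => 0).
  rewrite !scaler0 addr0 scaleN1r addNr.
  by move=> ->; rewrite subrr; apply: ideal0.
exists (c *: x + x'), (fun a => c *: xa a + xa' a), (fun r => c *: w r + w' r),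
  (fun r a => c *: wa r a + wa' r a); split=> *; try by apply: farD => //; apply: farZ.
rewrite normal_form_linear opprD addrACA -scalerBr; apply: (idealD idJ) => //.
exact: (ksubZ _ (ideal_ksub idJ)).
Qed.

Lemma normal_form_tjac d n z : ideal_set (gtjac P) z -> has_normal_form d n z.
Proof.
move=> zJ; have [x [xa [w [wa [fx fxa fw fwa zE]]]]] := (normal_form_ksub d n).1.
exists x, xa, w, wa; split=> //; rewrite -[- normal_form _ _ _ _]sub0r.
exact: (idealD tjac_ideal).
Qed.

Lemma normal_form_mod d n y z : ideal_set (gtjac P) (y - z) ->
  has_normal_form d n z -> has_normal_form d n y.
Proof.
move=> yz nz; rewrite -(subrK z y); apply: (ksubD (normal_form_ksub d n)) nz.
exact: normal_form_tjac.
Qed.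

Lemma normal_formW d n d' n' z : (d' <= d)%N -> (n' <= n)%N ->
  has_normal_form d n z -> has_normal_form d' n' z.
Proof.
move=> dd nn [x [xa [w [wa [fx fxa fw fwa zE]]]]]; exists x, xa, w, wa.
by split=> // *; [apply: farW fx|apply: farW (fxa _)|apply: farW (fw _)|apply: farW (fwa _ _)].
Qed.

Lemma normal_form_is d n x xa w wa : far d x -> (forall a, far n (xa a)) ->
  (forall r, far n (w r)) -> (forall r a, far n (wa r a)) ->
  has_normal_form d n (normal_form x xa w wa).
Proof.
by move=> *; exists x, xa, w, wa; split=> //; rewrite subrr; apply: ideal0 tjac_ideal.
Qed.

Lemma normal_form_theta d n x : far d x -> has_normal_form d n (theta x).
Proof.
move=> fx; have := @normal_form_is d n x (fun=> 0) (fun=> 0) (fun _ _ => 0) fx.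
rewrite {1}/normal_form [X in _ + X + _]big1 ?addr0 => [|a _]; last by rewrite ?rmorph0 mul0r.
rewrite big1 ?addr0 => [|r _]; first by apply.
by rewrite ?rmorph0 ?mulr0 ?add0r; apply: big1 => a _; rewrite ?rmorph0 ?mulr0 mul0r.
Qed.

Lemma sum_single (J : finType) (p : pred J) j (f : J -> cpa K Qm) : p j ->
  (forall i, i != j -> f i = 0) -> \sum_(i | p i) f i = f j.
Proof. by move=> pj f0; rewrite (bigD1 j) //= big1 ?addr0 // => i /andP[_ /f0]. Qed.

Lemma normal_form_arrow d n x a : src a = k -> far n x ->
  has_normal_form d n (theta x * star_arrow a).
Proof.
move=> /eqP ak fx; have := @normal_form_is d n 0 (fun b => if b == a then x else 0) (fun=> 0) (fun _ _ => 0).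
rewrite {1}/normal_form rmorph0 add0r [X in _ + X]big1 ?addr0 => [|r _]; last first.
  by rewrite ?mulr0 add0r; apply: big1 => b _; rewrite ?mulr0 mul0r.
rewrite (sum_single (p := fun b => src b == k) ak) ?eqxx => [|b /negbTE ->]; last by rewrite ?rmorph0 mul0r.
by apply=> // b; case: eqP.
Qed.

Lemma normal_form_rel d n x r : rel_src (R r) = k -> far n x ->
  has_normal_form d n (star_rel r * theta x).
Proof.
move=> /eqP rk fx; have := @normal_form_is d n 0 (fun=> 0) (fun s => if s == r then x else 0) (fun _ _ => 0).
rewrite {1}/normal_form rmorph0 add0r [X in X + _]big1 ?add0r => [|a _]; last by rewrite mul0r.
rewrite (sum_single (p := fun s => rel_src (R s) == k) rk) ?eqxx => [|s /negbTE ->].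
  rewrite big1 ?addr0 => [|a _]; last by rewrite ?mulr0 mul0r.
  by apply=> // s; case: eqP.
rewrite ?rmorph0 ?mulr0 add0r; apply: big1 => b _; by rewrite mul0r.
Qed.

Lemma normal_form_both d n x r a : rel_src (R r) = k -> src a = k -> far n x ->
  has_normal_form d n (star_rel r * theta x * star_arrow a).
Proof.
move=> /eqP rk /eqP ak fx.
have := @normal_form_is d n 0 (fun=> 0) (fun=> 0) (fun s b => if (s == r) && (b == a) then x else 0).
rewrite {1}/normal_form rmorph0 add0r [X in X + _]big1 ?add0r => [|b _]; last by rewrite mul0r.
rewrite (sum_single (p := fun s => rel_src (R s) == k) rk) => [|s /negbTE sr]; last first.
  by rewrite ?mulr0 add0r; apply: big1 => b _; rewrite sr ?rmorph0 ?mulr0 mul0r.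
rewrite ?mulr0 add0r (sum_single (p := fun b => src b == k) ak) ?eqxx => [|b /negbTE ->]; last by rewrite andbF ?rmorph0 ?mulr0 mul0r.
by apply=> // s b; case: ifP.
Qed.

Lemma star_arrow_out a y : src a = k -> src y != k -> star_arrow a * aelt K (y : arr Qm) = 0.
Proof.
move=> ak yk; have -> : star_arrow a = star_arrow a * idem K k by rewrite star_arrow_idem // eqxx.
by rewrite -mulrA idem_aelt eq_sym (negbTE yk) mulr0.
Qed.

Lemma star_relation n x a r : src a = k -> rel_src (R r) = k -> far n x ->
  exists2 y, far n.+1 y & ideal_set (gtjac P) (theta x * star_arrow a * star_rel r - theta y).
Proof.
move=> ak rk fx; exists (- (x * ldiv a (rel r))).
  apply: farN; rewrite -addn1; apply: farM => //; apply: ldiv_far; exact: rel_far.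
rewrite rmorphN opprK rmorphM -mulrA -mulrDr [X in _ * X]addrC.
by apply: (idealMl tjac_ideal); apply: star_cofactor.
Qed.

Lemma arrow_cases (y : arr Qm) : [\/ ideal_set (gtjac P) (aelt K y),
  exists b, [/\ src b != k, src y = src b, up_arrow y & aelt K y = theta (aelt K b)],
  exists a, [/\ src a = k, src y = tgt a, up_arrow y = false & aelt K y = star_arrow a] |
  exists r, [/\ rel_src (R r) = k, src y = k, up_arrow y & aelt K y = star_rel r]].
Proof.
have rtk := rel_tgtk minR k_source.
case: y => [c|[a|[b|[b a]]]].
- case cE: (val c) => [b|r].
    constructor 2; exists b; split=> //; last by rewrite (theta_far_arrow cE).
      by have /andP[] := valP c; rewrite cE.
    by rewrite [LHS](_ : _ = src (val c)) // cE.
  constructor 1; apply: tjac_aelt; rewrite (mut_deg1 k_source rtk) cE //.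
- constructor 3; have [a' [ak aE sE]] := out_starE a; exists a'; split=> //.
  by rewrite [LHS](_ : _ = tgt (val a)) // aE.
- constructor 4; have [r rk rE] := in_starE b; exists r; split=> //.
by constructor 1; apply: tjac_aelt; rewrite (mut_deg1 k_source rtk).
Qed.

Lemma far_max n x b : far (maxn 1 n) x -> far (maxn 1 n.+1) (x * aelt K (b : arr Q)).
Proof.
move=> fx; apply: (farW (m := maxn 1 n + 1)); first by rewrite addn1 geq_max /= ltnS leq_maxr.
by apply: farM => //; apply: far_bas.
Qed.

(** A star followed by a star of a relation turns into a column of that relation
    by the corresponding Jacobian relation; the other products either vanish or
    are again normal forms. *)
Lemma normal_form_act n z y : has_normal_form (maxn 1 n) n z ->
  has_normal_form (maxn 1 (up_arrow y + n)) (up_arrow y + n) (z * aelt K (y : arr Qm)).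
Proof.
have idJ := tjac_ideal.
move=> [x [xa [w [wa [fx fxa fw fwa zE]]]]].
set S := has_normal_form _ _; have kS : ksub S by apply: normal_form_ksub.
suff [A B C D] : [/\ S (theta x * aelt K y),
    forall a, src a = k -> S (theta (xa a) * star_arrow a * aelt K y),
    forall r, rel_src (R r) = k -> S (star_rel r * theta (w r) * aelt K y) &
    forall r a, rel_src (R r) = k -> src a = k -> S (star_rel r * theta (wa r a) * star_arrow a * aelt K y)].
  apply: (@normal_form_mod _ _ _ (normal_form x xa w wa * aelt K y)).
    by rewrite -mulrBl; apply: (idealMr idJ).
  rewrite /normal_form !mulrDl !mulr_suml; apply: (ksubD kS); first apply: (ksubD kS) => //.
    by apply: (ksub_sum _ kS) => a /eqP /B.
  apply: (ksub_sum _ kS) => r /eqP rk; rewrite mulrDl mulr_suml; apply: (ksubD kS); first exact: C.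
  by apply: (ksub_sum _ kS) => a /eqP; apply: D.
case: (arrow_cases y) => [yJ|[b [bk yb yu yE]]|[a [ak ya yu yE]]|[r [rk yk yu yE]]].
- by split=> *; apply: normal_form_tjac; apply: (idealMl idJ).
- have S0 u a : src a = k -> S (u * star_arrow a * aelt K y).
    by move=> ak; rewrite -mulrA star_arrow_out ?yb // mulr0; case: kS.
  split=> [|a ak|r rk|r a rk ak]; try exact: S0.
    by rewrite yE -rmorphM; apply: normal_form_theta; rewrite yu; apply: far_max.
  rewrite yE -mulrA -rmorphM; apply: normal_form_rel => //.
  by rewrite yu addnC; apply: farM => //; apply: far_bas.
- have S0 u b : src b = k -> S (u * star_arrow b * aelt K y).
    by move=> bk; rewrite -mulrA star_arrow_out ?ya ?k_source // mulr0; case: kS.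
  rewrite /S yu; split=> [|b bk|r rk|r b rk bk]; try by have := @S0; rewrite /S yu; apply.
    by rewrite yE; apply: normal_form_arrow => //; apply: farW fx; apply: leq_maxr.
  by rewrite yE; apply: normal_form_both.
have tk u : far 1 u -> theta u * star_rel r = 0.
  move=> fu; have -> : star_rel r = idem K k * star_rel r by rewrite idem_star_rel // eqxx.
  rewrite -theta_idem mulrA -rmorphM source_end //.
  by move/farP: fu => -> //; rewrite scale0r rmorph0 mul0r.
rewrite /S yu add1n; split=> [|a ak|s sk|s a sk ak]; rewrite yE.
- by rewrite tk; [case: (normal_form_ksub (maxn 1 n.+1) n.+1)|apply: farW fx; apply: leq_maxl].
- have [v fv vE] := star_relation ak rk (fxa a).
  apply: normal_form_mod vE _; apply: normal_form_theta.
  by move: fv; rewrite (maxn_idPr _).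
- have -> : star_rel r = idem K k * star_rel r by rewrite idem_star_rel // eqxx.
  rewrite -theta_idem -!mulrA [theta (w s) * _]mulrA -rmorphM source_end // thetaZ theta_idem.
  rewrite -scaleAl -scaleAr mulrA star_rel_idem // [k == _]eq_sym (negbTE (rel_tgtk minR k_source s)).
  by rewrite mul0r scaler0; case: (normal_form_ksub (maxn 1 n.+1) n.+1).
have [v fv vE] := star_relation ak rk (fwa s a).
apply: (@normal_form_mod _ _ _ (star_rel s * theta v)); last exact: normal_form_rel.
rewrite -!mulrA -mulrBr; apply: (idealMl idJ); by rewrite mulrA.
Qed.

Lemma normal_form_single y : has_normal_form 1 0 (aelt K (y : arr Qm)).
Proof.
case: (arrow_cases y) => [yJ|[b [bk yb yu ->]]|[a [ak ya yu ->]]|[r [rk yk yu ->]]].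
- exact: normal_form_tjac.
- by apply: normal_form_theta; apply: far_bas.
- by rewrite -[star_arrow a]mul1r -(rmorph1 theta); apply: normal_form_arrow.
by rewrite -[star_rel r]mulr1 -(rmorph1 theta); apply: normal_form_rel.
Qed.

Local Notation up := (@up_arrow K V Q I R k).

Lemma normal_form_path i (w : seq (arr Qm)) : walk i w -> w != [::] ->
  exists n, (count up w <= n.+1)%N /\ has_normal_form (maxn 1 n) n (bas K i w).
Proof.
elim/last_ind: w i => [//|w y IH] i; rewrite -cats1 walk_cat => /andP[hw /andP[/eqP yw _]] _.
have [w0|w0] := eqVneq w [::].
  exists 0%N; split; first by rewrite w0 /= addn0; case: up_arrow.
  rewrite (_ : bas K i (w ++ [:: y]) = aelt K y); first exact: normal_form_single.
  by rewrite /aelt yw w0.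
have [n [cn nw]] := IH i hw w0; exists (up y + n)%N.
split; first by rewrite count_cat /= addn0 addnC -addnS leq_add2l.
rewrite (bas_cat_end _ _ (esym yw)) -[bas K (src y) _]/(aelt K y).
exact: (normal_form_act (n := n) y nw).
Qed.

(** By [star_twice] the normal form of a long path has coefficients in a high
    power of the arrow ideal, hence in the ideal of relations. *)
Lemma tjac_far : exists n, forall z : cpa K Qm, far n z -> ideal_set (gtjac P) z.
Proof.
have idJ := tjac_ideal; have [n fn] := rel_ideal_nil fdR.
(* A path of this length has at least n.+2 arrows raising the level, and a path
   of a single arrow is at level 0. *)
exists n.+1.*2.+2 => z; apply: far_path_ind; first exact: ideal_ksub.
  exact: closed_ideal_closed.
move=> i w hw wn; have w0 : w != [::] by case: w wn {hw}.
have [m [cm [x [xa [w' [wa [fx fxa fw fwa zE]]]]]]] := normal_form_path hw w0.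
have nm : (n <= m)%N.
  have := leq_trans wn (star_twice minR k_source hw).
  by rewrite ltnS ltn_double => /leq_trans/(_ cm); rewrite ltnS => /ltnW.
have thJ u : far m u -> ideal_set (gtjac P) (theta u).
  by move=> fu; apply/theta_rel/fn; apply: farW fu.
rewrite -(subrK (normal_form x xa w' wa) (bas K i w)); apply: (idealD idJ) => //.
apply: (idealD idJ); first apply: (idealD idJ).
- by apply: thJ; apply: farW fx; apply: leq_maxr.
- by apply: (ideal_sum idJ) => a _; apply: (idealMr idJ); apply: thJ.
apply: (ideal_sum idJ) => r _; apply: (idealD idJ); first by apply: (idealMl idJ); apply: thJ.
by apply: (ideal_sum idJ) => a _; apply: (idealMr idJ); apply: (idealMl idJ); apply: thJ.
Qed.

Lemma normal_form_exists z : has_normal_form 0 0 z.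
Proof.
have [n fn] := tjac_far; apply: (path_ind (n := n)) z; first exact: normal_form_ksub.
  by move=> z /fn; apply: normal_form_tjac.
move=> i w hw; have [->|w0] := eqVneq w [::].
  rewrite (_ : bas K i [::] = theta (idem K i)); last by rewrite theta_idem.
  exact: normal_form_theta.
have [m [_]] := normal_form_path hw w0; exact: normal_formW.
Qed.

Lemma F_kernel z : ideal_set (gtjac P) z <-> F z = 0.
Proof.
split=> [|z0]; first exact: F_tjac.
have [x [xa [w [wa [_ _ _ _ zE]]]]] := normal_form_exists z.
rewrite -(subrK (normal_form x xa w wa) z); apply: (idealD tjac_ideal) => //.
apply: normal_form_inj; rewrite -(subKr z (normal_form _ _ _ _)) (rmorphB F) z0 (F_tjac zE).
exact: subr0.
Qed.

Lemma evaluation_iso : alg_iso (qalg (gtjac P)) (endalg T).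
Proof.
apply: (qalg_iso_ker Fk) => [f|z]; last exact: F_kernel.
have [x [xa [w [wa fE]]]] := normal_form_surj f; by exists (normal_form x xa w wa).
Qed.

End Kernel.

Theorem theorem1p2 (K : closedFieldType) (V : finType) (Q : quiver V)
    (I : finType) (R : I -> qrel K Q) (k : V)
    (tau_Pk : lmodType (bound_algebra R)) (M : gqp K V) :
  connected_quiver Q ->
  minimal_rels R ->
  fin_dim (bound_algebra R) ->
  gldim_le (bound_algebra R) 2 ->
  is_source Q k ->
  ~ injective_mod (proj_at R k) ->
  is_tau_inv (proj_at R k) tau_Pk ->
  is_left_mutation k (assoc_gqp R) M ->
  alg_iso (endalg (apr_tilting k tau_Pk)) (gtruncated_jacobian M).
Proof.
move=> conn minR fdR gld k_source ninj is_tau is_mut.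
have rtk := rel_tgtk minR k_source.
have [tau tauP] := apr_presentation fdR k_source is_tau.
have [a0 a0k] := source_arrow k_source conn ninj.
have [F [Fk Fi Fa [N FN]]] := evaluation minR fdR k_source tauP.
apply: alg_iso_trans (reduced_part_iso (mut_deg01 k_source rtk) (mut_cutspan k_source rtk) is_mut).
exact/alg_iso_sym/(evaluation_iso minR fdR k_source gld tauP Fk Fi Fa FN a0k).
Qed.
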